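(* Let $n\ge2$, let $a\in L^\infty_{loc}(\mathbb{R}^n)$ be real vector-valued, and let $V\in L^1_{loc}(\mathbb{R}^n)$ be real-valued with $V\ge0$. Assume that the spectrum of $H_{a,V}$ is discrete. Then for every fixed $d>0$ $$\mu_0(Q_d)+\frac{1}{d^n}\int_{Q_d}V(x)\,dx\to+\infty\quad\text{as } Q_d\to\infty.$$
   Context: $H_{a,V}=\sum_{j=1}^n\left(\frac1i\frac{\partial}{\partial x^j}+a_j\right)^2+V$ is the magnetic Schrödinger operator in $L^2(\mathbb{R}^n)$, defined as the self-adjoint operator associated with the closure of the quadratic form $h_{a,V}(u,u)=\int_{\mathbb{R}^n}(|\nabla_a u|^2+V|u|^2)\,dx$, $u\in C_c^\infty(\mathbb{R}^n)$, where $\nabla_a u=\nabla u+iau$. Its spectrum is called discrete if it consists of isolated eigenvalues of finite multiplicity (equivalently, $H_{a,V}$ has compact resolvent). $Q_d\subset\mathbb{R}^n$ denotes a closed cube with edge length $d>0$ and edges parallel to the coordinate axes, $\overset{\circ}{Q}_d$ its interior. ''$Q_d\to\infty$'' means that the center of the cube goes to infinity with $d$ fixed. Local energy of the magnetic field: $\mu_0(Q_d)=\inf_u \frac{\int_{Q_d}|\nabla_a u|^2dx}{\int_{Q_d}|u|^2dx}$, infimum over nonzero $u\in C^\infty(\overset{\circ}{Q}_d)\cap L^2(\overset{\circ}{Q}_d)$. *)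

(* Defs.v *)
From HB Require Import structures.
From mathcomp Require Import all_boot all_order all_algebra.
From mathcomp Require Import all_classical all_reals all_analysis.
From mathcomp Require Import complex.
Set Implicit Arguments.
Unset Strict Implicit.
Unset Printing Implicit Defensive.
Import Order.TTheory GRing.Theory Num.Theory.
Import numFieldNormedType.Exports.
Local Open Scope classical_set_scope.
Local Open Scope ring_scope.

(* R^n is 'rV[R]_n, with its library topology and the product Borel
   sigma-algebra, generated by the coordinate functions. As every Lebesgue
   measurable function is a.e. equal to a Borel one, the L^p classes are the
   usual ones. *)
Section measurable_rV.
Context {R : realType} (n : nat).

Definition coord_rV (i : 'I_n) (x : 'rV[R]_n) : measurableTypeR R := x ord0 i.

Let rV_set0 : g_sigma_preimage coord_rV set0.
Proof. exact: sigma_algebra0. Qed.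

Let rV_setC A : g_sigma_preimage coord_rV A -> g_sigma_preimage coord_rV (~` A).
Proof. exact: sigma_algebraC. Qed.

Let rV_bigcup (F : _^nat) : (forall i, g_sigma_preimage coord_rV (F i)) ->
  g_sigma_preimage coord_rV (\bigcup_i (F i)).
Proof. exact: sigma_algebra_bigcup. Qed.

HB.instance Definition _ :=
  @isMeasurable.Build default_measure_display
    'rV[R]_n (g_sigma_preimage coord_rV) rV_set0 rV_setC rV_bigcup.

Lemma measurable_coord_rV (i : 'I_n) : measurable_fun setT (coord_rV i).
Proof.
move=> _ Y mY; rewrite setTI; apply: sub_sigma_algebra => /=.
rewrite -bigcup_seq/=; exists i => /=; first by rewrite mem_index_enum.
by exists Y => //; rewrite setTI.
Qed.

Lemma measurable_fun_rV d (T : measurableType d) (f : T -> 'rV[R]_n) :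
  (forall i, measurable_fun setT (coord_rV i \o f)) -> measurable_fun setT f.
Proof.
move=> mf.
suff : g_sigma_preimage (fun i => coord_rV i \o f) `<=` measurable.
  rewrite g_sigma_preimage_comp => prefS _ A mA.
  by apply: prefS; exists A.
apply: smallest_sub; first exact: sigma_algebra_measurable.
rewrite -bigcup_seq => A [i _ [B mB <-]].
exact: mf.
Qed.

End measurable_rV.

Section lebesgue_rV.
Context {R : realType} (n : nat).

Definition cons_rV (p : measurableTypeR R * 'rV[R]_n) : 'rV[R]_n.+1 :=
  row_mx (p.1 : R)%:M p.2.

Definition uncons_rV (x : 'rV[R]_n.+1) : measurableTypeR R * 'rV[R]_n :=
  (x ord0 ord0, \row_i x ord0 (lift ord0 i)).

Lemma cons_rV0 p : cons_rV p ord0 ord0 = p.1.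
Proof.
rewrite /cons_rV (_ : ord0 = lshift n (ord0 : 'I_1)); last exact/val_inj.
by rewrite (row_mxEl p.1%:M) mxE eqxx.
Qed.

Lemma cons_rVS p i : cons_rV p ord0 (lift ord0 i) = p.2 ord0 i.
Proof.
rewrite /cons_rV (_ : lift ord0 i = rshift 1 i); last exact/val_inj.
by rewrite (row_mxEr p.1%:M).
Qed.

Lemma cons_rVK : cancel cons_rV uncons_rV.
Proof.
case=> t x; congr (_, _); first exact: cons_rV0.
by apply/rowP => i; rewrite mxE cons_rVS.
Qed.

Lemma measurable_cons_rV : measurable_fun setT cons_rV.
Proof.
apply: measurable_fun_rV => i; case: (unliftP ord0 i) => [j ->|->].
- rewrite (_ : _ \o _ = coord_rV j \o snd); last first.
    by apply/funext => p /=; rewrite /coord_rV cons_rVS.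
  by apply: measurableT_comp => //; exact: measurable_coord_rV.
- rewrite (_ : _ \o _ = fst) //.
  by apply/funext => p /=; rewrite /coord_rV cons_rV0.
Qed.

Lemma measurable_uncons_rV : measurable_fun setT uncons_rV.
Proof.
apply/measurable_fun_pairP; split; first exact: (measurable_coord_rV ord0).
apply: measurable_fun_rV => i.
rewrite (_ : _ \o _ = coord_rV (lift ord0 i)); last first.
  by apply/funext => x /=; rewrite /coord_rV /= mxE.
exact: measurable_coord_rV.
Qed.

Variable m : {sigma_finite_measure set 'rV[R]_n -> \bar R}.

Definition lebesgue_rVS : set 'rV[R]_n.+1 -> \bar R :=
  pushforward (@lebesgue_measure R \x m)%E cons_rV.

Let measurable_cons_rV_preimage A : measurable A -> measurable (cons_rV @^-1` A).
Proof.
by move=> mA; rewrite -[X in measurable X]setTI; exact: measurable_cons_rV.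
Qed.

Let lebesgue_rVS0 : lebesgue_rVS set0 = 0%E.
Proof. by rewrite /lebesgue_rVS /pushforward preimage_set0 measure0. Qed.

Let lebesgue_rVS_ge0 A : (0 <= lebesgue_rVS A)%E.
Proof. by rewrite /lebesgue_rVS /pushforward measure_ge0. Qed.

Let lebesgue_rVS_sigma_additive : semi_sigma_additive lebesgue_rVS.
Proof.
move=> F mF tF mUF; rewrite /lebesgue_rVS /pushforward preimage_bigcup.
apply: measure_semi_sigma_additive.
- by move=> k; exact: measurable_cons_rV_preimage.
- apply/trivIsetP => /= i j _ _ ij; rewrite -preimage_setI.
  by move/trivIsetP : tF => /(_ _ _ _ _ ij) ->//; rewrite preimage_set0.
- by rewrite -preimage_bigcup; exact: measurable_cons_rV_preimage.
Qed.

HB.instance Definition _ := isMeasure.Build _ _ _ lebesgue_rVS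
  lebesgue_rVS0 lebesgue_rVS_ge0 lebesgue_rVS_sigma_additive.

Let lebesgue_rVS_sigma_finite : sigma_finite setT lebesgue_rVS.
Proof.
have /sigma_finiteP[F [TF ndF Foo]] := sigma_finiteT (@lebesgue_measure R).
have /sigma_finiteP[G [TG ndG Goo]] := sigma_finiteT m.
exists (fun k => uncons_rV @^-1` (F k `*` G k)).
  apply/seteqP; split => // x _.
  have [i _ Fi] : (\bigcup_i F i) (uncons_rV x).1 by rewrite -TF.
  have [j _ Gj] : (\bigcup_i G i) (uncons_rV x).2 by rewrite -TG.
  exists (maxn i j) => //; split.
  - by move: Fi; exact/subsetPset/ndF/leq_maxl.
  - by move: Gj; exact/subsetPset/ndG/leq_maxr.
move=> k; have [mF Foo_k] := Foo k; have [mG Goo_k] := Goo k; split.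
  rewrite -[X in measurable X]setTI; apply: measurable_uncons_rV => //.
  exact: measurableX.
rewrite /lebesgue_rVS /pushforward -comp_preimage.
rewrite (_ : uncons_rV \o cons_rV = id); last exact/funext/cons_rVK.
by rewrite preimage_id product_measure1E// lte_mul_pinfty// ge0_fin_numE.
Qed.

HB.instance Definition _ :=
  Measure_isSigmaFinite.Build _ _ _ lebesgue_rVS lebesgue_rVS_sigma_finite.

End lebesgue_rV.

(* Lebesgue measure on R^n: the n-fold product of lebesgue_measure, the
   measure on R^0 being the unit mass at the only point. *)
Fixpoint lebesgue_rV (R : realType) (n : nat) :
    {sigma_finite_measure set 'rV[R]_n -> \bar R} :=
  match n with
  | 0 => @dirac _ 'rV[R]_0 (0 : 'rV[R]_0) R
  | n'.+1 => lebesgue_rVS (lebesgue_rV R n')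
  end.
Arguments lebesgue_rV {R n}.

Section local_spaces.
Context {R : realType} {n : nat}.
Implicit Types f V : 'rV[R]_n -> R.

Definition ess_bounded_on (K : set 'rV[R]_n) f :=
  exists M : R, {ae lebesgue_rV, forall x, K x -> `|f x| <= M}.

Definition Linfty_loc f :=
  measurable_fun setT f /\ forall K, compact K -> ess_bounded_on K f.

Definition L1_loc f :=
  measurable_fun setT f /\
  forall K, compact K -> lebesgue_rV.-integrable K (EFin \o f).

Definition basis_rV (j : 'I_n) : 'rV[R]_n := delta_mx ord0 j.

(* partials [:: j1; ...; jk] f is the iterated partial derivative
   D_j1 (... (D_jk f)). *)
Definition partials (s : seq 'I_n) f : 'rV[R]_n -> R :=
  foldr (fun j g => 'D_(basis_rV j) g) f s.

(* Meaningful for open U: derivatives at points of U then only depend on the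
   restriction of f to U. *)
Definition smooth_on (U : set 'rV[R]_n) f :=
  forall (s : seq 'I_n) (x : 'rV[R]_n), U x ->
    {for x, continuous (partials s f)} /\
    forall j, derivable (partials s f) x (basis_rV j).

End local_spaces.

Section complex_functions.
Local Open Scope complex_scope.
Context {R : realType} {n : nat}.
Implicit Types u v : 'rV[R]_n -> R[i].

Definition csmooth_on (U : set 'rV[R]_n) u :=
  smooth_on U (fun x => complex.Re (u x)) /\
  smooth_on U (fun x => complex.Im (u x)).

Definition test_function u :=
  csmooth_on setT u /\ compact (closure [set x | u x != 0]).

Definition cpartial (j : 'I_n) u (x : 'rV[R]_n) : R[i] :=
  'D_(basis_rV j) (fun y => complex.Re (u y)) x +i*
  'D_(basis_rV j) (fun y => complex.Im (u y)) x.

(* Only used for f with integrable real and imaginary parts. *)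
Definition Cintegral (f : 'rV[R]_n -> R[i]) : R[i] :=
  (\int[lebesgue_rV]_x complex.Re (f x)) +i*
  (\int[lebesgue_rV]_x complex.Im (f x)).

Definition sqnorm_on (D : set 'rV[R]_n) u : \bar R :=
  (\int[lebesgue_rV]_(x in D) (Normc.normc (u x) ^+ 2)%:E)%E.

(* Elements of L^2(D) are represented by functions on R^n, of which only the
   values on D matter; equality in L^2 is equality almost everywhere. *)
Definition L2_on (D : set 'rV[R]_n) u :=
  [/\ measurable_fun D (fun x => complex.Re (u x)),
      measurable_fun D (fun x => complex.Im (u x)) &
      (sqnorm_on D u < +oo)%E].

Definition L2 u := L2_on setT u.

Definition sqnorm u := sqnorm_on setT u.

Definition aeq u v := {ae lebesgue_rV, forall x, u x = v x}.

Definition inner u v : R[i] := Cintegral (fun x => u x * conjc (v x)).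

End complex_functions.

(* Unbounded operators in L^2(R^n; C), given by their graph: T u f means that
   u is in the domain of T and that T u = f. *)
Section spectrum.
Local Open Scope complex_scope.
Context {R : realType} {n : nat}.

Definition operator := ('rV[R]_n -> R[i]) -> ('rV[R]_n -> R[i]) -> Prop.

Variable T : operator.

(* T - z is a bijection from the domain of T onto L^2 whose inverse is
   bounded; (T - z) u = f is written T u = f + z u. *)
Definition in_resolvent_set (z : R[i]) :=
  exists C : R, forall f, L2 f ->
    exists u, [/\ T u (fun x => f x + z * u x),
                  (sqnorm u <= C%:E * sqnorm f)%E &
                  forall w, T w (fun x => f x + z * w x) -> aeq w u].

Definition spectrum : set R[i] := [set z | ~ in_resolvent_set z].

Definition eigenfunction (z : R[i]) (u : 'rV[R]_n -> R[i]) :=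
  T u (fun x => z * u x).

Definition eigenvalue (z : R[i]) :=
  exists u, eigenfunction z u /\ ~ aeq u (fun=> 0).

Definition finite_multiplicity (z : R[i]) :=
  exists (N : nat) (e : 'I_N -> 'rV[R]_n -> R[i]),
    (forall k, eigenfunction z (e k)) /\
    forall u, eigenfunction z u ->
      exists c : 'I_N -> R[i], aeq u (fun x => \sum_(k < N) c k * e k x).

Definition isolated_in_spectrum (z : R[i]) :=
  exists2 r : R, 0 < r &
    forall w, spectrum w -> w != z -> r <= Normc.normc (w - z).

Definition discrete_spectrum :=
  forall z, spectrum z ->
    [/\ isolated_in_spectrum z, eigenvalue z & finite_multiplicity z].

End spectrum.

Section magnetic_schrodinger.
Local Open Scope complex_scope.
Context {R : realType} {n : nat}.
Variables (a : 'rV[R]_n -> 'rV[R]_n) (V : 'rV[R]_n -> R).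
Implicit Types u v f : 'rV[R]_n -> R[i].

(* The j-th component of grad u + i a u. *)
Definition magnetic_partial (j : 'I_n) u (x : 'rV[R]_n) : R[i] :=
  cpartial j u x + (0 +i* a x ord0 j) * u x.

Definition magnetic_energy_density u (x : 'rV[R]_n) : R :=
  \sum_(j < n) Normc.normc (magnetic_partial j u x) ^+ 2.

(* The sesquilinear form on test functions with
   h(u, u) = \int (|grad_a u|^2 + V |u|^2) *)
Definition magnetic_form u v : R[i] :=
  Cintegral (fun x =>
    \sum_(j < n) magnetic_partial j u x * conjc (magnetic_partial j v x) +
    (V x)%:C * u x * conjc (v x)).

(* us is an h-Cauchy sequence of test functions with limit u in L^2; the
   closure of the form has as domain the limits of such sequences. *)
Definition form_approximates (us : nat -> 'rV[R]_n -> R[i]) u :=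
  [/\ forall k, test_function (us k),
      L2 u,
      (fun k => sqnorm (us k \- u)) @ \oo --> 0%E &
      forall eps : R, 0 < eps -> exists N : nat, forall k l : nat,
        (N <= k)%N -> (N <= l)%N ->
        complex.Re (magnetic_form (us k \- us l) (us k \- us l)) < eps].

Definition closed_form_domain u := exists us, form_approximates us u.

(* The graph of the closed form: u and v are in its domain and its value at
   (u, v) is z. *)
Definition closed_form u v (z : R[i]) :=
  exists us vs, [/\ form_approximates us u, form_approximates vs v &
    (fun k => Normc.normc (magnetic_form (us k) (vs k) - z)) @ \oo --> (0 : R)].

(* The operator associated with the closed form by the representation
   theorem: H u = f iff u is in the form domain and h(u, v) = (f, v) for all
   v in the form domain. *)
Definition magnetic_schrodinger : @operator R n := fun u f =>
  [/\ closed_form_domain u, L2 f &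
      forall v, closed_form_domain v -> closed_form u v (inner f v)].

End magnetic_schrodinger.

Section local_energy.
Context {R : realType} {n : nat}.

Definition cube (c : 'rV[R]_n) (d : R) : set 'rV[R]_n :=
  [set x | forall i, `|x ord0 i - c ord0 i| <= d / 2].

(* Integrals run over the interior of Q, where u is defined; for a cube the
   boundary is a null set. *)
Definition rayleigh_quotient (a : 'rV[R]_n -> 'rV[R]_n) (Q : set 'rV[R]_n)
    (u : 'rV[R]_n -> R[i]) : \bar R :=
  (\int[lebesgue_rV]_(x in Q°) (magnetic_energy_density a u x)%:E *
   ((fine (sqnorm_on Q° u))^-1)%:E)%E.

Definition local_energy (a : 'rV[R]_n -> 'rV[R]_n) (Q : set 'rV[R]_n) : \bar R :=
  ereal_inf [set rayleigh_quotient a Q u | u in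
    [set u | [/\ csmooth_on Q° u, L2_on Q° u &
                 exists2 x, Q° x & u x != 0]]].

End local_energy.

(* Main.v *)
Require Import Defs.
From HB Require Import structures.
From mathcomp Require Import all_boot all_order all_algebra.
From mathcomp Require Import all_classical all_reals all_analysis.
From mathcomp Require Import measurable_realfun.
From mathcomp Require Import complex ring lra.
Set Implicit Arguments.
Unset Strict Implicit.
Unset Printing Implicit Defensive.
Import Order.TTheory GRing.Theory Num.Theory.
Import numFieldNormedType.Exports.
Local Open Scope classical_set_scope.
Local Open Scope ring_scope.

(* Suppose mu_0(Q) + d^-n int_Q V < M for cubes Q of edge d going arbitrarily
   far. Then Q carries a test function phi with
   h(phi, phi) <= K |phi|^2, where K depends on d, M and n only: a function u
   almost minimizing int_Q |grad_a u|^2 / int_Q |u|^2 is, on some subcube,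
   nearly of constant modulus, since |D_j |u|^2| <= 2 |u| |(grad_a u)_j| (the
   diamagnetic argument, applied to |u|^2, with the L^1 Poincare inequality).
   With m the mean of |u|^2 on that subcube, u / (m + |u|^2) is bounded, which
   is what int V |phi|^2 needs when only int_Q V is controlled; phi is this
   function times a cutoff.

   Disjoint cubes give a space of test functions of arbitrarily large dimension
   on which h <= K |.|^2. This contradicts discreteness: B = (H + 1)^-1 is
   bounded, symmetric and nonnegative, with (B phi, phi) >= |phi|^2 / (1 + K)
   on that space, so the infimum m of the bounds of B on the orthogonal
   complements of finite families is positive. Then B - m has approximate
   kernel vectors orthogonal to any finite family, whereas for an isolated
   eigenvalue of finite multiplicity B - m is bounded below on the orthogonal
   complement of its kernel.

   To identify H with its resolvent, h must have a well-defined value on limits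
   of h-Cauchy sequences, i.e. be closable. If w_k -> 0 in L^2 is h-Cauchy, the
   difference quotients of w_k tend to 0 in L^1_loc and approximate D_j w_k
   uniformly in k, so D_j w_k -> 0 in L^1_loc; hence h(w_k, chi) -> 0 for a
   fixed test function chi, and h(w_k, w_k) -> 0.

   Everything is done in the underlying real Hilbert space, with the real part
   of the inner product. *)

(** * Symmetric operators without essential spectrum *)

(** A small subcube is used because the energy bound controls int |grad |u|^2| only by a fixed
    multiple of int |u|^2, with no smallness, while the Poincare constant is proportional to the
    edge. Cutting a cube into a number of subcubes that depends on d, M and n alone keeps the energy
    ratio on at least one of them. With w = |u|^2, the function w / (m + w)^2 is maximal at w = m
    and falls short of its maximum by at most a multiple of |w - m|, which is what an L^1 estimate
    controls. Energy, potential term and squared norm of phi all scale like 1 / m, so K is free of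
    u. On the operator side, isolation of an eigenvalue bounds each B - m - z from below separately,
    with constants that may degenerate as z varies. The difficulty is to extract one gap around 0
    for B - m; it is met with squares and Cauchy-Schwarz for nonnegative forms. The existence of B
    comes from discreteness too: were -1 in the spectrum, it would be an eigenvalue of a nonnegative
    operator. *)

Lemma quadratic_ge0_discriminant {R : realType} (A B C : R) : 0 <= C ->
  (forall t, 0 <= A + 2 * t * B + t ^+ 2 * C) -> B ^+ 2 <= A * C.
Proof.
rewrite le_eqVlt => /orP[/eqP <-|C0] h.
  have [->|B0] := eqVneq B 0; first by rewrite expr0n mulr0.
  (* The affine function of [t] takes the value -1 there. *)
  have := h (- (A + 1) / (2 * B)).
  rewrite mulr0 addr0 -mulrA (_ : - (A + 1) / (2 * B) * B = - (A + 1) / 2); last by field.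
  by lra.
have := h (- B / C).
rewrite (_ : _ + _ = (A * C - B ^+ 2) / C); last by field; rewrite gt_eqF.
by rewrite pmulr_lge0 ?invr_gt0// subr_ge0.
Qed.

Lemma sqr_lt {R : realType} (x y : R) : 0 <= y -> x ^+ 2 < y ^+ 2 -> x < y.
Proof. by move=> y0 xy; rewrite ltNge; apply/negP => yx; nra. Qed.

Lemma small_geometric {R : realType} (K q e : R) : 0 <= q -> q < 1 -> 0 < e ->
  exists N, forall k, (N <= k)%N -> K * q ^+ k <= e.
Proof.
move=> q0 q1 e0.
have : (fun k => K * q ^+ k) @ \oo --> (0 : R).
  rewrite -(mulr0 K); apply: cvgMr; apply: cvg_expr.
  by rewrite ger0_norm.
move/cvgrPdist_le => /(_ _ e0)[N _ hN]; exists N => k /hN /=.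
by rewrite sub0r normrN; apply: le_trans; rewrite ler_norm.
Qed.

Section hilbert.
Context {R : realType} {X : lmodType R} (ip : X -> X -> R).
Hypothesis ipC : forall x y, ip x y = ip y x.
Hypothesis ipl : forall a x y z, ip (a *: x + y) z = a * ip x z + ip y z.
Hypothesis ip_ge0 : forall x, 0 <= ip x x.
Hypothesis ip_eq0 : forall x, ip x x = 0 -> x = 0.

Definition nsq x := ip x x.

Lemma ip0l z : ip 0 z = 0.
Proof. by have := ipl 1 0 0 z; rewrite scaler0 addr0 mul1r; lra. Qed.

Lemma ipZl a x z : ip (a *: x) z = a * ip x z.
Proof. by rewrite -[a *: x]addr0 ipl ip0l addr0. Qed.

Lemma ipDl x y z : ip (x + y) z = ip x z + ip y z.
Proof. by rewrite -[x in x + y]scale1r ipl mul1r. Qed.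

Lemma ipNl x z : ip (- x) z = - ip x z.
Proof. by rewrite -scaleN1r ipZl mulN1r. Qed.

Lemma ipBl x y z : ip (x - y) z = ip x z - ip y z.
Proof. by rewrite ipDl ipNl. Qed.

Lemma ipZr a x z : ip z (a *: x) = a * ip z x.
Proof. by rewrite ipC ipZl ipC. Qed.

Lemma ipDr x y z : ip z (x + y) = ip z x + ip z y.
Proof. by rewrite ipC ipDl !(ipC z). Qed.

Lemma ipNr x z : ip z (- x) = - ip z x.
Proof. by rewrite ipC ipNl ipC. Qed.

Definition ipE := (ipDl, ipDr, ipNl, ipNr, ipZl, ipZr).

Lemma cauchy_schwarz x y : ip x y ^+ 2 <= nsq x * nsq y.
Proof.
apply: quadratic_ge0_discriminant; first exact: ip_ge0.
move=> t; have := ip_ge0 (x + t *: y); rewrite !ipE (ipC y x) /nsq.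
by move/le_trans; apply; rewrite le_eqVlt; apply/orP; left; apply/eqP; ring.
Qed.

Lemma ip_inj x y : (forall z, ip x z = ip y z) -> x = y.
Proof.
move=> h; apply/eqP; rewrite -subr_eq0; apply/eqP/ip_eq0.
by rewrite ipBl h subrr.
Qed.

Lemma nsq_gt0 x : x != 0 -> 0 < nsq x.
Proof.
move=> x0; rewrite lt_def ip_ge0 andbT; apply: contra_neq x0; exact: ip_eq0.
Qed.

Lemma nsqZ a x : nsq (a *: x) = a ^+ 2 * nsq x.
Proof. by rewrite /nsq !ipE; ring. Qed.

Lemma nsqN x : nsq (- x) = nsq x.
Proof. by rewrite /nsq !ipE; ring. Qed.

Lemma nsqD_le x y : nsq (x + y) <= 2 * nsq x + 2 * nsq y.
Proof.
have := ip_ge0 (x - y); rewrite /nsq !ipE (ipC y x); lra.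
Qed.

Lemma nsq0 : nsq 0 = 0.
Proof. by rewrite /nsq ip0l. Qed.

(** Completeness is phrased with squared norms and geometrically small steps: every Cauchy sequence
    has such a subsequence, and the iteration in [gap_lower_bound] has this form directly. *)
Definition complete_nsq := forall (f : nat -> X) (K q : R), 0 <= q -> q < 1 ->
  (forall k, nsq (f k.+1 - f k) <= K * q ^+ k) ->
  exists x, forall e : R, 0 < e -> exists N, forall k, (N <= k)%N ->
    nsq (f k - x) <= e.

Definition bounded_below (L : X -> X) :=
  exists2 c : R, 0 < c & forall x, c * nsq x <= nsq (L x).

(** By symmetry the defect of linearity is orthogonal to every vector, in particular to itself. The
    resolvent is later obtained by choice, and its linearity is read off from here. *)
Lemma symmetric_linear (B : X -> X) : (forall x y, ip (B x) y = ip x (B y)) ->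
  forall a x y, B (a *: x + y) = a *: B x + B y.
Proof.
move=> Bsym a x y; apply/eqP; rewrite -subr_eq0; apply/eqP/ip_eq0.
set z := (X in ip _ X).
by rewrite !ipE !Bsym !ipE; ring.
Qed.

Section symmetric.
Variable (D : X -> X).
Hypothesis Dsym : forall x y, ip (D x) y = ip x (D y).

Let Dlin := symmetric_linear Dsym.

Lemma sym0 : D 0 = 0.
Proof. by have := Dlin (-1) 0 0; rewrite scaleN1r addr0 oppr0 scaleN1r addNr. Qed.

Lemma symZ a x : D (a *: x) = a *: D x.
Proof. by rewrite -[a *: x]addr0 Dlin sym0 addr0. Qed.

Lemma symD x y : D (x + y) = D x + D y.
Proof. by rewrite -[x in x + y]scale1r Dlin scale1r. Qed.

Lemma symN x : D (- x) = - D x.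
Proof. by rewrite -scaleN1r symZ scaleN1r. Qed.

Lemma symB x y : D (x - y) = D x - D y.
Proof. by rewrite symD symN. Qed.

Variables (l r : R).
Hypothesis l0 : 0 <= l.
Hypothesis Dl : forall x, nsq (D x) <= l * nsq x.

Let sq_shift c x := D (D x) - c *: x.

Lemma sq_shift_sym c x y : ip (sq_shift c x) y = ip x (sq_shift c y).
Proof. by rewrite /sq_shift !ipE !Dsym. Qed.

(* If D^2 - c were not bounded below by c, then the infimum nu < c^2 of
   |(D^2 - c) x|^2 / |x|^2 would be approximately attained, so that
   (D^2 - c)^2 - nu, a product of four factors D - z with 0 < |z| < r, would
   not be bounded below. *)
Lemma square_gap : 0 < r ->
  (forall z : R, z != 0 -> `|z| < r -> bounded_below (fun x => D x - z *: x)) ->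
  forall x, r ^+ 2 * nsq (D x) <= nsq (D (D x)).
Proof.
move=> r0 bb.
(* [c] is the midpoint of [0, r^2]: expanding |(D^2 - c) x|^2 >= c^2 |x|^2 gives |D^2 x|^2 >= 2 c |D
   x|^2, which is the claim. *)
pose c := r ^+ 2 / 2; have c0 : 0 < c by rewrite divr_gt0// exprn_gt0.
have [L LE] : {L | L = sq_shift c} by exists (sq_shift c).
have Lsym x y : ip (L x) y = ip x (L y) by rewrite LE sq_shift_sym.
suff Lc x : c ^+ 2 * nsq x <= nsq (L x).
  move=> x; have := Lc x.
  rewrite /nsq LE /sq_shift !ipE (Dsym (D x) x) -(ipC (D (D x)) x) (Dsym (D x) x).
  rewrite /c; lra.
apply: contrapT => /negP; rewrite -ltNge => xc.
have x0 : x != 0.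
  by apply: contraTneq xc => ->; rewrite nsq0 mulr0 -leNgt; exact: ip_ge0.
pose S := [set nsq (L y) / nsq y | y in [set y | y != 0]].
have S0 : has_inf S.
  split; first by exists (nsq (L x) / nsq x), x.
  by exists 0 => _ [y y0 <-]; rewrite divr_ge0 ?ip_ge0.
pose nu := inf S.
have nu_ge0 : 0 <= nu.
  apply: lb_le_inf; first by case: S0.
  by move=> _ [y y0 <-]; rewrite divr_ge0 ?ip_ge0.
have nule y : nu * nsq y <= nsq (L y).
  have [->|y0] := eqVneq y 0; first by rewrite nsq0 mulr0 ip_ge0.
  rewrite -ler_pdivlMr ?nsq_gt0//; apply: ge_inf; first by case: S0.
  by exists y.
have nuc : nu < c ^+ 2.
  rewrite -(ltr_pM2r (nsq_gt0 x0)); apply: le_lt_trans xc; exact: nule.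
pose mu := Num.sqrt nu.
have mu2 : mu ^+ 2 = nu by rewrite sqr_sqrtr.
have mu0 : 0 <= mu by rewrite sqrtr_ge0.
have muc : mu < c by apply: sqr_lt; rewrite ?mu2// ltW.
(* D^2 - t = (D - z) (D + z) with z = sqrt t < r, and both factors are bounded below. *)
have bbL t : 0 < t -> t < r ^+ 2 ->
    exists2 c', 0 < c' & forall y, c' * nsq y <= nsq (sq_shift t y).
  move=> t0 tr; pose z := Num.sqrt t.
  have z2 : z ^+ 2 = t by rewrite sqr_sqrtr// ltW.
  have z0 : 0 < z by rewrite sqrtr_gt0.
  have zr : z < r by apply: sqr_lt; rewrite ?z2// ltW.
  have [|c1 c1p h1] := bb z (lt0r_neq0 z0); first by rewrite gtr0_norm.
  have [||c2 c2p h2] := bb (- z); first by rewrite oppr_eq0 (lt0r_neq0 z0).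
    by rewrite normrN gtr0_norm.
  exists (c1 * c2); first exact: mulr_gt0.
  move=> y; rewrite -mulrA; apply: (le_trans (ler_wpM2l (ltW c1p) (h2 y))).
  apply: (le_trans (h1 _)); rewrite /sq_shift -z2.
  rewrite symB symZ !scaleNr !opprK scalerDr scalerA -expr2 opprD addrA addrK.
  by [].
(* L^2 - nu = (L - mu) (L + mu), with factors D^2 - (c + mu) and D^2 - (c - mu); both shifts lie
   strictly between 0 and r^2 because mu < c. *)
have [c1 c1p h1] : exists2 c', 0 < c' &
    forall y, c' * nsq y <= nsq (sq_shift (c - mu) y).
  by apply: bbL; rewrite /c in muc *; lra.
have [c2 c2p h2] : exists2 c', 0 < c' &
    forall y, c' * nsq y <= nsq (sq_shift (c + mu) y).
  by apply: bbL; rewrite /c in muc *; lra.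
pose ll := 2 * l ^+ 2 + 2 * c ^+ 2 + 1.
have ll0 : 0 < ll by rewrite /ll; have := sqr_ge0 l; have := sqr_ge0 c; lra.
have Lll y : nsq (L y) <= ll * nsq y.
  rewrite LE; apply: (le_trans (nsqD_le _ _)); rewrite nsqN nsqZ.
  have h3 : nsq (D (D y)) <= l ^+ 2 * nsq y.
    by apply: (le_trans (Dl _)); rewrite expr2 -mulrA ler_wpM2l.
  rewrite /ll; have := ip_ge0 y; rewrite -/(nsq y); lra.
have key y : c1 * c2 * nsq y <= ll * (nsq (L y) - nu * nsq y).
  pose w := L (L y) - nu *: y.
  have wE : w = sq_shift (c - mu) (sq_shift (c + mu) y).
    apply: ip_inj => v; rewrite /w LE /sq_shift !(symB, symZ) -mu2 !ipE; ring.
  have hw : c1 * c2 * nsq y <= nsq w.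
    rewrite wE -mulrA; apply: (le_trans (ler_wpM2l (ltW c1p) (h2 y))).
    exact: h1.
  apply: (le_trans hw).
  (* [Y] is nonnegative by the choice of nu, and |w|^2 = Y(y, w). Hence |w|^4 <= Y(y, y) Y(w, w) <=
     Y(y, y) ll |w|^2, so the lower bound for w pushes the infimum above nu. *)
  pose Y u v := ip (L u) (L v) - nu * ip u v.
  have wY : nsq w = Y y w.
    by rewrite /nsq {1}/w ipBl ipZl Lsym.
  have YCS : Y y w ^+ 2 <= Y y y * Y w w.
    apply: quadratic_ge0_discriminant.
      by rewrite /Y subr_ge0; exact: nule.
    move=> t; have := nule (y + t *: w); rewrite -subr_ge0.
    have -> : L (y + t *: w) = L y + t *: L w.
      by rewrite addrC (symmetric_linear Lsym) addrC.
    rewrite /Y /nsq.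
    move: (w) => v; rewrite !ipE (ipC v y) (ipC (L v)).
    by move/le_trans; apply; rewrite le_eqVlt; apply/orP; left; apply/eqP; ring.
  have [->|w0] := eqVneq w 0.
    by rewrite nsq0 mulr_ge0 ?(ltW ll0)// subr_ge0.
  have wp := nsq_gt0 w0.
  have Yw : Y w w <= ll * nsq w.
    rewrite /Y -/(nsq w) -/(nsq (L w)); apply: le_trans (Lll w).
    by rewrite gerBl mulr_ge0// ltW.
  rewrite -(ler_pM2r wp) -expr2 {1}wY.
  apply: (le_trans YCS); rewrite -/(nsq y) {1}/Y -/(nsq (L y)) -/(nsq y).
  rewrite mulrAC mulrC; apply: ler_wpM2r => //.
  by rewrite subr_ge0.
have : nu + c1 * c2 / ll <= nu.
  apply: lb_le_inf; first by case: S0.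
  move=> _ [y y0 <-]; rewrite ler_pdivlMr ?nsq_gt0//.
  have := key y; rewrite -ler_pdivrMl// => h; move: h.
  rewrite [X in X <= _](_ : _ = c1 * c2 / ll * nsq y); first by lra.
  by rewrite mulrA (mulrC ll^-1).
by rewrite gerDl leNgt divr_gt0// mulr_gt0.
Qed.

(* The iterates of 1 - tau D^2 converge to the orthogonal projection onto the
   kernel of D, which vanishes on the orthogonal complement of E. *)
Lemma gap_lower_bound (E : set X) : complete_nsq -> 0 < r ->
  (forall x, r ^+ 2 * nsq (D x) <= nsq (D (D x))) ->
  (forall e, E e -> D e = 0) ->
  (forall x, D x = 0 -> (forall e, E e -> ip e x = 0) -> x = 0) ->
  exists2 c : R, 0 < c & forall x, (forall e, E e -> ip e x = 0) ->
    c * nsq x <= nsq (D x).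
Proof.
move=> cX r0 gap EK KE; have l0' := l0.
have r20 : 0 < r ^+ 2 by rewrite exprn_gt0.
(* A step size with t l <= 1, so that t^2 |D^3 y|^2 <= t |D^2 y|^2, and with t r^2 < 1. On the range
   of D one step then multiplies the squared norm by at most q = 1 - t r^2. *)
pose t := (l + r ^+ 2 + 1)^-1.
have tV : 0 < l + r ^+ 2 + 1 by lra.
have t0 : 0 < t by rewrite invr_gt0.
have tl : t * l <= 1 by rewrite mulrC ler_pdivrMr//; lra.
have tr : t * r ^+ 2 < 1 by rewrite mulrC ltr_pdivrMr//; lra.
pose q := 1 - t * r ^+ 2.
have q0 : 0 <= q by rewrite /q; lra.
have q1 : q < 1 by rewrite /q gtrBl mulr_gt0.
pose p := Num.sqrt q.
have p2 : p ^+ 2 = q by rewrite sqr_sqrtr.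
have p0 : 0 <= p by rewrite sqrtr_ge0.
have p1 : p < 1 by apply: sqr_lt => //; rewrite p2 expr1n.
pose T x := x - t *: D (D x).
have TD k x : iter k T (D x) = D (iter k T x).
  by elim: k => //= k ->; rewrite /T !(symB, symZ).
have Tq k x : nsq (iter k T (D x)) <= q ^+ k * nsq (D x).
  elim: k => [|k IH] /=; first by rewrite expr0 mul1r.
  rewrite exprS -mulrA; apply: le_trans (ler_wpM2l q0 IH).
  rewrite TD; set y := iter k T x.
  have -> : nsq (T (D y)) = nsq (D y) - 2 * t * nsq (D (D y))
     + t ^+ 2 * nsq (D (D (D y))).
    rewrite /nsq /T !ipE (Dsym (D (D y)) (D y)) -(ipC (D (D (D y))) (D y)).
    by rewrite (Dsym (D (D y)) (D y)); ring.
  have h1 : t ^+ 2 * nsq (D (D (D y))) <= t * nsq (D (D y)).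
    rewrite expr2 -mulrA ler_wpM2l ?(ltW t0)//.
    apply: (le_trans (ler_wpM2l (ltW t0) (Dl _))).
    by rewrite mulrA ler_piMl// ip_ge0.
  have h2 := ler_wpM2l (ltW t0) (gap y).
  rewrite /q; lra.
have pT k x : ip (iter k T (D x)) (D x) <= p ^+ k * nsq (D x).
  have pk0 : 0 <= p ^+ k by rewrite exprn_ge0.
  have n0 : 0 <= nsq (D x) by exact: ip_ge0.
  rewrite leNgt; apply/negP => h.
  have := cauchy_schwarz (iter k T (D x)) (D x).
  apply/negP; rewrite -ltNge.
  apply: (@le_lt_trans _ _ ((p ^+ k * nsq (D x)) ^+ 2)).
    rewrite exprMn -exprM mulnC exprM p2 expr2 mulrA.
    by rewrite ler_wpM2r.
  by rewrite ltr_pXn2r ?nnegrE// ?mulr_ge0//; apply: ltW; apply: le_lt_trans h; rewrite mulr_ge0.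
exists ((1 - p) / t); first by rewrite divr_gt0// subr_gt0.
move=> x xE.
have [u hu] : exists u, forall e : R, 0 < e -> exists N, forall k, (N <= k)%N ->
    nsq (iter k T x - u) <= e.
  apply: (cX _ (t ^+ 2 * l * nsq (D x)) q) => // k.
  rewrite /= {1}/T addrAC subrr add0r nsqN nsqZ -TD.
  rewrite [leRHS](_ : _ = t ^+ 2 * (l * (q ^+ k * nsq (D x)))); last by ring.
  apply: ler_wpM2l; first exact: sqr_ge0.
  by apply: (le_trans (Dl _)); apply: ler_wpM2l.
have small (a : R) : 0 <= a -> (forall e : R, 0 < e -> a <= e) -> a = 0.
  move=> a0 h; apply/eqP; rewrite eq_le a0 andbT leNgt; apply/negP => ap.
  by have := h (a / 2); rewrite divr_gt0// => /(_ isT); lra.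
have Du : D u = 0.
  apply: ip_eq0; apply: small; first exact: ip_ge0.
  move=> e e0.
  have [|N1 h1] := hu (e / (4 * (l + 1))); first by rewrite divr_gt0// mulr_gt0//; lra.
  have e4 : 0 < e / 4 by lra.
  have [N2 h2] := small_geometric (nsq (D x)) q0 q1 e4.
  pose k := maxn N1 N2.
  rewrite -/(nsq (D u)) (_ : D u = - D (iter k T x - u) + iter k T (D x)); last first.
    by rewrite TD symB opprB subrK.
  apply: (le_trans (nsqD_le _ _)); rewrite nsqN.
  have {}h1 := h1 _ (leq_maxl N1 N2); have {}h2 := h2 _ (leq_maxr N1 N2).
  have b1 : nsq (D (iter k T x - u)) <= e / 4.
    apply: (le_trans (Dl _)).
    apply: (@le_trans _ _ ((l + 1) * (e / (4 * (l + 1))))).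
      apply: ler_pM => //; [exact: ip_ge0|by lra].
    by rewrite le_eqVlt; apply/orP; left; apply/eqP; field; rewrite gt_eqF//; lra.
  have b2 : nsq (iter k T (D x)) <= e / 4.
    by apply: (le_trans (Tq k x)); rewrite mulrC.
  lra.
have kE k e : E e -> ip e (iter k T x) = 0.
  move=> Ee; elim: k => [|k IH] /=; first exact: xE.
  by rewrite /T !ipE IH -!Dsym (EK _ Ee) sym0 ip0l mulr0 subr0.
have u0 : u = 0.
  apply: KE => // e Ee; apply/eqP; rewrite -sqrf_eq0; apply/eqP.
  apply: small; first exact: sqr_ge0.
  move=> d d0; have [|N h] := hu (d / (nsq e + 1)).
    by rewrite divr_gt0//; have := ip_ge0 e; rewrite /nsq; lra.
  have {}h := h N (leqnn _).
  have -> : ip e u = - ip e (iter N T x - u) by rewrite !ipE kE// add0r opprK.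
  rewrite sqrrN; apply: (le_trans (cauchy_schwarz _ _)).
  apply: (@le_trans _ _ ((nsq e + 1) * (d / (nsq e + 1)))).
    by apply: ler_pM; rewrite ?ip_ge0//; lra.
  rewrite mulrC divfK// gt_eqF//; have := ip_ge0 e; rewrite /nsq; lra.
(* Telescoping of x - T x = t D^2 x. The summands decay like p^j |D x|^2, so |x|^2 <= t / (1 - p) |D
   x|^2 once T^k x tends to 0. *)
have sum k : ip (x - iter k T x) x = t * \sum_(j < k) ip (iter j T (D x)) (D x).
  elim: k => [|k IH]; first by rewrite big_ord0 subrr ip0l mulr0.
  rewrite big_ord_recr mulrDr -IH /= {1}/T TD -Dsym !ipE; ring.
have sumle k : ip (x - iter k T x) x <= t / (1 - p) * nsq (D x).
  rewrite sum -mulrA ler_wpM2l ?(ltW t0)//.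
  have p1' : 0 < 1 - p by rewrite subr_gt0.
  apply: (@le_trans _ _ (\sum_(j < k) p ^+ j * nsq (D x))).
    by apply: ler_sum => j _; exact: pT.
  rewrite -mulr_suml ler_wpM2r ?ip_ge0// -(ler_pM2l p1').
  rewrite -[X in X * _]opprB mulNr -subrX1 opprB divff ?gt_eqF//.
  by rewrite gerBl exprn_ge0.
rewrite mulrAC ler_pdivrMr// mulrC -ler_pdivlMr ?subr_gt0// mulrAC mulrC.
rewrite mulrC mulrAC.
apply/ler_addgt0Pr => e e0.
have [|N h] := hu (e ^+ 2 / (nsq x + 1)).
  by rewrite divr_gt0// ?exprn_gt0//; have := ip_ge0 x; rewrite /nsq; lra.
have {}h := h N (leqnn _); rewrite u0 subr0 in h.
have h2 : ip (iter N T x) x <= e.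
  rewrite leNgt; apply/negP => h3.
  have h4 : e ^+ 2 < ip (iter N T x) x ^+ 2.
    by rewrite ltr_pXn2r// nnegrE ltW//; apply: lt_trans h3.
  have h5 : nsq (iter N T x) * (nsq x + 1) <= e ^+ 2.
    by rewrite -ler_pdivlMr//; have := ip_ge0 x; rewrite /nsq; lra.
  have := cauchy_schwarz (iter N T x) x.
  have := ip_ge0 (iter N T x); rewrite -/(nsq _); lra.
have := sumle N; rewrite ipBl -/(nsq x); lra.
Qed.

End symmetric.

(** The alternative in the hypotheses says that k is in the resolvent set of B, or is isolated with
    an eigenspace generated by finitely many vectors. It covers k > 0 only, since at 0 the spectrum
    of a compact operator may accumulate; [k0] keeps the critical value [m], the top of the
    essential spectrum of B, away from 0. *)
Lemma no_bounded_form_subspaces (B : X -> X) (b k0 : R) : complete_nsq ->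
  (forall x y, ip (B x) y = ip x (B y)) -> (forall x, 0 <= ip (B x) x) ->
  0 <= b -> (forall x, nsq (B x) <= b * nsq x) -> 0 < k0 ->
  (forall k : R, 0 < k -> bounded_below (fun x => B x - k *: x) \/
    (exists2 r : R, 0 < r & forall z : R, z != 0 -> `|z| < r ->
      bounded_below (fun x => B x - (k + z) *: x)) /\
    exists E : seq X, (forall e, e \in E -> B e = k *: e) /\
      forall x, B x = k *: x -> (forall e, e \in E -> ip e x = 0) -> x = 0) ->
  (forall E : seq X, exists2 x, x != 0 & (forall e, e \in E -> ip e x = 0) /\
      k0 * nsq x <= ip (B x) x) -> False.
Proof.
move=> cX Bsym Bge0 b0 Bb k00 disc infdim.
pose P c (E : seq X) := forall f, (forall e, e \in E -> ip e f = 0) ->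
  nsq (B f) <= c ^+ 2 * nsq f.
pose S := [set c : R | 0 <= c /\ exists E, P c E].
have k0S (c : R) : S c -> k0 <= c.
  move=> [c0 [E cE]]; rewrite leNgt; apply/negP => ck.
  have [x x0 [xE xk]] := infdim E.
  have := cE _ xE; apply/negP; rewrite -ltNge.
  have h := cauchy_schwarz (B x) x.
  have xp := nsq_gt0 x0.
  rewrite -(ltr_pM2r xp); apply: lt_le_trans h.
  apply: (@lt_le_trans _ _ ((k0 * nsq x) ^+ 2)); last first.
    by rewrite ler_pXn2r ?nnegrE// mulr_ge0 ?ltW.
  rewrite -mulrA -expr2 -exprMn ltr_pXn2r ?nnegrE ?mulr_ge0 ?(ltW xp) ?(ltW k00)//.
  by rewrite ltr_pM2r.
have S0 : has_inf S.
  split; last by exists k0 => c; exact: k0S.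
  exists (b + 1); split; first by lra.
  exists [::] => f _; apply: (le_trans (Bb _)); rewrite ler_wpM2r ?ip_ge0//.
  by rewrite sqrrD expr1n mulr1; have := sqr_ge0 b; lra.
pose m := inf S.
have km : k0 <= m by apply: lb_le_inf; [case: S0|move=> c /k0S].
have m0 : 0 < m by exact: lt_le_trans km.
have approx (E : seq X) (e : R) : 0 < e -> exists2 f, f != 0 &
    (forall x, x \in E -> ip x f = 0) /\ nsq (B f - m *: f) <= e * nsq f.
  move=> e0.
  (* The final estimate is (m + d)^4 - 2 m^2 (m - d)^2 + m^4 <= 17 m^3 d: the linear term
     contributes 8 and, as d < m, the higher ones at most 9. *)
  pose d := Num.min (m / 2) (e / (17 * m)).
  have d0 : 0 < d by rewrite lt_min !divr_gt0// mulr_gt0.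
  have dm : d < m by rewrite gt_min; apply/orP; left; lra.
  have de : 17 * m * d <= e.
    by rewrite mulrC -ler_pdivlMr ?mulr_gt0// ge_min lexx orbT.
  have [c [c0 [E1 cE1]] cm] : exists2 c, S c & c < m + d by apply: inf_adherent.
  (* Orthogonality to [map B E1] makes B f orthogonal to [E1] as well, so the bound [c] applies to f
     and to B f. *)
  pose E2 := E ++ E1 ++ map B E1.
  have : ~ P (m - d) E2.
    move=> h; have : m <= m - d; last by lra.
    by apply: ge_inf; [case: S0|split; [lra|exists E2]].
  move/existsNP => [f /not_implyP[fE /negP]]; rewrite -ltNge => fb.
  have f0 : f != 0.
    by apply: contraTneq fb => ->; rewrite (sym0 Bsym) nsq0 mulr0 ltxx.
  exists f => //; split=> [x xE|]; first by apply: fE; rewrite mem_cat xE.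
  have fp := nsq_gt0 f0.
  have c2 : c ^+ 2 <= (m + d) ^+ 2 by rewrite ler_pXn2r ?nnegrE//; lra.
  have h1 : nsq (B f) <= (m + d) ^+ 2 * nsq f.
    apply: (@le_trans _ _ (c ^+ 2 * nsq f)); last by rewrite ler_wpM2r// ltW.
    by apply: cE1 => x xE; apply: fE; rewrite !mem_cat xE orbT.
  have h2 : nsq (B (B f)) <= (m + d) ^+ 2 * nsq (B f).
    apply: (@le_trans _ _ (c ^+ 2 * nsq (B f))); last by rewrite ler_wpM2r// ip_ge0.
    apply: cE1 => x xE; rewrite -Bsym; apply: fE.
    by rewrite !mem_cat map_f ?orbT.
  pose y := B f - m *: f.
  (* B^2 - m^2 = (B + m) (B - m), and |(B + m) y| >= m |y| since B >= 0. *)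
  have h3 : m ^+ 2 * nsq y <= nsq (B (B f) - m ^+ 2 *: f).
    have -> : B (B f) - m ^+ 2 *: f = B y + m *: y.
      by apply: ip_inj => z; rewrite /y !(symB Bsym, symZ Bsym) !ipE; ring.
    move: (y) => v; rewrite [leRHS]/nsq !ipE (ipC v (B v)).
    have := ip_ge0 (B v); have := mulr_ge0 (ltW m0) (Bge0 v).
    by rewrite /nsq; lra.
  have h4 : nsq (B (B f) - m ^+ 2 *: f) =
      nsq (B (B f)) - 2 * m ^+ 2 * nsq (B f) + m ^+ 4 * nsq f.
    by rewrite /nsq !ipE (ipC f) -(Bsym (B f) f); ring.
  rewrite -(ler_pM2l (exprn_gt0 2 m0)); apply: (le_trans h3); rewrite h4.
  have h5 : nsq (B (B f)) <= (m + d) ^+ 4 * nsq f.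
    apply: (le_trans h2); rewrite -[4%N]/(2 + 2)%N exprD -mulrA ler_wpM2l//.
    by rewrite exprn_ge0//; lra.
  have h6 : (m + d) ^+ 4 - 2 * m ^+ 2 * (m - d) ^+ 2 + m ^+ 4 <= m ^+ 2 * (17 * m * d).
    have -> : (m + d) ^+ 4 - 2 * m ^+ 2 * (m - d) ^+ 2 + m ^+ 4 =
      m ^+ 2 * (8 * m * d) + d * (4 * m ^+ 2 * d + 4 * m * d ^+ 2 + d ^+ 3) by ring.
    have d2 : d ^+ 2 <= m ^+ 2 by rewrite ler_pXn2r ?nnegrE//; lra.
    have d3 : d ^+ 3 <= m ^+ 3 by rewrite ler_pXn2r ?nnegrE//; lra.
    have a1 : 4 * m ^+ 2 * d <= 4 * m ^+ 3.
      by rewrite -mulrA ler_pM2l// [m ^+ 3]exprSr ler_pM2l ?exprn_gt0// ltW.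
    have a2 : 4 * m * d ^+ 2 <= 4 * m ^+ 3.
      by rewrite -mulrA ler_pM2l// [m ^+ 3]exprS ler_pM2l.
    have := ler_wpM2l (ltW d0) (lerD (lerD a1 a2) d3); lra.
  have h7 := ler_wpM2l (exprn_ge0 2 (ltW m0)) de.
  have h8 := ler_wpM2r (ltW fp) (le_trans h6 h7).
  have h9 := ler_wpM2l (exprn_ge0 2 (ltW m0)) (ltW fb).
  lra.
have [[c c0 hc]|[[r r0 hr] [E [EK KE]]]] := disc m m0.
  have [f f0 [_]] := approx [::] (c / 2) (divr_gt0 c0 (ltr0Sn R 1)).
  apply/negP; rewrite -ltNge; apply: lt_le_trans (hc f).
  by rewrite ltr_pM2r ?nsq_gt0//; lra.
pose D x := B x - m *: x.
have Dsym x y : ip (D x) y = ip x (D y) by rewrite /D !ipE Bsym.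
have Dl x : nsq (D x) <= (2 * b + 2 * m ^+ 2) * nsq x.
  apply: (le_trans (nsqD_le _ _)); rewrite nsqN nsqZ.
  by have := Bb x; lra.
have l0 : 0 <= 2 * b + 2 * m ^+ 2 by have := sqr_ge0 m; lra.
have gap : forall x, r ^+ 2 * nsq (D x) <= nsq (D (D x)).
  apply: (square_gap Dsym l0 Dl r0) => z z0 zr.
  have [c c0 h] := hr z z0 zr; exists c => // x.
  by rewrite /D -addrA -opprD -scalerDl.
have [||c c0 hc] := @gap_lower_bound D Dsym _ r l0 Dl [set` E] cX r0 gap.
  by move=> e /EK; rewrite /D => ->; rewrite subrr.
  by move=> x Dx; apply: KE; apply/eqP; rewrite -subr_eq0; apply/eqP.
have [f f0 [fE]] := approx E (c / 2) (divr_gt0 c0 (ltr0Sn R 1)).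
apply/negP; rewrite -ltNge; apply: lt_le_trans (hc f fE).
by rewrite ltr_pM2r ?nsq_gt0//; lra.
Qed.

End hilbert.

(** * Lebesgue measure: Borel sets, translations, cubes *)

Section measurable_rV_theory.
Context {R : realType} {n : nat}.
Implicit Types (x y v : 'rV[R]_n) (A U : set 'rV[R]_n).

Lemma nbhs_rVP x A : nbhs x A <->
  exists2 e : R, 0 < e & forall y, (forall i, `|y ord0 i - x ord0 i| < e) -> A y.
Proof.
split=> [/nbhs_ballP[e /= e0 h]|[e e0 h]]; last apply/nbhs_ballP.
  exists e => // y hy; apply: h; split=> // i j.
  by rewrite ord1 /ball/= distrC; exact: hy.
exists e => // y [_ hy]; apply: h => i.
by have := hy ord0 i; rewrite /ball/= distrC.
Qed.

Lemma measurable_coords (P : 'I_n -> set (measurableTypeR R)) : (forall i, measurable (P i)) ->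
  measurable [set x : 'rV[R]_n | forall i, P i (x ord0 i)].
Proof.
move=> mP; rewrite (_ : mkset _ = \bigcap_(i in [set: 'I_n]) (coord_rV i @^-1` P i)).
  apply: fin_bigcap_measurable; first exact: finite_finset.
  move=> i _; rewrite -[X in measurable X]setTI.
  exact: (measurable_coord_rV i measurableT (mP i)).
apply/seteqP; split=> x h i.
  by move=> _; exact: (h i).
exact: (h i I).
Qed.

(** The sigma-algebra is generated by coordinates, so an open set has to be exhibited as a countable
    union of boxes; those with rational centre and radius 1 / (k + 1) contained in U suffice. *)
Lemma open_measurable_rV U : open U -> measurable U.
Proof.
move=> oU.
pose box (p : 'rV[rat]_n * nat) := [set x : 'rV[R]_n |
  forall i, `|x ord0 i - ratr (p.1 ord0 i)| < p.2.+1%:R^-1].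
have mbox p : measurable (box p).
  apply: (@measurable_coords (fun i => [set t : R | `|t - ratr (p.1 ord0 i)| < p.2.+1%:R^-1])).
  move=> i; apply: open_measurable.
  rewrite (_ : mkset _ = ball (ratr (p.1 ord0 i) : R) (p.2.+1%:R^-1)).
    exact: ball_open.
  by apply/seteqP; split=> t; rewrite /ball/= distrC.
rewrite (_ : U = \bigcup_p (if `[< box p `<=` U >] then box p else set0)).
  apply: countable_bigcupT_measurable; first exact: countableP.
  by move=> p; case: ifPn.
apply/seteqP; split=> [x Ux|x [p _]]; last by case: ifPn => // /asboolP; exact.
have /nbhs_rVP[e e0 he] : nbhs x U by apply: open_nbhs_nbhs.
have e20 : 0 < e / 2 by rewrite divr_gt0.
have [k _ /(_ k (leqnn k))/= hk] := near_infty_natSinv_lt (PosNum e20).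
have k0 : 0 < k.+1%:R^-1 :> R by rewrite invr_gt0.
have /choice[q hq] i : exists q : rat, `|x ord0 i - ratr q| < k.+1%:R^-1.
  have [|q] := @rat_in_itvoo R (x ord0 i - k.+1%:R^-1) (x ord0 i + k.+1%:R^-1).
    by rewrite ltrD2l gt0_cp.
  by rewrite in_itv/= => qx; exists q; rewrite distrC ltr_distl.
exists (\row_i q i, k) => //=; case: ifPn => [_ i|].
  by rewrite mxE; exact: hq.
move=> /asboolP; apply: contra_notP => _ y hy; apply: he => i.
have := hy i; have := hq i; rewrite /= mxE => h1 h2.
rewrite -(subrKA (ratr (q i))) (le_lt_trans (ler_normD _ _))// (splitr e).
by rewrite ltrD// ?(lt_trans h2)//; rewrite distrC (lt_trans h1).
Qed.

Lemma continuous_on_measurable U (f : 'rV[R]_n -> R) : open U ->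
  (forall x, U x -> {for x, continuous f}) -> measurable_fun U f.
Proof.
move=> oU cf mU; apply: (measurability _ (RGenOpens.measurableE R)) => //.
move=> _ [_ [a [b ->] <-]]; apply: open_measurable_rV.
rewrite openE => x [Ux fx]; apply: filterI; first exact: open_nbhs_nbhs.
by apply: cf => //; apply: open_nbhs_nbhs; split => //; exact: interval_open.
Qed.

End measurable_rV_theory.

Section shift.
Context {R : realType}.

Lemma measurable_shift_rV n (v : 'rV[R]_n) : measurable_fun [set: 'rV[R]_n] (+%R^~ v).
Proof.
apply: measurable_fun_rV => i.
rewrite (_ : _ \o _ = (fun x => coord_rV i x + v ord0 i)).
  apply: measurable_funD => //; exact: measurable_coord_rV.
by apply/funext => x; rewrite /= /coord_rV mxE.
Qed.

Lemma lebesgue_measure_shift (s : R) (A : set R) : measurable A ->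
  lebesgue_measure ((+%R^~ s) @^-1` A) = lebesgue_measure A.
Proof.
move=> mA; apply/esym.
pose S : measurableTypeR R -> measurableTypeR R := +%R^~ s.
have mS : measurable_fun setT S by apply: measurable_funD.
rewrite -[RHS]/(pushforward lebesgue_measure S A).
apply: (lebesgue_measure_unique (mu := pushforward lebesgue_measure S)) => //.
move=> _ [[a b] _ <-] /=; rewrite /pushforward.
rewrite (_ : _ @^-1` _ = `]a - s, b - s]%classic).
  rewrite !lebesgue_measure_itv/= !lte_fin ltrD2r -!EFinB; case: ifPn => //.
  by move=> _; congr (_%:E); ring.
by apply/seteqP; split=> x /=; rewrite !in_itv/= ltrBlDr lerBrDr.
Qed.

Lemma lebesgue_rVSE n (A : set 'rV[R]_n.+1) :
  lebesgue_rV A = (@lebesgue_measure R \x lebesgue_rV)%E (@cons_rV R n @^-1` A).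
Proof. by []. Qed.

(** Induction on the dimension: through [cons_rV] the translation becomes a product of translations,
    and a product measure is determined by its values on rectangles. *)
Lemma lebesgue_rV_shift n (v : 'rV[R]_n) (A : set 'rV[R]_n) : measurable A ->
  lebesgue_rV ((+%R^~ v) @^-1` A) = lebesgue_rV A.
Proof.
elim: n v A => [|n IH] v A mA.
  rewrite (_ : _ @^-1` A = A)//; apply/seteqP; split=> x /=;
    by rewrite (_ : x + v = x)//; apply/rowP => -[].
pose S (p : measurableTypeR R * 'rV[R]_n) : measurableTypeR R * 'rV[R]_n :=
  (p.1 + v ord0 ord0, p.2 + \row_i v ord0 (lift ord0 i)).
have mS : measurable_fun setT S.
  apply/measurable_fun_pairP; split.
    by apply: measurable_funD => //; exact: measurable_fst.
  exact: (measurableT_comp (measurable_shift_rV (\row_i v ord0 (lift ord0 i)))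
    measurable_snd).
have mcA : measurable (@cons_rV R n @^-1` A).
  by rewrite -[X in measurable X]setTI; exact: measurable_cons_rV.
rewrite !lebesgue_rVSE.
rewrite (_ : _ @^-1` (_ @^-1` A) = S @^-1` (@cons_rV R n @^-1` A)); last first.
  apply/funext => p; rewrite /preimage /mkset; congr (A _).
  apply/rowP => i; rewrite mxE; case: (unliftP ord0 i) => [j|] ->.
    by rewrite !cons_rVS mxE mxE.
  by rewrite !cons_rV0.
apply/esym.
rewrite -[RHS]/(pushforward (lebesgue_measure \x lebesgue_rV)%E S (@cons_rV R n @^-1` A)).
apply: (product_measure_unique (m' := pushforward (lebesgue_measure \x lebesgue_rV)%E S)) => //.
move=> B C mB mC; rewrite /= /pushforward.
rewrite (_ : S @^-1` _ = ((+%R^~ (v ord0 ord0)) @^-1` B) `*`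
   ((+%R^~ (\row_i v ord0 (lift ord0 i))) @^-1` C)); last by [].
rewrite product_measure1E.
- by congr (_ * _)%E; [exact: lebesgue_measure_shift|exact: IH].
- by rewrite -[X in measurable X]setTI; apply: measurable_funD.
- by rewrite -[X in measurable X]setTI; apply: measurable_shift_rV.
Qed.

Lemma ge0_integral_shift n (v : 'rV[R]_n) (f : 'rV[R]_n -> \bar R) :
  measurable_fun setT f -> (forall x, 0 <= f x)%E ->
  (\int[lebesgue_rV]_x f (x + v)%R = \int[lebesgue_rV]_x f x)%E.
Proof.
move=> mf f0; transitivity (\int[pushforward lebesgue_rV (+%R^~ v)]_y f y)%E.
  by rewrite (ge0_integral_pushforward (measurable_shift_rV v)).
apply: eq_measure_integral => [|mv A mA _]; first exact: measurable_shift_rV.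
exact: lebesgue_rV_shift.
Qed.

End shift.

(** * Increments along segments *)

Section lines.
Context {R : realType} {V : normedModType R}.
Implicit Types (w : V -> R) (x e : V).

Let along w x e (t : R) : R := w (x + t *: e).

Lemma line_quotient w x e (t : R) :
  (fun h : R => h^-1 *: ((along w x e \o shift t) (h *: (1 : R)) - along w x e t)) =
  (fun h : R => h^-1 *: ((w \o shift (x + t *: e)) (h *: e) - w (x + t *: e))).
Proof.
apply/funext => h; rewrite /along /=; congr (_ *: (w _ - _)).
by rewrite -[h *: 1]/(h * 1) mulr1 scalerDl addrCA.
Qed.

Lemma derivable_line w x e (t : R) : derivable w (x + t *: e) e ->
  derivable (fun t : R => w (x + t *: e)) t 1.
Proof. by rewrite /derivable -/(along w x e) line_quotient. Qed.

Lemma derive_line w x e (t : R) :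
  'D_1 (fun t : R => w (x + t *: e)) t = 'D_e w (x + t *: e).
Proof. by rewrite /derive -/(along w x e) line_quotient. Qed.

Lemma continuous_line w x e (t : R) : derivable w (x + t *: e) e ->
  {for t, continuous (fun t : R => w (x + t *: e))}.
Proof.
by move=> /derivable_line/derivable1_diffP/differentiable_continuous.
Qed.

Lemma cvg_line x e (t : R) : x + s *: e @[s --> t] --> x + t *: e.
Proof. by apply: cvgD; [exact: cvg_cst|apply: cvgZr_tmp; exact: cvg_id]. Qed.

Lemma increment_le_integral w x e (a b : R) : a <= b ->
  (forall t, a <= t <= b -> derivable w (x + t *: e) e /\
     {for x + t *: e, continuous ('D_e w)}) ->
  (`|w (x + b *: e) - w (x + a *: e)|%:E <=
   \int[lebesgue_measure]_(t in `[a, b]) `|'D_e w (x + t *: e)|%:E)%E.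
Proof.
rewrite le_eqVlt => /orP[/eqP <- _|ab hw].
  by rewrite subrr normr0; apply: integral_ge0 => t _; rewrite lee_fin.
have cD : {within `[a, b], continuous (fun t : R => 'D_e w (x + t *: e))}.
  apply: continuous_in_subspaceT => t; rewrite inE/= in_itv/= => tab.
  apply: (@continuous_comp _ _ _ (fun t : R => x + t *: e) ('D_e w) t).
    exact: cvg_line.
  by have [] := hw t tab.
have FTC := @continuous_FTC2 R (fun t : R => 'D_e w (x + t *: e))
  (fun t : R => w (x + t *: e)) a b ab cD.
rewrite -abse_EFin EFinB -FTC.
- apply: le_abse_integral => //; apply/measurable_EFinP.
  exact: subspace_continuous_measurable_fun.
- split.
  + move=> t; rewrite in_itv/= => /andP[at_ tb]; apply: derivable_line.
    by have [] := hw t; rewrite ?ltW.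
  + have [] := hw a; first by rewrite lexx ltW.
    move=> /continuous_line + _; exact: cvg_at_right_filter.
  + have [] := hw b; first by rewrite lexx ltW.
    move=> /continuous_line + _; exact: cvg_at_left_filter.
- by move=> t _; rewrite derive1E derive_line.
Qed.

End lines.

Section integral_increment.
Context {R : realType} {n : nat}.
Implicit Types (w : 'rV[R]_n -> R) (e : 'rV[R]_n) (A B U : set 'rV[R]_n).

(** Each increment is at most an integral of |D_e w| over a segment. After exchanging integrals,
    every fixed t contributes at most the integral over [B], since the translation by c + t e maps
    [A] into [B] and preserves measure. The offset [c] lets increments in different directions be
    chained. *)
Lemma integral_increment_le w c e A B U (a b : R) : a <= b ->
  open U -> measurable A -> measurable B -> B `<=` U ->
  (forall x, U x -> {for x, continuous w}) ->
  (forall x, U x -> derivable w x e /\ {for x, continuous ('D_e w)}) ->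
  (forall x t, A x -> a <= t <= b -> B (x + c + t *: e)) ->
  (\int[lebesgue_rV]_(x in A) `|w (x + c + b *: e)%R - w (x + c + a *: e)%R|%:E <=
   (b - a)%:E * \int[lebesgue_rV]_(x in B) `|'D_e w x|%:E)%E.
Proof.
move=> ab oU mA mB BU cw dw AB.
have mU := open_measurable_rV oU.
have mD : measurable_fun B (fun x => `|'D_e w x|%:E).
  apply/measurable_EFinP; apply: measurableT_comp => //.
  apply: (measurable_funS mU BU); apply: continuous_on_measurable => //.
  by move=> x /dw[].
(* Extended by 0 outside [B], so that translation invariance applies on the whole space. *)
pose G := (fun x => `|'D_e w x|%:E) \_ B.
have mG : measurable_fun setT G by apply/(measurable_restrictT _ mB).
have G0 x : (0 <= G x)%E by rewrite /G patchE; case: ifPn.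
pose L (p : 'rV[R]_n * measurableTypeR R) : 'rV[R]_n := p.1 + c + (p.2 : R) *: e.
have mL : measurable_fun setT L.
  apply: measurable_fun_rV => i.
  rewrite (_ : _ \o _ = (fun p => coord_rV i p.1 + c ord0 i + p.2 * e ord0 i)); last first.
    by apply/funext => p; rewrite /= /coord_rV !mxE.
  apply: measurable_funD.
    apply: measurable_funD => //.
    exact: (measurableT_comp (measurable_coord_rV i) measurable_fst).
  by apply: measurable_funM => //; exact: measurable_snd.
have mAw t : a <= t <= b -> measurable_fun A (fun x => w (x + c + t *: e)).
  move=> tab; under eq_fun do rewrite -addrA.
  apply: (@measurable_comp _ _ _ _ _ _ U w A (+%R^~ (c + t *: e))) => //.
  - by move=> _ [x Ax <-]; apply: BU; rewrite addrA; exact: AB.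
  - exact: continuous_on_measurable.
  - by apply: measurable_funTS; exact: measurable_shift_rV.
pose K := (G \o L) \_ (setT `*` `[a, b]).
have mK : measurable_fun setT K.
  have mT : measurable ([set: 'rV[R]_n] `*` (`[a, b]%classic : set (measurableTypeR R))).
    exact: measurableX.
  apply/(measurable_restrictT _ mT).
  by apply: measurable_funTS; exact: (measurableT_comp mG mL).
have K0 p : (0 <= K p)%E by rewrite /K patchE; case: ifPn => // _; exact: G0.
have KE x : (\int[lebesgue_measure]_t K (x, t) =
             \int[lebesgue_measure]_(t in `[a, b]) G (x + c + t *: e)%R)%E.
  rewrite [RHS]integral_mkcond; apply: eq_integral => t _.
  rewrite /K !patchE; congr (if _ then _ else _).
  by apply/idP/idP; rewrite !inE/=; [case|].
apply: (@le_trans _ _ (\int[lebesgue_rV]_(x in A)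
    \int[lebesgue_measure]_t K (x, t))%E).
  apply: ge0_le_integral => //.
  - apply/measurable_EFinP; apply: measurableT_comp => //.
    by apply: measurable_funB; apply: mAw; rewrite lexx ?andbT.
  - apply: measurable_funTS; exact: measurable_fun_fubini_tonelli_F.
  move=> x Ax; rewrite KE.
  apply: (le_trans (increment_le_integral (e := e) (x := x + c) ab _)).
    by move=> t tab; apply: dw; apply: BU; exact: AB.
  rewrite le_eqVlt; apply/orP; left; apply/eqP; apply: eq_integral => t.
  rewrite inE/= in_itv/= => tab; rewrite /G patchE mem_set//; exact: AB.
apply: (@le_trans _ _ (\int[lebesgue_rV]_x
    \int[lebesgue_measure]_t K (x, t))%E).
  apply: ge0_subset_integral => //; first exact: measurable_fun_fubini_tonelli_F.
  by move=> x _; apply: integral_ge0.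
rewrite (fubini_tonelli (m1 := lebesgue_rV) (m2 := lebesgue_measure) K mK K0).
rewrite (_ : (fun y => _) = ((fun=> \int[lebesgue_rV]_x G x)%E \_ `[a, b])); last first.
  apply/funext => t; rewrite patchE; case: ifPn => [tab|tab].
    rewrite -(ge0_integral_shift (c + t *: e) mG G0); apply: eq_integral => x _.
    by rewrite addrA /K patchE ifT// inE/=; split => //; rewrite inE in tab.
  rewrite integral0_eq// => x _; rewrite /K patchE ifF//.
  by apply: contraNF tab; rewrite !inE => -[].
rewrite -integral_mkcond integral_cst//= lebesgue_measure_itv/= lte_fin.
rewrite (_ : (if _ then _ else _) = (b - a)%:E); last first.
  case: ifPn => [//|]; rewrite -leNgt => ba.
  by rewrite (@le_anti _ _ a b) ?ab// subrr.
by rewrite [X in (_ <= _ * X)%E]integral_mkcond muleC.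
Qed.

End integral_increment.

Section hcube.
Context {R : realType}.

(** Half-open and given by its lowest corner, so that a grid of such cubes is an exact partition. *)
Definition hcube n (l : 'rV[R]_n) (s : R) : set 'rV[R]_n :=
  [set x | forall i, l ord0 i <= x ord0 i < l ord0 i + s].

Lemma measurable_hcube n (l : 'rV[R]_n) s : measurable (hcube l s).
Proof.
rewrite (_ : hcube l s =
  [set x | forall i, `[l ord0 i, l ord0 i + s[%classic (x ord0 i)]).
  apply: (@measurable_coords R n (fun i => `[l ord0 i, l ord0 i + s[%classic)) => i.
  exact: measurable_itv.
by apply/seteqP; split=> x h i; have := h i; rewrite /= in_itv.
Qed.

Lemma lebesgue_hcube n (l : 'rV[R]_n) s : 0 <= s ->
  lebesgue_rV (hcube l s) = (s ^+ n)%:E.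
Proof.
move=> s0; elim: n l => [|n IH] l.
  rewrite /= diracE mem_set// => -[]//.
rewrite lebesgue_rVSE (_ : _ @^-1` _ = `[l ord0 ord0, l ord0 ord0 + s[%classic `*`
    hcube (\row_i l ord0 (lift ord0 i)) s); last first.
  apply/seteqP; split=> -[t x] /=.
    move=> h; split; first by have := h ord0; rewrite cons_rV0 in_itv.
    by move=> i; have := h (lift ord0 i); rewrite cons_rVS mxE.
  rewrite in_itv/= => -[h1 h2] i; case: (unliftP ord0 i) => [j|] ->.
    by have := h2 j; rewrite cons_rVS mxE.
  by rewrite cons_rV0.
rewrite product_measure1E//; last exact: measurable_hcube.
rewrite IH exprS EFinM; congr (_ * _)%E.
have E : lebesgue_measure (`[l ord0 ord0, l ord0 ord0 + s[%classic : set R) = s%:E.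
  rewrite lebesgue_measure_itv/= lte_fin; case: ifPn => [_|].
    by rewrite -EFinB addrAC subrr add0r.
  by rewrite ltrDl -leNgt => s0'; have -> : s = 0 by apply/le_anti; rewrite s0 s0'.
exact: E.
Qed.

End hcube.

(** * An L^1 Poincare inequality on cubes *)

Section poincare.
Context {R : realType} {n : nat}.
Variables (w : 'rV[R]_n -> R) (U : set 'rV[R]_n) (l : 'rV[R]_n) (s : R).
Hypothesis s0 : 0 < s.
Hypothesis oU : open U.
Hypothesis qU : hcube l s `<=` U.
Hypothesis cw : forall x, U x -> {for x, continuous w}.
Hypothesis dw : forall j x, U x ->
  derivable w x (basis_rV j) /\ {for x, continuous ('D_(basis_rV j) w)}.

Local Notation q := (hcube l s).
Local Notation mu := (@lebesgue_rV R n).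

Let G j := (\int[mu]_(x in q) `|'D_(basis_rV j) w x|%:E)%E.

Let G_ge0 j : (0 <= G j)%E.
Proof. by apply: integral_ge0 => x _; rewrite lee_fin. Qed.

Let mq : measurable q := measurable_hcube l s.

Let mU : measurable U := open_measurable_rV oU.

Let mw : measurable_fun U w := continuous_on_measurable oU cw.

(** The corners x + [head v k] of a path from x to x + v parallel to the axes. A cube is a product,
    so the path stays in it as soon as both ends do. *)
Let head (v : 'rV[R]_n) k : 'rV[R]_n := \row_i if (i < k)%N then v ord0 i else 0.

Let headS (v : 'rV[R]_n) (j : 'I_n) : head v j.+1 = head v j + v ord0 j *: basis_rV j.
Proof.
apply/rowP => i; rewrite !mxE ltnS leq_eqVlt /=.
have [->|ij] := eqVneq i j; first by rewrite eqxx ltnn mulr1 add0r.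
by rewrite (negbTE (_ : val i != val j))//= mulr0 addr0.
Qed.

Let Q (v : 'rV[R]_n) : set 'rV[R]_n := [set x | q x /\ q (x + v)].

Let mshift v : measurable (Q v).
Proof.
apply: measurableI => //; rewrite -[X in measurable X]setTI.
exact: measurable_shift_rV.
Qed.

Let step_le (v : 'rV[R]_n) (j : 'I_n) : (forall i, `|v ord0 i| <= s) ->
  (\int[mu]_(x in Q v)
     `|w (x + head v j.+1)%R - w (x + head v j)%R|%:E <= s%:E * G j)%E.
Proof.
move=> vs; set A := Q v.
have AB t x : Num.min 0 (v ord0 j) <= t <= Num.max 0 (v ord0 j) -> A x ->
    q (x + head v j + t *: basis_rV j).
  move=> tv [qx qxv] i; rewrite !mxE /=.
  have := qx i; have := qxv i; rewrite !mxE.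
  have [ij|ij] := ltnP i j.
    by rewrite (negbTE (_ : i != j))?mulr0 ?addr0// -val_eqE ltn_eqF.
  rewrite addr0; have [->|_] := eqVneq i j; last by rewrite mulr0 addr0.
  by rewrite mulr1; move: tv; rewrite ge_min le_max; lra.
have [v0|v0] := leP 0 (v ord0 j).
- have := @integral_increment_le R n w (head v j) (basis_rV j) A q U 0 (v ord0 j)
    v0 oU (mshift v) mq qU cw (@dw j) _.
  rewrite scale0r subr0; under eq_integral do rewrite addr0 -addrA -headS.
  move=> /(_ _)/le_trans; apply.
    by move=> x t Ax tv; apply: AB => //; rewrite (min_idPl v0) (max_idPr v0).
  apply: lee_wpmul2r; first exact: G_ge0.
  rewrite lee_fin; apply: le_trans (vs j).
  exact: ler_norm.
- have := @integral_increment_le R n w (head v j) (basis_rV j) A q U (v ord0 j) 0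
    (ltW v0) oU (mshift v) mq qU cw (@dw j) _.
  rewrite scale0r sub0r; under eq_integral do rewrite addr0 -addrA -headS distrC.
  move=> /(_ _)/le_trans; apply.
    move=> x t Ax tv; apply: AB => //.
    by rewrite (min_idPr (ltW v0)) (max_idPl (ltW v0)).
  apply: lee_wpmul2r; first exact: G_ge0.
  rewrite lee_fin; apply: le_trans (vs j).
  by rewrite -normrN ler_norm.
Qed.

Let shift_le (v : 'rV[R]_n) : (forall i, `|v ord0 i| <= s) ->
  (\int[mu]_(x in Q v) `|w (x + v)%R - w x|%:E <=
   s%:E * \sum_j G j)%E.
Proof.
move=> vs; set A := Q v.
have mh k : measurable_fun A (fun x => w (x + head v k)).
  apply: (@measurable_comp _ _ _ _ _ _ U w A (+%R^~ (head v k))) => //.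
  - move=> _ [x [qx qxv] <-]; apply: qU => i; have := qx i; have := qxv i.
    by rewrite !mxE; case: ifPn => // _; rewrite addr0.
  - by apply: measurable_funTS; exact: measurable_shift_rV.
have mA := mshift v.
apply: (@le_trans _ _ (\int[mu]_(x in A) \sum_(j < n)
    `|w (x + head v j.+1)%R - w (x + head v j)%R|%:E)%E).
  apply: ge0_le_integral => //.
  - apply/measurable_EFinP; apply: measurableT_comp => //.
    apply: measurable_funB.
      by have := mh n; rewrite (_ : head v n = v)//; apply/rowP => i; rewrite mxE ltn_ord.
    by apply: measurable_funS mw => // x [/qU].
  - apply: emeasurable_sum => j; apply/measurable_EFinP.
    by apply: measurableT_comp => //; apply: measurable_funB.
  move=> x Ax; rewrite sumEFin lee_fin.
  have -> : w (x + v) - w x =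
      \sum_(j < n) (w (x + head v j.+1) - w (x + head v j)).
    rewrite -(big_mkord xpredT (fun j => w (x + head v j.+1) - w (x + head v j))).
    rewrite telescope_sumr//; congr (w _ - w _).
      by congr (_ + _); apply/rowP => i; rewrite mxE ltn_ord.
    by rewrite (_ : head v 0 = 0) ?addr0//; apply/rowP => i; rewrite !mxE.
  exact: ler_norm_sum.
rewrite ge0_integral_sum//; last first.
  move=> j; apply/measurable_EFinP.
  by apply: measurableT_comp => //; apply: measurable_funB.
rewrite ge0_sume_distrr; last by move=> j _; exact: G_ge0.
apply: lee_sum => j _; exact: step_le.
Qed.

(** Substitute y = x + v and integrate over v last: v ranges over a cube of edge 2 s, which gives
    the factor (2 s)^n, and for fixed v each leg of the path along the axes has length at most s. *)
Lemma poincare_pairs :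
  (\int[mu]_(x in q) \int[mu]_(y in q) `|w x - w y|%:E <=
   ((2 * s) ^+ n * s)%:E * \sum_j \int[mu]_(x in q) `|'D_(basis_rV j) w x|%:E)%E.
Proof.
pose V := hcube (const_mx (- s) : 'rV[R]_n) (2 * s).
have mV : measurable V := measurable_hcube _ _.
pose D := [set p : 'rV[R]_n * 'rV[R]_n | q p.1 /\ q (p.1 + p.2)].
have madd : measurable_fun setT (fun p : 'rV[R]_n * 'rV[R]_n => p.1 + p.2).
  apply: measurable_fun_rV => i.
  rewrite (_ : _ \o _ = (fun p => coord_rV i p.1 + coord_rV i p.2)); last first.
    by apply/funext => p; rewrite /= /coord_rV !mxE.
  by apply: measurable_funD; apply: measurableT_comp => //; exact: measurable_coord_rV.
have mD : measurable D.
  apply: measurableI.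
    by rewrite -[X in measurable X]setTI; exact: measurable_fst.
  by rewrite -[X in measurable X]setTI; exact: madd.
pose f (p : 'rV[R]_n * 'rV[R]_n) := `|w (p.1 + p.2) - w p.1|%:E.
pose K := f \_ D.
have mK : measurable_fun setT K.
  apply/(measurable_restrictT _ mD)/measurable_EFinP.
  apply: measurableT_comp => //; apply: measurable_funB.
    apply: (@measurable_comp _ _ _ _ _ _ U w D (fun p => p.1 + p.2)) => //.
    - by move=> _ [p [_ /qU] ? <-].
    - exact: measurable_funTS.
  apply: (@measurable_comp _ _ _ _ _ _ U w D fst) => //.
  - by move=> _ [p [/qU ? _] <-].
  - by apply: measurable_funTS; exact: measurable_fst.
have K0 p : (0 <= K p)%E by rewrite /K patchE; case: ifPn => // _; rewrite lee_fin.
have -> : (\int[mu]_(x in q) \int[mu]_(y in q) `|w x - w y|%:E)%E =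
    (\int[mu]_x \int[mu]_v K (x, v))%E.
  rewrite integral_mkcond; apply: eq_integral => x _; rewrite patchE.
  case: ifPn => [qx|qx].
    rewrite integral_mkcond -[LHS](ge0_integral_shift x).
    - apply: eq_integral => v _; rewrite /K !patchE (addrC v) distrC.
      rewrite inE in qx; congr (if _ then _ else _).
      by apply/idP/idP; rewrite !inE /D /=; [move=> ?; split|case].
    - apply/(measurable_restrictT _ mq)/measurable_EFinP.
      by apply: measurableT_comp => //; apply: measurable_funB => //; exact: measurable_funS mw.
    - by move=> y; rewrite patchE; case: ifPn.
  rewrite integral0_eq// => v _; rewrite /K patchE ifF//.
  by apply: contraNF qx; rewrite !inE => -[].
rewrite (fubini_tonelli (m1 := mu) (m2 := mu) K mK K0).
have in_V x v : q x -> q (x + v) -> V v /\ forall i, `|v ord0 i| <= s.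
  move=> qx qxv; split=> i; have := qx i; have := qxv i; rewrite !mxE; first by lra.
  by rewrite ler_norml; lra.
apply: (@le_trans _ _ (\int[mu]_(v in V) (s%:E * \sum_j G j))%E).
  rewrite [leRHS]integral_mkcond; apply: ge0_le_integral => //.
  - by move=> v _; apply: integral_ge0.
  - exact: measurable_fun_fubini_tonelli_G.
  - by apply/(measurable_restrictT _ mV).
  move=> v _; rewrite patchE; case: ifPn => [Vv|Vv].
    have [vs|] := pselect (exists x, q x /\ q (x + v)).
      case: vs => x [qx qxv]; have [_ vs] := in_V x v qx qxv.
      apply: le_trans (shift_le vs); rewrite [leRHS]integral_mkcond.
      rewrite le_eqVlt; apply/orP; left; apply/eqP; apply: eq_integral => y _.
      by rewrite /K !patchE; congr (if _ then _ else _).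
    move=> nex; rewrite integral0_eq; last first.
      move=> x _; rewrite /K patchE ifF//; apply/negbTE/negP; rewrite inE => -[] *.
      by apply: nex; exists x.
    by apply: mule_ge0; [rewrite lee_fin ltW|apply: sume_ge0].
  rewrite integral0_eq// => x _; rewrite /K patchE ifF//; apply/negbTE/negP.
  rewrite inE => -[/= qx qxv]; move/negP: Vv; apply; rewrite inE.
  by have [] := in_V x v qx qxv.
rewrite integral_cst// [X in (_ * X)%E](_ : _ = ((2 * s) ^+ n)%:E); last by apply: lebesgue_hcube; rewrite mulr_ge0// ltW.
by rewrite muleC muleA -EFinM.
Qed.

End poincare.

(** * Functions of class C^k *)

Section smooth_calculus.
Context {R : realType} {n : nat}.
Implicit Types (f g : 'rV[R]_n -> R) (U W : set 'rV[R]_n).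

(** Regularity of finite order, defined by recursion on the derivative taken first. In a product or
    an inverse of order k + 1 the first derivative involves the functions themselves at order k, so
    induction on the order closes. *)
Fixpoint Ck (k : nat) U f : Prop :=
  (forall x, U x -> {for x, continuous f}) /\
  if k is k'.+1 then forall j : 'I_n,
    (forall x, U x -> derivable f x (basis_rV j)) /\ Ck k' U ('D_(basis_rV j) f)
  else True.

Lemma smooth_onP U f : smooth_on U f <-> forall k, Ck k U f.
Proof.
split=> [|h s].
  move=> + k; elim: k f => [|k IH] f sf /=.
    by split => // x Ux; have [] := sf [::] x Ux.
  split; first by move=> x Ux; have [] := sf [::] x Ux.
  move=> j; split; first by move=> x Ux; have [_ /(_ j)] := sf [::] x Ux.
  (* In [partials] the derivative taken first stands last in the list. *)
  apply: IH => s x Ux; have := sf (rcons s j) x Ux.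
  by rewrite /partials foldr_rcons.
elim/last_ind: s f h => [|s j IH] f h x Ux.
  have [cf dj] := h 1%N; split; first exact: cf.
  by move=> j; have [+ _] := dj j; exact.
rewrite /partials foldr_rcons; apply: IH => // k.
by have [_ /(_ j)[]] := h k.+1.
Qed.

Lemma Ck_continuous k U f x : Ck k U f -> U x -> {for x, continuous f}.
Proof. by case: k => [|k] [h _]; exact: h. Qed.

Lemma Ck_derivable k U f x j : Ck k.+1 U f -> U x -> derivable f x (basis_rV j).
Proof. by move=> [_ /(_ j)[+ _]]; exact. Qed.

Lemma Ck_derive k U f j : Ck k.+1 U f -> Ck k U ('D_(basis_rV j) f).
Proof. by move=> [_ /(_ j)[]]. Qed.

Lemma CkW k U f : Ck k.+1 U f -> Ck k U f.
Proof.
elim: k f => [|k IH] f [cf df]; split => // j; have [df1 df2] := df j.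
by split => //; exact: IH.
Qed.

Lemma Ck_sub k U W f : W `<=` U -> Ck k U f -> Ck k W f.
Proof.
move=> WU; elim: k f => [|k IH] f [cf df]; split.
- by move=> x /WU; exact: cf.
- by [].
- by move=> x /WU; exact: cf.
- by move=> j; have [h1 h2] := df j; split; [move=> x /WU; exact: h1|exact: IH].
Qed.

Lemma CkU k U W f : Ck k U f -> Ck k W f -> Ck k (U `|` W) f.
Proof.
elim: k f => [|k IH] f [cf df] [cf' df']; split.
- by move=> x []; [exact: cf|exact: cf'].
- by [].
- by move=> x []; [exact: cf|exact: cf'].
- move=> j; have [h1 h2] := df j; have [h3 h4] := df' j; split.
    by move=> x []; [exact: h1|exact: h3].
  exact: IH.
Qed.

Lemma Ck_ext k U f g : open U -> (forall x, U x -> f x = g x) ->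
  Ck k U f -> Ck k U g.
Proof.
move=> oU fg.
have nfg f' g' x : (forall x, U x -> f' x = g' x) -> U x -> \near x, f' x = g' x.
  by move=> fg' Ux; near=> y; apply: fg'; near: y; exact: open_nbhs_nbhs.
have cfg f' g' : (forall x, U x -> f' x = g' x) ->
    (forall x, U x -> {for x, continuous f'}) ->
    forall x, U x -> {for x, continuous g'}.
  move=> fg' cf x Ux; rewrite /prop_for /continuous_at -(fg' x Ux).
  exact: cvg_trans (near_eq_cvg (nfg _ _ _ fg' Ux)) (cf x Ux).
elim: k f g fg => [|k IH] f g fg [cf df]; split => //; try exact: cfg cf.
move=> j; have [h1 h2] := df j; split.
  by move=> x Ux; apply: near_eq_derivable (h1 x Ux); exact: nfg.
by apply: IH h2 => x Ux; apply: near_eq_derive; exact: nfg.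
Unshelve. all: by end_near. Qed.

Lemma Ck_cst k U (c : R) : Ck k U (fun=> c).
Proof.
elim: k c => [|k IH] c; split => //; try by move=> x Ux; exact: cst_continuous.
move=> j; split; first by move=> x _; exact: derivable_cst.
rewrite (_ : 'D_ _ _ = fun=> 0); first exact: IH.
by apply/funext => x; rewrite derive_cst.
Qed.

Lemma CkD k U f g : open U -> Ck k U f -> Ck k U g ->
  Ck k U (fun x => f x + g x).
Proof.
move=> oU; elim: k f g => [|k IH] f g [cf df] [cg dg]; split => //.
- by move=> x Ux; apply: continuousD; [exact: cf|exact: cg].
- by move=> x Ux; apply: continuousD; [exact: cf|exact: cg].
move=> j; have [h1 h2] := df j; have [h3 h4] := dg j.
split; first by move=> x Ux; apply: derivableD; [exact: h1|exact: h3].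
apply: (Ck_ext oU _ (IH _ _ h2 h4)) => x Ux.
by rewrite [RHS]deriveD; [|exact: h1|exact: h3].
Qed.

Lemma CkM k U f g : open U -> Ck k U f -> Ck k U g ->
  Ck k U (fun x => f x * g x).
Proof.
move=> oU; elim: k f g => [|k IH] f g Cf Cg; split => //.
- by move=> x Ux; apply: continuousM; [case: Cf => + _|case: Cg => + _]; exact.
- by move=> x Ux; apply: continuousM; [case: Cf => + _|case: Cg => + _]; exact.
have [_ df] := Cf; have [_ dg] := Cg.
move=> j; have [h1 h2] := df j; have [h3 h4] := dg j.
split; first by move=> x Ux; apply: derivableM; [exact: h1|exact: h3].
apply: (Ck_ext oU _ (CkD oU (IH _ _ (CkW Cf) h4) (IH _ _ (CkW Cg) h2))) => x Ux.
by rewrite [RHS]deriveM; [|exact: h1|exact: h3].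
Qed.

Lemma CkV k U f : open U -> (forall x, U x -> f x != 0) -> Ck k U f ->
  Ck k U (fun x => (f x)^-1).
Proof.
move=> oU f0; elim: k => [|k IH] Cf; split => //.
- by move=> x Ux; apply: continuousV; [exact: f0|case: Cf => + _; exact].
- by move=> x Ux; apply: continuousV; [exact: f0|case: Cf => + _; exact].
have [_ df] := Cf.
move=> j; have [h1 h2] := df j.
split; first by move=> x Ux; apply: derivableV; [exact: f0|exact: h1].
have CV := IH (CkW Cf).
have h := CkM oU (Ck_cst k U (-1)) (CkM oU (CkM oU CV CV) h2).
apply: (Ck_ext oU _ h) => x Ux.
rewrite [RHS]deriveV; [|exact: f0|exact: h1].
by rewrite -[RHS]/(_ * _) mulN1r mulNr expr2 invfM.
Qed.

Lemma Ck_prod k U (I : Type) (s : seq I) (F : I -> 'rV[R]_n -> R) : open U ->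
  (forall i, Ck k U (F i)) -> Ck k U (fun x => \prod_(i <- s) F i x).
Proof.
move=> oU CF; elim: s => [|i s IH].
  by under eq_fun do rewrite big_nil; exact: Ck_cst.
by under eq_fun do rewrite big_cons; exact: CkM.
Qed.

End smooth_calculus.

(** * Smooth cutoffs *)

Section flat_functions.
Context {R : realType}.

(* The derivatives of exp(-1/x) are combinations of these functions. *)
Definition flat (m : nat) (x : R) : R :=
  if 0 < x then x^-1 ^+ m * expR (- x^-1) else 0.

Lemma flat_ge0 m x : 0 <= flat m x.
Proof.
rewrite /flat; case: ifPn => // x0.
by rewrite mulr_ge0 ?expR_ge0// exprn_ge0// invr_ge0 ltW.
Qed.

Lemma flat_le0 m x : x <= 0 -> flat m x = 0.
Proof. by rewrite /flat leNgt => /negbTE ->. Qed.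

Lemma exprn_expRN_le m (y : R) : 0 < y -> y ^+ m * expR (- y) <= m`!%:R.
Proof.
move=> y0; rewrite expRN ler_pdivrMr ?expR_gt0// mulrC.
have f0 : 0 < m`!%:R :> R by rewrite ltr0n fact_gt0.
rewrite -ler_pdivrMr//; case: m f0 => [|m] f0.
  by rewrite expr0 fact0 divr1 -expR0 ler_expR ltW.
by apply: le_trans (expR_ge1Dxn m (ltW y0)); rewrite lerDr.
Qed.

Lemma flat_le m x : flat m x <= m`!%:R.
Proof.
rewrite /flat; case: ifPn => // x0.
by rewrite exprn_expRN_le// invr_gt0.
Qed.

(** Quadratic decay at 0, which makes the difference quotient at 0 tend to 0. *)
Lemma flat_le_sqr m x : flat m x <= m.+2`!%:R * x ^+ 2.
Proof.
rewrite /flat; case: ifPn => [x0|_]; last by rewrite mulr_ge0// sqr_ge0.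
have y0 : 0 < x^-1 by rewrite invr_gt0.
rewrite -ler_pdivrMr ?exprn_gt0//; apply: le_trans (exprn_expRN_le m.+2 y0).
rewrite mulrAC ler_wpM2r ?expR_ge0//.
by rewrite -exprVn -exprD addn2.
Qed.

Lemma flat0_mono (x y : R) : x <= y -> flat 0 x <= flat 0 y.
Proof.
move=> xy; rewrite {1}/flat; case: ifPn => [x0|_]; last exact: flat_ge0.
have y0 := lt_le_trans x0 xy.
by rewrite /flat y0 !expr0 !mul1r ler_expR lerN2 lef_pV2.
Qed.

Lemma flat0_gt0 (x : R) : 0 < x -> 0 < flat 0 x.
Proof. by move=> x0; rewrite /flat x0 expr0 mul1r expR_gt0. Qed.

Lemma is_derive_flat m (x : R) :
  is_derive x 1 (flat m) (flat m.+2 x - m%:R * flat m.+1 x).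
Proof.
have [x0|x0|<-] := ltgtP 0 x.
- have nx : {near x, (fun y => (y^-1) ^+ m * expR (- y^-1)) =1 flat m}.
    near=> y; rewrite /flat ifT//; near: y; exact: lt_nbhsr.
  apply: near_eq_is_derive nx _.
  have xn0 : x != 0 by rewrite gt_eqF.
  have dV : is_derive x 1 (fun y : R => y^-1) (- x ^- 2).
    have := @is_deriveV R id x 1 1 xn0 (is_derive_id _ _).
    by rewrite -[_ *: 1]/(_ * 1) mulr1.
  have dX : is_derive x 1 (fun y : R => (y^-1) ^+ m) (m%:R * x^-1 ^+ m.-1 * - x ^- 2).
    rewrite (_ : (fun y : R => _) = (fun y : R => y^-1) ^+ m); last by rewrite exprfctE.
    have h := @is_deriveX _ _ (fun y : R => y^-1) m x 1 _ dV. exact: (is_derive_eq h).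
  have dE : is_derive x 1 (fun y : R => expR (- y^-1)) (expR (- x^-1) * x ^- 2).
    have dN : is_derive x 1 (fun y : R => - y^-1) (x ^- 2).
      by have := is_deriveN dV; rewrite opprK.
    exact: (is_derive1_comp (is_derive_expR _) dN).
  have := is_deriveM dX dE => h; apply: is_derive_eq.
  rewrite /flat x0 -![_ *: _]/(_ * _) -exprVn.
  case: m {dX h} => [|m] /=; first by rewrite !expr0 !mul0r; ring.
  by rewrite !exprS; ring.
- have nx : {near x, (fun=> 0) =1 flat m}.
    near=> y; rewrite flat_le0//; apply: ltW; near: y; exact: lt_nbhsl.
  apply: near_eq_is_derive nx _; rewrite !flat_le0 ?ltW// mulr0 subr0.
  exact: is_derive_cst.
rewrite !flat_le0// mulr0 subr0.
have h0 : (fun h : R => h^-1 *: ((flat m \o shift 0) (h *: (1 : R)) - flat m 0)) @ 0^' --> (0 : R).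
  apply/cvgrPdist_le => e e0; near=> h.
  rewrite sub0r normrN /= addr0 -[h *: 1]/(h * 1) mulr1 (flat_le0 m (lexx 0)) subr0.
  have hn0 : h != 0 by near: h; exact: nbhs_dnbhs_neq.
  rewrite -[_ *: _]/(_ * _) normrM normfV mulrC ler_pdivrMr ?normr_gt0//.
  rewrite ger0_norm ?flat_ge0//; apply: le_trans (flat_le_sqr m h) _.
  rewrite -(real_normK (num_real h)) expr2 mulrA ler_wpM2r//.
  rewrite mulrC -ler_pdivlMr ?ltr0n ?fact_gt0//.
  near: h; apply: dnbhs0_le; rewrite divr_gt0// ltr0n fact_gt0//.
apply: DeriveDef; last exact: cvg_lim.
by apply/cvg_ex; exists 0.
Unshelve. all: by end_near. Qed.

End flat_functions.

Section cutoff.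
Context {R : realType} {n : nat}.

Lemma is_derive_coord (g dg : R -> R) (i j : 'I_n) (x : 'rV[R]_n) :
  (forall t : R, is_derive t (1 : R) g (dg t)) ->
  is_derive x (basis_rV j) (fun x => g (x ord0 i)) ((i == j)%:R * dg (x ord0 i)).
Proof.
move=> hg.
have E : (fun h : R => h^-1 *: (((fun x : 'rV[R]_n => g (x ord0 i)) \o shift x)
      (h *: basis_rV j) - g (x ord0 i))) =
    (fun h : R => h^-1 *: ((g \o shift (x ord0 i)) (h *: (i == j)%:R) - g (x ord0 i))).
  by apply/funext => h /=; rewrite !mxE.
case: eqP E => [_|_] E.
  have [dg1 dg2] := hg (x ord0 i); rewrite mul1r.
  by apply: DeriveDef; rewrite /derivable /derive E.
have E0 : (fun h : R => h^-1 *: (((fun x : 'rV[R]_n => g (x ord0 i)) \o shift x)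
      (h *: basis_rV j) - g (x ord0 i))) = fun=> 0.
  by rewrite E; apply/funext => h /=; rewrite scaler0 add0r subrr scaler0.
rewrite mul0r; apply: DeriveDef; rewrite /derivable /derive E0.
  exact: is_cvg_cst.
exact: lim_cst.
Qed.

Let affine_flat m (a b t : R) := flat m (a * t + b).

Let is_derive_affine_flat m (a b t : R) :
  is_derive t (1 : R) (affine_flat m a b)
    (a * (affine_flat m.+2 a b t - m%:R * affine_flat m.+1 a b t)).
Proof.
rewrite mulrC; apply: (is_derive1_comp (is_derive_flat _ _)).
have h : is_derive t 1 (fun t : R => a * t + b) (a *: 1 + 0).
  apply: is_deriveD; apply: is_deriveZ.
by apply: is_derive_eq; rewrite addr0 -[a *: 1]/(a * 1) mulr1.
Qed.

Lemma Ck_flat k m (a b : R) (i : 'I_n) :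
  Ck k setT (fun x : 'rV[R]_n => flat m (a * x ord0 i + b)).
Proof.
have cont p x : setT x ->
    {for x, continuous (fun x : 'rV[R]_n => flat p (a * x ord0 i + b))}.
  move=> _; apply: (@continuous_comp _ _ _ (fun x : 'rV[R]_n => x ord0 i)
    (affine_flat p a b)); first exact: coord_continuous.
  apply: differentiable_continuous; apply/derivable1_diffP.
  by have [] := is_derive_affine_flat p a b (x ord0 i).
elim: k m => [|k IH] m; split => //; try exact: cont.
move=> j.
have dj x := @is_derive_coord _ _ i j x (is_derive_affine_flat m a b).
split; first by move=> x _; have [] := dj x.
apply: (Ck_ext openT _ (CkM openT (Ck_cst k setT ((i == j)%:R * a))
  (CkD openT (IH m.+2) (CkM openT (Ck_cst k setT (- m%:R)) (IH m.+1))))) => x _.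
by have [_ ->] := dj x; rewrite /affine_flat; ring.
Qed.

(** In the Leibniz formula the factors that are not differentiated lie in [0, 1] and are bounded by
    1. *)
Lemma derive_prod_le (I : Type) (r : seq I) (F : I -> 'rV[R]_n -> R) v (x : 'rV[R]_n) :
  (forall i, derivable (F i) x v) -> (forall i, 0 <= F i x <= 1) ->
  derivable (fun x => \prod_(i <- r) F i x) x v /\
  `|'D_v (fun x => \prod_(i <- r) F i x) x| <= \sum_(i <- r) `|'D_v (F i) x|.
Proof.
move=> dF F01; elim: r => [|i r [IH1 IH2]].
  under eq_fun do rewrite big_nil; split; first exact: derivable_cst.
  by rewrite derive_cst normr0 big_nil.
have -> : (fun x => \prod_(k <- i :: r) F k x) =
    (fun x => F i x * \prod_(k <- r) F k x).
  by apply/funext => y; rewrite big_cons.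
have dFi := dF i.
split; first exact: (derivableM dFi IH1).
rewrite big_cons (deriveM dFi IH1) (le_trans (ler_normD _ _))// addrC.
rewrite -![_ *: _]/(_ * _) !normrM; apply: lerD.
  rewrite ler_piMl// ger0_norm.
    by apply: prodr_ile1 => k _; exact: F01.
  by apply: prodr_ge0 => k _; have /andP[] := F01 k.
apply: le_trans IH2; rewrite ler_piMl// ger0_norm; by have /andP[] := F01 i.
Qed.

(* exp(-1/(x_i - l_i)) exp(-1/(l_i + s - x_i)), multiplied over i *)
Definition cutoff (l : 'rV[R]_n) (s : R) (x : 'rV[R]_n) : R :=
  \prod_(i < n) (flat 0 (1 * x ord0 i + - l ord0 i) *
                 flat 0 (-1 * x ord0 i + (l ord0 i + s))).

Lemma Ck_cutoff k l s : Ck k setT (cutoff l s).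
Proof.
by apply: Ck_prod openT _ => i; apply: (CkM openT); exact: Ck_flat.
Qed.

Let factor01 (a b a' b' t : R) :
  0 <= flat 0 (a * t + b) * flat 0 (a' * t + b') <= 1.
Proof.
rewrite mulr_ge0 ?flat_ge0//=.
by rewrite -[leRHS]mulr1 ler_pM ?flat_ge0// (le_trans (flat_le _ _)).
Qed.

Lemma cutoff_ge0 l s x : 0 <= cutoff l s x.
Proof. by apply: prodr_ge0 => i _; rewrite mulr_ge0 ?flat_ge0. Qed.

Lemma cutoff_le1 l s x : cutoff l s x <= 1.
Proof. by apply: prodr_ile1 => i _; exact: factor01. Qed.

Lemma cutoff_eq0 l s x : ~ hcube l s x -> cutoff l s x = 0.
Proof.
move=> /existsNP[i /negP]; rewrite negb_and -!ltNge => h.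
rewrite /cutoff (bigD1 i)//=; case/orP: h => h.
  by rewrite flat_le0 ?mul0r// mul1r subr_le0 ltW.
by rewrite [X in _ * X * _]flat_le0 ?mulr0 ?mul0r// mulN1r addrC subr_le0 leNgt.
Qed.

(** On the concentric cube of half the edge, x is at distance at least s / 4 from both faces in
    every coordinate; there are 2 n factors. *)
Lemma cutoff_lower l s x : 0 < s -> hcube (l + const_mx (s / 4)) (s / 2) x ->
  flat 0 (s / 4) ^+ (2 * n) <= cutoff l s x.
Proof.
move=> s0 hx; rewrite exprM -[n in X in X <= _]card_ord -prodr_const.
apply: ler_prod => i _; rewrite exprn_ge0 ?flat_ge0//= expr2.
have := hx i; rewrite !mxE => hi.
by apply: ler_pM; rewrite ?flat_ge0// flat0_mono//; lra.
Qed.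

(** The bound is free of s because the profile exp(-1/t) is not rescaled. Each of the n factors
    contributes at most 1 * 2 + 1 * 2, where 2 = 2! bounds [flat 2]. *)
Lemma cutoff_derive_le l s x j : `|'D_(basis_rV j) (cutoff l s) x| <= (4 * n)%:R.
Proof.
have d m a b i := @is_derive_coord _ _ i j x (is_derive_affine_flat m a b).
have [i|i|_] := @derive_prod_le _ (index_enum 'I_n)
  (fun i x => flat 0 (1 * x ord0 i + - l ord0 i) *
              flat 0 (-1 * x ord0 i + (l ord0 i + s))) (basis_rV j) x.
- by apply: derivableM; [have [] := d 0%N 1 (- l ord0 i) i
                       |have [] := d 0%N (-1) (l ord0 i + s) i].
- exact: factor01.
move=> /le_trans; apply.
have -> : (4 * n)%:R = \sum_(i < n) (4 : R).
  by rewrite sumr_const card_ord natrM mulr_natr.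
apply: ler_sum => i _.
have [d1 e1] := d 0%N 1 (- l ord0 i) i; have [d2 e2] := d 0%N (-1) (l ord0 i + s) i.
rewrite [X in `|X|](deriveM d1 d2) e1 e2 -![_ *: _]/(_ * _).
have B a b : `|a| = 1 -> `|(i == j)%:R * (a * (affine_flat 2 a b (x ord0 i) -
    0%:R * affine_flat 1 a b (x ord0 i)))| <= 2.
  move=> a1.
  rewrite mul0r subr0 !normrM a1 mul1r -[leRHS]mul1r.
  have ij1 : `|(i == j)%:R| <= 1 :> R.
    by case: (i == j); rewrite /= ?normr1 ?normr0 ?ler01.
  have f2 : `|affine_flat 2 a b (x ord0 i)| <= 2.
    by rewrite ger0_norm; [exact: (flat_le 2)|exact: flat_ge0].
  exact: ler_pM.
have F a b : `|affine_flat 0 a b (x ord0 i)| <= 1.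
  by rewrite ger0_norm; [exact: (flat_le 0)|exact: flat_ge0].
apply: le_trans (ler_normD _ _) _.
rewrite [X in X + _]normrM [X in _ + X]normrM.
have B1 := B 1 (- l ord0 i) (normr1 _).
have B2 := B (-1) (l ord0 i + s) (normrN1 _).
rewrite (_ : 4 = 1 * 2 + 1 * 2); last by ring.
have F1 := F 1 (- l ord0 i); have F2 := F (-1) (l ord0 i + s).
by apply: lerD; apply: ler_pM.
Qed.

End cutoff.

(** * Truncation of functions of small magnetic energy *)

Section complex_parts.
Local Open Scope complex_scope.
Context {R : realType} {n : nat}.
Implicit Types (u : 'rV[R]_n -> R[i]) (x : 'rV[R]_n).

Definition repart u x : R := complex.Re (u x).
Definition impart u x : R := complex.Im (u x).

Definition sqmod (z : R[i]) : R := complex.Re z ^+ 2 + complex.Im z ^+ 2.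

Lemma normc_sqr (z : R[i]) : Normc.normc z ^+ 2 = sqmod z.
Proof.
by case: z => p q; rewrite /sqmod /= sqr_sqrtr// addr_ge0 ?sqr_ge0.
Qed.

Lemma sqmod_ge0 (z : R[i]) : 0 <= sqmod z.
Proof. by rewrite addr_ge0 ?sqr_ge0. Qed.

Variable a : 'rV[R]_n -> 'rV[R]_n.

Definition mpart_re j u x : R :=
  'D_(basis_rV j) (repart u) x - a x ord0 j * impart u x.
Definition mpart_im j u x : R :=
  'D_(basis_rV j) (impart u) x + a x ord0 j * repart u x.

Lemma magnetic_partialE j u x :
  magnetic_partial a j u x = mpart_re j u x +i* mpart_im j u x.
Proof.
rewrite /magnetic_partial /cpartial /mpart_re /mpart_im /repart /impart.
by case: (u x) => p q; apply/eqP; rewrite eq_complex /= !mul0r sub0r add0r !eqxx.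
Qed.

Lemma energy_densityE u x : magnetic_energy_density a u x =
  \sum_(j < n) (mpart_re j u x ^+ 2 + mpart_im j u x ^+ 2).
Proof.
by apply: eq_bigr => j _; rewrite normc_sqr magnetic_partialE.
Qed.

Lemma energy_density_ge0 u x : 0 <= magnetic_energy_density a u x.
Proof. by apply: sumr_ge0 => j _; rewrite sqr_ge0. Qed.

Lemma measurable_energy U u : open U -> csmooth_on U u ->
  (forall j, measurable_fun setT (fun x => a x ord0 j)) ->
  measurable_fun U (magnetic_energy_density a u).
Proof.
move=> oU [/smooth_onP sr /smooth_onP si] ma.
have mD f j : (forall k, Ck k U f) -> measurable_fun U ('D_(basis_rV j) f).
  move=> sf; apply: continuous_on_measurable => // x Ux.
  exact: (Ck_continuous (Ck_derive j (sf 1%N))).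
have m0 f : (forall k, Ck k U f) -> measurable_fun U f.
  by move=> sf; apply: continuous_on_measurable => // x Ux; exact: (Ck_continuous (sf 0%N)).
have maU j : measurable_fun U (fun x => a x ord0 j) by exact: measurable_funTS.
rewrite (_ : magnetic_energy_density a u = fun x =>
  \sum_(j < n) (mpart_re j u x ^+ 2 + mpart_im j u x ^+ 2)); last first.
  by apply/funext => x; exact: energy_densityE.
apply: measurable_sum => j; apply: measurable_funD; apply: measurable_funX.
  by apply: measurable_funB; [exact: mD|apply: measurable_funM => //; exact: m0].
by apply: measurable_funD; [exact: mD|apply: measurable_funM => //; exact: m0].
Qed.

End complex_parts.

Section smooth_more.
Context {R : realType} {n : nat}.
Implicit Types (f : 'rV[R]_n -> R) (u : 'rV[R]_n -> R[i]).

(** A zero of a nonnegative function is a minimum. This gives the vanishing of the gradient of the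
    cutoff wherever the cutoff vanishes, including the faces of the cube. *)
Lemma derive_ge0_eq0 f (e x : 'rV[R]_n) : (forall y, 0 <= f y) ->
  (forall y, derivable f y e) -> f x = 0 -> 'D_e f x = 0.
Proof.
move=> f0 df fx0; pose g (t : R) := f (x + t *: e).
have dg (t : R) : derivable g t 1 by apply: derivable_line; exact: df.
have h : is_derive (0 : R) (1 : R) g 0.
  apply: (@derive1_at_min R g (-1) 1 0) => // [|t _].
  - by rewrite in_itv/= ltrN10 ltr01.
  - by rewrite /g scale0r addr0 fx0.
have := derive_line f x e 0; rewrite scale0r addr0 => <-.
by have [_] := h.
Qed.

Definition cbox (l : 'rV[R]_n) (s : R) : set 'rV[R]_n :=
  [set x | forall i, l ord0 i <= x ord0 i <= l ord0 i + s].

Lemma cbox_compact l s : compact (cbox l s).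
Proof.
rewrite (_ : cbox l s = [set x | forall i, `[l ord0 i, l ord0 i + s]%classic (x ord0 i)]).
  by apply: (@rV_compact _ _ (fun i => `[l ord0 i, l ord0 i + s]%classic)) => i;
    exact: segment_compact.
by apply/seteqP; split=> x h i; have := h i; rewrite /= in_itv.
Qed.

Lemma cbox_closed l s : closed (cbox l s).
Proof. by apply: compact_closed; [exact: norm_hausdorff|exact: cbox_compact]. Qed.

Lemma bounded_integrable (A : set 'rV[R]_n) (f : 'rV[R]_n -> R) (M : R) :
  measurable A -> (lebesgue_rV A < +oo)%E -> measurable_fun A f ->
  (forall x, A x -> `|f x| <= M) -> lebesgue_rV.-integrable A (EFin \o f).
Proof.
move=> mA Aoo mf fM; apply: measurable_bounded_integrable => //.
exists M; split; first exact: num_real.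
by move=> M' MM' x Ax; apply: le_trans (fM x Ax) (ltW MM').
Qed.

Lemma hcube_sub_box (l : 'rV[R]_n) s x : hcube l s x -> cbox l s x.
Proof. by move=> h i; have /andP[-> /ltW ->] := h i. Qed.

Lemma integral_supported (A : set 'rV[R]_n) (f : 'rV[R]_n -> R) :
  (forall x, ~ A x -> f x = 0) ->
  (\int[lebesgue_rV]_x (f x)%:E = \int[lebesgue_rV]_(x in A) (f x)%:E)%E.
Proof.
move=> fA; rewrite [RHS]integral_mkcond; apply: eq_integral => x _.
by rewrite patchE; case: ifPn => //; rewrite notin_setE => /fA ->.
Qed.

(** Since m is the average of w(y), |w(x) - m| is at most the average of |w(x) - w(y)| over y; this
    links [poincare_pairs] to the deviation from the mean. *)
Lemma integral_average_le (w : 'rV[R]_n -> R) (l : 'rV[R]_n) (s m : R) : 0 < s ->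
  lebesgue_rV.-integrable (hcube l s) (EFin \o w) ->
  m = (\int[lebesgue_rV]_(x in hcube l s) w x) / s ^+ n ->
  (\int[lebesgue_rV]_(x in hcube l s) `|w x - m|%:E <=
   ((s ^+ n)^-1)%:E * \int[lebesgue_rV]_(x in hcube l s)
     \int[lebesgue_rV]_(y in hcube l s) `|w x - w y|%:E)%E.
Proof.
move=> s0 iw hm.
have mq := measurable_hcube l s.
have sn0 : 0 < s ^+ n by rewrite exprn_gt0.
have mw : measurable_fun (hcube l s) w.
  by apply/measurable_EFinP; exact: measurable_int iw.
have mu_q : lebesgue_rV (hcube l s) = (s ^+ n)%:E by apply: lebesgue_hcube; exact: ltW.
have ic x : lebesgue_rV.-integrable (hcube l s) (EFin \o (fun=> w x)).
  by apply: (@bounded_integrable _ _ `|w x|) => //; rewrite mu_q ltry.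
pose f (p : 'rV[R]_n * 'rV[R]_n) := ((fun p : 'rV[R]_n * 'rV[R]_n => `|w p.1 - w p.2|%:E)
   \_ (hcube l s `*` hcube l s)) p.
have mf : measurable_fun setT f.
  apply/(measurable_restrictT _ (measurableX mq mq))/measurable_EFinP.
  apply: measurableT_comp => //; apply: measurable_funB.
    apply: (@measurable_comp _ _ _ _ _ _ (hcube l s) w _ fst) => //.
      by move=> _ [p [? ?] <-].
    by apply: measurable_funTS; exact: measurable_fst.
  apply: (@measurable_comp _ _ _ _ _ _ (hcube l s) w _ snd) => //.
    by move=> _ [p [? ?] <-].
  by apply: measurable_funTS; exact: measurable_snd.
have f0 p : (0 <= f p)%E by rewrite /f patchE; case: ifPn => // _; rewrite lee_fin.
have fE x : hcube l s x -> (\int[lebesgue_rV]_y f (x, y) =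
    \int[lebesgue_rV]_(y in hcube l s) `|w x - w y|%:E)%E.
  move=> qx; rewrite [RHS]integral_mkcond; apply: eq_integral => y _.
  rewrite /f !patchE; congr (if _ then _ else _).
  by apply/idP/idP; rewrite !inE /=; [case|split].
have mF : measurable_fun (hcube l s) (fun x =>
    \int[lebesgue_rV]_(y in hcube l s) `|w x - w y|%:E)%E.
  apply: (eq_measurable_fun (fun x => \int[lebesgue_rV]_y f (x, y))%E).
    by move=> x; rewrite inE => qx; exact: fE.
  by apply: measurable_funTS; exact: measurable_fun_fubini_tonelli_F.
rewrite -ge0_integralZl//.
- apply: ge0_le_integral => //.
  + apply/measurable_EFinP; apply: measurableT_comp => //.
    exact: measurable_funB.
  + exact: measurable_funeM.
  move=> x qx.
  have -> : w x - m = (s ^+ n)^-1 * \int[lebesgue_rV]_(y in hcube l s) (w x - w y).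
    rewrite RintegralB// Rintegral_cst// [fine _](congr1 fine mu_q) mulrBr hm.
    by rewrite [w x * _]mulrC mulKf ?gt_eqF// [in RHS]mulrC.
  rewrite normrM ger0_norm; last by rewrite invr_ge0 ltW.
  rewrite EFinM; apply: lee_wpmul2l; first by rewrite lee_fin invr_ge0 ltW.
  have ii : lebesgue_rV.-integrable (hcube l s) (EFin \o (fun y => w x - w y)).
    exact: integrableB (ic x) iw.
  have := le_normr_Rintegral mq ii; rewrite -lee_fin => /le_trans; apply.
  rewrite /Rintegral fineK//.
  by apply: integrable_fin_num => //; exact: integrable_abse ii.
- by move=> x _; apply: integral_ge0.
- by rewrite lee_fin invr_ge0 ltW.
Qed.

End smooth_more.

(** With u = p + i r and (grad_a u)_j = X + i Y, the left side is |(grad_a (e g u))_j|^2 for a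
    cutoff e with derivative de. Differentiating g only helps: with P = p X + r Y it adds -4 g^3 P^2
    (1 - g w) <= 0 to g^2 (X^2 + Y^2). The rest uses g <= 1 / m and g^2 w <= 1 / (4 m). *)
Lemma truncated_energy_le {R : realType} (X Y p r e g de K m : R) : 0 < m ->
  g = (m + (p ^+ 2 + r ^+ 2))^-1 -> 0 <= e <= 1 -> `|de| <= K ->
  (e * g * X + (de * g + e * (- g ^+ 2 * (2 * (p * X + r * Y)))) * p) ^+ 2 +
  (e * g * Y + (de * g + e * (- g ^+ 2 * (2 * (p * X + r * Y)))) * r) ^+ 2 <=
  2 / m ^+ 2 * (X ^+ 2 + Y ^+ 2) + K ^+ 2 / (2 * m).
Proof.
move=> m0 ge e01 dK; set w := p ^+ 2 + r ^+ 2 in ge.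
have w0 : 0 <= w by rewrite addr_ge0 ?sqr_ge0.
have mw : 0 < m + w by lra.
have g0 : 0 < g by rewrite ge invr_gt0.
have gm : g * (m + w) = 1 by rewrite ge mulVf ?gt_eqF.
pose P := p * X + r * Y.
pose Z1 := g * X - 2 * g ^+ 2 * P * p; pose Z2 := g * Y - 2 * g ^+ 2 * P * r.
have -> : e * g * X + (de * g + e * (- g ^+ 2 * (2 * P))) * p = e * Z1 + de * g * p.
  by rewrite /Z1; ring.
have -> : e * g * Y + (de * g + e * (- g ^+ 2 * (2 * P))) * r = e * Z2 + de * g * r.
  by rewrite /Z2; ring.
have hZ : Z1 ^+ 2 + Z2 ^+ 2 <= g ^+ 2 * (X ^+ 2 + Y ^+ 2).
  have -> : Z1 ^+ 2 + Z2 ^+ 2 = g ^+ 2 * (X ^+ 2 + Y ^+ 2) -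
      4 * g ^+ 3 * P ^+ 2 * (1 - g * w) by rewrite /Z1 /Z2 /w /P; ring.
  rewrite gerBl; apply: mulr_ge0; last by have := mulr_gt0 g0 m0; lra.
  by rewrite mulr_ge0 ?sqr_ge0// mulr_ge0// exprn_ge0// ltW.
have gm2 : g ^+ 2 <= (m ^+ 2)^-1.
  rewrite ge exprVn lef_pV2 ?posrE ?exprn_gt0//.
  by rewrite !expr2; apply: ler_pM; lra.
have g2w : g ^+ 2 * w <= (4 * m)^-1.
  rewrite ge exprVn mulrC ler_pdivrMr ?exprn_gt0// mulrC ler_pdivlMr ?mulr_gt0//.
  by have := sqr_ge0 (m - w); rewrite !expr2; lra.
have de2 : de ^+ 2 <= K ^+ 2.
  rewrite -(real_normK (num_real de)) ler_pXn2r ?nnegrE//.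
  exact: le_trans (normr_ge0 _) dK.
have e2 : e ^+ 2 <= 1 by rewrite expr_le1//; lra.
have sq2 (a b : R) : (a + b) ^+ 2 <= 2 * a ^+ 2 + 2 * b ^+ 2.
  by have := sqr_ge0 (a - b); rewrite !expr2; lra.
apply: (le_trans (lerD (sq2 _ _) (sq2 _ _))).
have -> : 2 * (e * Z1) ^+ 2 + 2 * (de * g * p) ^+ 2 +
  (2 * (e * Z2) ^+ 2 + 2 * (de * g * r) ^+ 2) =
  2 * (e ^+ 2 * (Z1 ^+ 2 + Z2 ^+ 2)) + 2 * (de ^+ 2 * (g ^+ 2 * w)) by rewrite /w; ring.
have S0 : 0 <= X ^+ 2 + Y ^+ 2 by rewrite addr_ge0 ?sqr_ge0.
apply: lerD.
  rewrite -mulrA ler_pM2l//; apply: (@le_trans _ _ (Z1 ^+ 2 + Z2 ^+ 2)).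
    by rewrite ler_piMl// addr_ge0 ?sqr_ge0.
  by apply: (le_trans hZ); exact: ler_wpM2r.
have -> : K ^+ 2 / (2 * m) = 2 * (K ^+ 2 * (4 * m)^-1) by field; rewrite gt_eqF.
rewrite ler_pM2l//; apply: ler_pM => //; first exact: sqr_ge0.
by rewrite mulr_ge0 ?sqr_ge0.
Qed.

(** w / (m + w)^2 equals its maximum 1 / (4 m) minus (w - m)^2 / (4 m (m + w)^2). As |w - m| <= m +
    w, this defect is at most linear in |w - m|. *)
Lemma truncated_lower {R : realType} (m w : R) : 0 < m -> 0 <= w ->
  (4 * m)^-1 <= ((m + w)^-1) ^+ 2 * w + (4 * m ^+ 2)^-1 * `|w - m|.
Proof.
move=> m0 w0; have mw : 0 < m + w by lra.
have -> : ((m + w)^-1) ^+ 2 * w = (4 * m)^-1 - (w - m) ^+ 2 / (4 * m * (m + w) ^+ 2).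
  by field; rewrite !gt_eqF.
suff : (w - m) ^+ 2 / (4 * m * (m + w) ^+ 2) <= (4 * m ^+ 2)^-1 * `|w - m| by lra.
have nn := normr_ge0 (w - m).
rewrite -(real_normK (num_real (w - m))) ler_pdivrMr; last first.
  by rewrite mulr_gt0 ?exprn_gt0// mulr_gt0.
have -> : (4 * m ^+ 2)^-1 * `|w - m| * (4 * m * (m + w) ^+ 2) =
  `|w - m| * ((m + w) ^+ 2 / m) by field; rewrite gt_eqF.
rewrite expr2 ler_wpM2l// ler_pdivlMr//.
have h : `|w - m| <= m + w by rewrite ler_norml; lra.
rewrite expr2; apply: ler_pM => //; lra.
Qed.

Section truncation.
Local Open Scope complex_scope.
Context {R : realType} {n : nat}.
Variables (a : 'rV[R]_n -> 'rV[R]_n) (u : 'rV[R]_n -> R[i]) (U : set 'rV[R]_n)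
  (l : 'rV[R]_n) (s M : R).
Hypothesis s0 : 0 < s.
Hypothesis oU : open U.
Hypothesis qU : cbox l s `<=` U.
Hypothesis su : csmooth_on U u.
Hypothesis ma : forall j, measurable_fun setT (fun x => a x ord0 j).

Local Notation q := (hcube l s).
Local Notation mu := (@lebesgue_rV R n).
Local Notation p := (repart u).
Local Notation r := (impart u).

Hypothesis hE : (\int[mu]_(x in q) (magnetic_energy_density a u x)%:E <=
  M%:E * \int[mu]_(x in q) (sqmod (u x))%:E)%E.
Hypothesis W0 : (0 < \int[mu]_(x in q) (sqmod (u x))%:E)%E.
Hypothesis Woo : (\int[mu]_(x in q) (sqmod (u x))%:E < +oo)%E.
(** Smallness of the subcube. One 2^n comes from the cube of differences in [poincare_pairs], the
    other is the volume ratio of the cube to its concentric half, and the factor 2 leaves half of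
    the main term in [truncation_sqnorm_ge]. *)
Hypothesis hs : 2 ^+ n * 2 ^+ n * 2 * s * (M + n%:R) <= 1.

Let w x : R := sqmod (u x).

Let wE x : w x = p x * p x + r x * r x.
Proof. by rewrite /w /sqmod -!expr2. Qed.

Let Cp k : Ck k U p. Proof. by move: su => [/smooth_onP + _]; exact. Qed.
Let Cr k : Ck k U r. Proof. by move: su => [_ /smooth_onP]; exact. Qed.

Let Cw k : Ck k U w.
Proof.
rewrite (_ : w = fun x => p x * p x + r x * r x); last exact/funext/wE.
by apply: CkD => //; exact: CkM.
Qed.

(** D_j |u|^2 = 2 Re (conj(u) (grad_a u)_j): the term i a_j u is orthogonal to u, so a drops out. *)
Let Dw (j : 'I_n) x : U x -> 'D_(basis_rV j) w x =
  2 * (p x * mpart_re a j u x + r x * mpart_im a j u x).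
Proof.
move=> Ux; rewrite (_ : w = p * p + r * r); last by apply/funext => y; rewrite wE.
have dp := Ck_derivable (Cp 1%N) Ux; have dr := Ck_derivable (Cr 1%N) Ux.
rewrite deriveD; [|exact: derivableM|exact: derivableM].
rewrite !deriveM// -![_ *: _]/(_ * _) /mpart_re /mpart_im; ring.
Qed.

Let qU' : q `<=` U.
Proof. by move=> x /hcube_sub_box/qU. Qed.

Let mq : measurable q := measurable_hcube l s.

Let mw : measurable_fun q w.
Proof.
apply: (measurable_funS (open_measurable_rV oU) qU').
by apply: continuous_on_measurable => // x; exact: Ck_continuous (Cw 0).
Qed.

Let mE : measurable_fun q (magnetic_energy_density a u).
Proof.
by apply: (measurable_funS (open_measurable_rV oU) qU'); exact: measurable_energy.
Qed.

Let mEe : measurable_fun q (fun x => (magnetic_energy_density a u x)%:E).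
Proof. exact/measurable_EFinP. Qed.

Let Ee0 x : q x -> (0 <= (magnetic_energy_density a u x)%:E)%E.
Proof. by move=> _; rewrite lee_fin energy_density_ge0. Qed.

Let mwe : measurable_fun q (fun x => (w x)%:E).
Proof. exact/measurable_EFinP. Qed.

Let we0 x : q x -> (0 <= (w x)%:E)%E.
Proof. by move=> _; rewrite lee_fin sqmod_ge0. Qed.

Let m := (\int[mu]_(x in q) w x) / s ^+ n.

Let sn0 : 0 < s ^+ n. Proof. exact: exprn_gt0. Qed.

Let intw : (\int[mu]_(x in q) (w x)%:E = (m * s ^+ n)%:E)%E.
Proof.
rewrite /m divfK ?gt_eqF// /Rintegral fineK// ge0_fin_numE//.
by rewrite ltW.
Qed.

Let m0 : 0 < m.
Proof.
by move: W0; rewrite -/(w _) intw lte_fin pmulr_lgt0.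
Qed.

Let muq : mu q = (s ^+ n)%:E.
Proof. by apply: lebesgue_hcube; exact: ltW. Qed.

(** By [Dw], |D_j |u|^2| <= |(grad_a u)_j|^2 + |u|^2; summed over j and integrated this gives the
    factor M + n. The volume (s / 2)^n is that of the half cube on which the cutoff is bounded
    below. *)
Let average_bound : (\int[mu]_(x in q) `|w x - m|%:E <=
  (m * (s / 2) ^+ n / 2)%:E)%E.
Proof.
have iw : mu.-integrable q (EFin \o w).
  apply/integrableP; split; first exact/measurable_EFinP.
  rewrite (eq_integral (fun x => (w x)%:E)) ?Woo// => x _ /=.
  by rewrite ger0_norm// sqmod_ge0.
apply: (le_trans (integral_average_le s0 iw (erefl m))).
have dw j x : U x -> derivable w x (basis_rV j) /\ {for x, continuous ('D_(basis_rV j) w)}.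
  move=> Ux; split; first exact: (Ck_derivable (Cw 1%N) Ux).
  exact: (Ck_continuous (Ck_derive j (Cw 1%N))).
have cw x : U x -> {for x, continuous w} by exact: Ck_continuous (Cw 0).
have h := poincare_pairs s0 oU qU' cw dw.
have mDw j : measurable_fun q (fun x => `|'D_(basis_rV j) w x|%:E).
  apply/measurable_EFinP; apply: measurableT_comp => //.
  apply: (measurable_funS (open_measurable_rV oU) qU').
  by apply: continuous_on_measurable => // x /(dw j)[].
have hsum : (\sum_(j < n) \int[mu]_(x in q) `|'D_(basis_rV j) w x|%:E <=
    (M + n%:R)%:E * (m * s ^+ n)%:E)%E.
  rewrite -ge0_integral_sum//.
  apply: (@le_trans _ _ (\int[mu]_(x in q)
      ((magnetic_energy_density a u x)%:E + n%:R%:E * (w x)%:E))%E).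
    apply: ge0_le_integral => //.
    - by move=> x _; apply: sume_ge0.
    - exact: emeasurable_sum.
    - by apply: emeasurable_funD => //; exact: measurable_funeM.
    move=> x qx; rewrite sumEFin -EFinM -EFinD lee_fin energy_densityE.
    have -> : n%:R * w x = \sum_(j < n) w x.
      by rewrite sumr_const card_ord mulr_natl.
    rewrite -big_split/=; apply: ler_sum => j _.
    rewrite Dw; last exact: qU'.
    rewrite wE ler_norml.
    set X := mpart_re _ _ _ _; set Y := mpart_im _ _ _ _.
    have := sqr_ge0 (X - p x); have := sqr_ge0 (Y - r x).
    have := sqr_ge0 (X + p x); have := sqr_ge0 (Y + r x).
    rewrite !expr2; lra.
  have nw0 x : q x -> (0 <= n%:R%:E * (w x)%:E)%E.
    by move=> qx; rewrite mule_ge0// we0.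
  rewrite (ge0_integralD mu mq Ee0 mEe nw0 (measurable_funeM _ mwe)).
  rewrite (ge0_integralZl mu mq mwe we0)//.
  rewrite intw EFinD [leRHS]muleDl//; apply: leeD => //.
  by rewrite -intw.
apply: (@le_trans _ _ (((s ^+ n)^-1)%:E * (((2 * s) ^+ n * s)%:E *
    ((M + n%:R)%:E * (m * s ^+ n)%:E)))%E).
  apply: lee_wpmul2l; first by rewrite lee_fin invr_ge0 ltW.
  apply: (le_trans h); apply: lee_wpmul2l => //.
  by rewrite lee_fin mulr_ge0 ?exprn_ge0 ?mulr_ge0// ltW.
rewrite -!EFinM lee_fin exprMn [(s / 2) ^+ n]exprMn exprVn.
have t0 : 0 < 2 ^+ n :> R by rewrite exprn_gt0.
have := ler_wpM2r (ltW (mulr_gt0 m0 sn0)) hs.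
have S0 := sn0; set T := 2 ^+ n in t0 *; set S := s ^+ n in S0 * => h2.
rewrite (_ : S^-1 * _ = T * s * (M + n%:R) * (m * S)); last by field; rewrite gt_eqF.
rewrite (_ : m * (S / T) / 2 = (1 * (m * S)) / (T * 2)); last by field; rewrite gt_eqF.
rewrite ler_pdivlMr ?mulr_gt0//; apply: le_trans h2.
by rewrite le_eqVlt; apply/orP; left; apply/eqP; ring.
Qed.

Let eta := cutoff l s.
Let g x : R := (m + w x)^-1.
Let kk x : R := eta x * g x.

Definition truncation (x : 'rV[R]_n) : R[i] := (kk x)%:C * u x.

Let mw0 x : 0 < m + w x.
Proof. by rewrite ltr_wpDr// sqmod_ge0. Qed.

Let Cg k : Ck k U g.
Proof.
apply: CkV => //; first by move=> x _; rewrite gt_eqF.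
by apply: CkD => //; exact: Ck_cst.
Qed.

Let Ckk k : Ck k U kk.
Proof.
apply: CkM => //; exact: (Ck_sub (subsetT _) (Ck_cutoff k l s)).
Qed.

Let re_trunc : repart truncation = fun x => kk x * p x.
Proof.
by apply/funext => x; rewrite /repart /truncation; case: (u x) => ? ? /=; rewrite mul0r subr0.
Qed.

Let im_trunc : impart truncation = fun x => kk x * r x.
Proof.
by apply/funext => x; rewrite /impart /truncation; case: (u x) => ? ? /=; rewrite mul0r addr0.
Qed.

Lemma truncation_eq0 x : ~ q x -> truncation x = 0.
Proof.
by move=> /cutoff_eq0 h; rewrite /truncation /kk /eta h mul0r mul0r.
Qed.

Let oW : open (~` cbox l s).
Proof. by apply: closed_openC; exact: cbox_closed. Qed.

Let Wq x : (~` cbox l s) x -> ~ q x.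
Proof. by move=> h /hcube_sub_box. Qed.

Let cover : U `|` ~` cbox l s = setT.
Proof.
apply/seteqP; split=> // x _; have [h|h] := pselect (cbox l s x); [left|right] => //.
exact: qU.
Qed.

(** On [U] the defining formula is smooth; on the complement of the closed box the function is 0,
    whatever u is there. These two open sets cover the space. *)
Lemma truncation_test_function : test_function truncation.
Proof.
split.
  split; apply/smooth_onP => k; rewrite -cover; apply: CkU.
  - by rewrite -/(repart truncation) re_trunc; exact: CkM.
  - apply: (Ck_ext oW _ (Ck_cst k _ 0)) => x /Wq/truncation_eq0 h.
    by rewrite h.
  - by rewrite -/(impart truncation) im_trunc; exact: CkM.
  - apply: (Ck_ext oW _ (Ck_cst k _ 0)) => x /Wq/truncation_eq0 h.
    by rewrite h.
apply: (@subclosed_compact _ _ (cbox l s)); [exact: closed_closure|exact: cbox_compact|].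
have /closure_id -> := @cbox_closed R n l s.
apply: closure_subset => x /= tx; apply: contrapT => /Wq/truncation_eq0 h.
by rewrite h eqxx in tx.
Qed.

Let Dkk (j : 'I_n) x : U x -> 'D_(basis_rV j) kk x = 'D_(basis_rV j) eta x * g x +
  eta x * (- g x ^+ 2 * (2 * (p x * mpart_re a j u x + r x * mpart_im a j u x))).
Proof.
move=> Ux.
have de : derivable eta x (basis_rV j).
  exact: (Ck_derivable (Ck_cutoff 1%N l s) I).
have dg : derivable g x (basis_rV j) by exact: (Ck_derivable (Cg 1%N) Ux).
rewrite [LHS](deriveM de dg) -![_ *: _]/(_ * _) addrC [g x * _]mulrC.
congr (_ + _ * _); rewrite -(Dw _ Ux).
have dmw : derivable (fun x => m + w x) x (basis_rV j).
  by apply: derivableD; [exact: derivable_cst|exact: (Ck_derivable (Cw 1%N) Ux)].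
rewrite [LHS](deriveV _ dmw) ?gt_eqF//.
have -> : 'D_(basis_rV j) (fun x => m + w x) x = 'D_(basis_rV j) w x.
  rewrite [LHS]deriveD; [|exact: derivable_cst|exact: (Ck_derivable (Cw 1%N) Ux)].
  by rewrite derive_cst add0r.
by rewrite -[_ *: _]/(_ * _) /g exprVn.
Qed.

Let mre_trunc (j : 'I_n) x : U x -> mpart_re a j truncation x =
  kk x * mpart_re a j u x + 'D_(basis_rV j) kk x * p x.
Proof.
move=> Ux; rewrite /mpart_re re_trunc im_trunc.
have dk : derivable kk x (basis_rV j) by exact: (Ck_derivable (Ckk 1%N) Ux).
have dp : derivable p x (basis_rV j) by exact: (Ck_derivable (Cp 1%N) Ux).
rewrite [X in X - _](deriveM dk dp) -![_ *: _]/(_ * _); ring.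
Qed.

Let mim_trunc (j : 'I_n) x : U x -> mpart_im a j truncation x =
  kk x * mpart_im a j u x + 'D_(basis_rV j) kk x * r x.
Proof.
move=> Ux; rewrite /mpart_im re_trunc im_trunc.
have dk : derivable kk x (basis_rV j) by exact: (Ck_derivable (Ckk 1%N) Ux).
have dp : derivable r x (basis_rV j) by exact: (Ck_derivable (Cr 1%N) Ux).
rewrite [X in X + _](deriveM dk dp) -![_ *: _]/(_ * _); ring.
Qed.

(** At points of [U] off the cube, the cutoff vanishes and so does its gradient, 0 being its
    minimum; at points outside [U] the function vanishes in a neighbourhood. *)
Lemma truncation_mpart_eq0 j x : ~ q x ->
  mpart_re a j truncation x = 0 /\ mpart_im a j truncation x = 0.
Proof.
move=> nqx; have eta0 : eta x = 0 by exact: cutoff_eq0.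
have [Ux|nUx] := pselect (U x).
  rewrite mre_trunc// mim_trunc// Dkk//.
  rewrite (_ : 'D_ _ eta x = 0); last first.
    apply: derive_ge0_eq0 => //; first by move=> y; exact: cutoff_ge0.
    by move=> y; exact: (Ck_derivable (Ck_cutoff 1%N l s) I).
  by rewrite /kk eta0 !mul0r !addr0 !mul0r !add0r.
have Wx : (~` cbox l s) x by move=> /qU.
have nW : \near x, truncation x = 0.
  by near=> y; apply/truncation_eq0/Wq; near: y; exact: open_nbhs_nbhs.
have t0 : truncation x = 0 by exact: truncation_eq0.
rewrite /mpart_re /mpart_im /repart /impart t0 !mulr0 subr0 addr0.
by split; (rewrite (@near_eq_derive _ _ _ _ (fun=> 0)) ?derive_cst//; near do move=> /=);
  apply: filterS nW => y ->.
Unshelve. all: by end_near. Qed.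

Lemma sqmod_truncation x : sqmod (truncation x) = eta x ^+ 2 * (g x ^+ 2 * w x).
Proof.
rewrite /sqmod -/(repart truncation x) -/(impart truncation x) re_trunc im_trunc /kk.
by rewrite wE; ring.
Qed.

Lemma sqmod_truncation_le x : sqmod (truncation x) <= (4 * m)^-1.
Proof.
rewrite sqmod_truncation; apply: (@le_trans _ _ (g x ^+ 2 * w x)).
  have e1 : eta x ^+ 2 <= 1 by rewrite exprn_ile1 ?cutoff_ge0 ?cutoff_le1.
  by rewrite ler_piMl// mulr_ge0 ?sqr_ge0 ?sqmod_ge0.
have := mw0 x; rewrite /g exprVn mulrC => h.
have m4 : 0 < 4 * m by apply: mulr_gt0.
rewrite ler_pdivrMr ?exprn_gt0// mulrC ler_pdivlMr//.
by have := sqr_ge0 (m - w x); rewrite !expr2; lra.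
Qed.

(** This bound, [sqmod_truncation_le] and [truncation_sqnorm_ge] all scale like 1 / m, so m, the
    only trace of u, cancels in the quotient. *)
Lemma truncation_energy_le :
  (\int[mu]_x (magnetic_energy_density a truncation x)%:E <=
   ((2 * M + n%:R * (4 * n)%:R ^+ 2 / 2) * s ^+ n / m)%:E)%E.
Proof.
rewrite (@integral_supported _ _ q); last first.
  move=> x nqx; rewrite energy_densityE big1// => j _.
  by have [-> ->] := truncation_mpart_eq0 j nqx; rewrite expr0n addr0.
pose K : R := (4 * n)%:R.
apply: (@le_trans _ _ (\int[mu]_(x in q) ((2 / m ^+ 2)%:E *
   (magnetic_energy_density a u x)%:E + (n%:R * (K ^+ 2 / (2 * m)))%:E))%E).
  have [st _] := truncation_test_function.
  apply: ge0_le_integral => //.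
  - by move=> x _; rewrite lee_fin energy_density_ge0.
  - by apply/measurable_EFinP/measurable_funTS; apply: measurable_energy => //; exact: openT.
  - apply: emeasurable_funD => //; apply: measurable_funeM; exact/measurable_EFinP.
  move=> x qx; rewrite -EFinM -EFinD lee_fin !energy_densityE.
  have -> : n%:R * (K ^+ 2 / (2 * m)) = \sum_(j < n) (K ^+ 2 / (2 * m)).
    by rewrite sumr_const card_ord mulr_natl.
  rewrite mulr_sumr -big_split; apply: ler_sum => j _ /=.
  have Ux := qU' qx; rewrite mre_trunc// mim_trunc// Dkk//.
  apply: truncated_energy_le => //.
  - by rewrite cutoff_ge0 cutoff_le1.
  - exact: cutoff_derive_le.
have c0 : 0 <= 2 / m ^+ 2 by rewrite divr_ge0// exprn_ge0// ltW.
have c1 : 0 <= n%:R * (K ^+ 2 / (2 * m)).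
  by rewrite mulr_ge0// divr_ge0 ?sqr_ge0// mulr_ge0// ltW.
have cE0 x : q x -> (0 <= (2 / m ^+ 2)%:E * (magnetic_energy_density a u x)%:E)%E.
  by move=> qx; rewrite mule_ge0// Ee0.
have cc0 (x : 'rV[R]_n) : q x -> (0 <= (n%:R * (K ^+ 2 / (2 * m)))%:E)%E by [].
have mc : measurable_fun q (fun=> (n%:R * (K ^+ 2 / (2 * m)))%:E) by [].
rewrite (ge0_integralD mu mq cE0 (measurable_funeM _ mEe) cc0 mc).
rewrite (ge0_integralZl mu mq mEe Ee0)//.
have -> : (\int[mu]_(_ in q) (n%:R * (K ^+ 2 / (2 * m)))%:E =
    (n%:R * (K ^+ 2 / (2 * m)))%:E * (s ^+ n)%:E)%E by rewrite integral_cst// -muq.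
apply: (@le_trans _ _ ((2 / m ^+ 2)%:E * (M%:E * (m * s ^+ n)%:E) +
   (n%:R * (K ^+ 2 / (2 * m)))%:E * (s ^+ n)%:E)%E).
  by apply: leeD => //; apply: lee_wpmul2l => //; rewrite -intw.
rewrite -!EFinM -EFinD lee_fin le_eqVlt; apply/orP; left; apply/eqP.
by rewrite -/K; field; rewrite gt_eqF.
Qed.

(** On the half cube [J], where the cutoff is at least c, [truncated_lower] bounds |phi|^2 from
    below by c^2 / (4 m) - b |w - m|. By [average_bound] the error takes at most half of the main
    term, whence 8 in place of 4. *)
Lemma truncation_sqnorm_ge :
  (((flat 0 (s / 4) ^+ (2 * n)) ^+ 2 * (s / 2) ^+ n / (8 * m))%:E <=
   \int[mu]_x (sqmod (truncation x))%:E)%E.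
Proof.
set c := flat 0 (s / 4) ^+ (2 * n).
pose J := hcube (l + const_mx (s / 4)) (s / 2).
have s2 : 0 <= s / 2 by rewrite divr_ge0// ltW.
have Jq : J `<=` q.
  move=> x Jx i; have := Jx i; rewrite !mxE; have := s0; lra.
have mJ : measurable J by exact: measurable_hcube.
have [[sr si] _] := truncation_test_function.
have mt : measurable_fun setT (fun x => sqmod (truncation x)).
  rewrite (_ : (fun x => _) = fun x => repart truncation x ^+ 2 + impart truncation x ^+ 2)//.
  apply: measurable_funD; apply: measurable_funX; apply: continuous_on_measurable;
    try exact: openT; move=> x _; [exact: (sr [::] x I).1|exact: (si [::] x I).1].
have md : measurable_fun q (fun x => `|w x - m|).
  by apply: measurableT_comp => //; exact: measurable_funB.
pose b := c ^+ 2 * (4 * m ^+ 2)^-1.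
have b0 : 0 <= b.
  by rewrite mulr_ge0 ?sqr_ge0// invr_ge0 mulr_ge0// sqr_ge0.
have key : ((c ^+ 2 * (4 * m)^-1 * (s / 2) ^+ n)%:E <=
    \int[mu]_x (sqmod (truncation x))%:E + b%:E * (m * (s / 2) ^+ n / 2)%:E)%E.
  have -> : ((c ^+ 2 * (4 * m)^-1 * (s / 2) ^+ n)%:E =
      \int[mu]_(x in J) (c ^+ 2 * (4 * m)^-1)%:E)%E.
    by rewrite integral_cst// EFinM; congr (_ * _)%E; rewrite -(lebesgue_hcube (l + const_mx (s / 4)) s2).
  apply: (@le_trans _ _ (\int[mu]_(x in J) ((sqmod (truncation x))%:E + b%:E * `|w x - m|%:E))%E).
    apply: ge0_le_integral => //.
    - by move=> x _; rewrite lee_fin mulr_ge0 ?sqr_ge0// invr_ge0 mulr_ge0// ltW.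
    - apply: emeasurable_funD; first by apply/measurable_EFinP; exact: measurable_funTS.
      by apply: measurable_funeM; apply/measurable_EFinP; exact: measurable_funS md.
    move=> x Jx; rewrite -EFinM -EFinD lee_fin sqmod_truncation.
    have h := truncated_lower m0 (sqmod_ge0 (u x)).
    have ce : c ^+ 2 <= eta x ^+ 2.
      rewrite !expr2; have h2 := cutoff_lower s0 Jx; have c0 : 0 <= c by rewrite exprn_ge0 ?flat_ge0.
      by apply: ler_pM.
    apply: (@le_trans _ _ (c ^+ 2 * (g x ^+ 2 * w x) + b * `|w x - m|)).
      by rewrite /b -mulrA -mulrDr ler_wpM2l ?sqr_ge0.
    by rewrite lerD2r ler_wpM2r// mulr_ge0 ?sqr_ge0 ?sqmod_ge0.
  have mde : measurable_fun J (fun x => `|w x - m|%:E).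
    by apply/measurable_EFinP; exact: measurable_funS md.
  have mte : measurable_fun J (fun x => (sqmod (truncation x))%:E).
    by apply/measurable_EFinP; exact: measurable_funTS.
  have te0 x : J x -> (0 <= (sqmod (truncation x))%:E)%E.
    by move=> _; rewrite lee_fin sqmod_ge0.
  have de0 x : J x -> (0 <= b%:E * `|w x - m|%:E)%E.
    by move=> _; rewrite mule_ge0// lee_fin.
  rewrite (ge0_integralD mu mJ te0 mte de0 (measurable_funeM _ mde)).
  apply: leeD.
    apply: ge0_subset_integral => //; first exact/measurable_EFinP.
    by move=> x _; rewrite lee_fin sqmod_ge0.
  have d0 x : J x -> (0 <= `|w x - m|%:E)%E by move=> _; rewrite lee_fin.
  rewrite (ge0_integralZl mu mJ mde d0); last by rewrite lee_fin.
  apply: lee_wpmul2l => //; apply: le_trans average_bound.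
  by apply: ge0_subset_integral => //; exact/measurable_EFinP.
move: key; rewrite -EFinM -leeBlDr// -EFinB; apply: le_trans.
rewrite lee_fin le_eqVlt; apply/orP; left; apply/eqP.
by rewrite /b; field; rewrite gt_eqF.
Qed.

End truncation.

(** * Choice of a subcube by averaging *)

Section subcubes.
Context {R : realType} {n : nat}.
Implicit Types (f e : 'rV[R]_n -> R) (l c : 'rV[R]_n).
Local Notation mu := (@lebesgue_rV R n).

Let corner l (s : R) N (k : {ffun 'I_n -> 'I_N}) : 'rV[R]_n :=
  l + \row_i (s * (k i : nat)%:R).

Let grid_cover l s N : 0 < s -> (0 < N)%N ->
  hcube l (N%:R * s) = \big[setU/set0]_(k <- index_enum {ffun 'I_n -> 'I_N})
    hcube (corner l s k) s.
Proof.
move=> s0 N0; rewrite -bigcup_seq; apply/seteqP; split=> x.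
  move=> hx; pose t i := Num.trunc ((x ord0 i - l ord0 i) / s).
  have ht i : (t i)%:R * s <= x ord0 i - l ord0 i < (t i).+1%:R * s /\ (t i < N)%N.
    have /andP[h1 h2] := hx i.
    have h0 : 0 <= (x ord0 i - l ord0 i) / s by rewrite divr_ge0 ?subr_ge0// ltW.
    have /andP[h3 h4] := truncn_itv h0.
    split; first by rewrite -ler_pdivlMr// -ltr_pdivrMr// h3 h4.
    rewrite -(ltr_nat R); apply: le_lt_trans h3 _.
    by rewrite ltr_pdivrMr// ltrBlDl.
  exists [ffun i => Ordinal (ht i).2]; first by rewrite /= mem_index_enum.
  move=> i; rewrite !mxE ffunE /=; have [/andP[h1 h2] _] := ht i.
  by rewrite -natr1 mulrDl mul1r in h2; lra.
move=> [k _ hk] i; have := hk i; rewrite !mxE => /andP[h1 h2].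
have sk : 0 <= s * (k i : nat)%:R by rewrite mulr_ge0// ltW.
have : s * (k i).+1%:R <= s * N%:R by rewrite ler_pM2l// ler_nat ltn_ord.
rewrite -natr1 mulrDr mulr1 => h3; rewrite (mulrC N%:R); lra.
Qed.

Let grid_trivIset l s N : 0 < s ->
  trivIset [set` index_enum {ffun 'I_n -> 'I_N}] (fun k => hcube (corner l s k) s).
Proof.
move=> s0 k k' _ _ [x [hk hk']]; apply/ffunP => i; apply/val_inj.
have lt_k (a b : {ffun 'I_n -> 'I_N}) : hcube (corner l s a) s x ->
    hcube (corner l s b) s x -> (a i <= b i)%N.
  move=> ha hb; have := ha i; have := hb i; rewrite !mxE => /andP[_ h1] /andP[h2 _].
  rewrite -ltnS -(ltr_nat R) -(ltr_pM2l s0) -[in ltRHS]natr1 mulrDr mulr1; lra.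
by apply/eqP; rewrite eqn_leq !lt_k.
Qed.

(** If no subcube qualified, the reverse inequality would hold on each of them, trivially where f
    has integral 0, and hence on their union. *)
Lemma subcube_pigeonhole l s N f e (M : R) : 0 < s -> (0 < N)%N -> 0 <= M ->
  measurable_fun (hcube l (N%:R * s)) f -> measurable_fun (hcube l (N%:R * s)) e ->
  (forall x, 0 <= f x) -> (forall x, 0 <= e x) ->
  (\int[mu]_(x in hcube l (N%:R * s)) (e x)%:E <
   M%:E * \int[mu]_(x in hcube l (N%:R * s)) (f x)%:E)%E ->
  exists l', [/\ forall i, l ord0 i <= l' ord0 i /\ l' ord0 i + s <= l ord0 i + N%:R * s,
    (\int[mu]_(x in hcube l' s) (e x)%:E <= M%:E * \int[mu]_(x in hcube l' s) (f x)%:E)%E &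
    (0 < \int[mu]_(x in hcube l' s) (f x)%:E)%E].
Proof.
move=> s0 N0 M0 mf me f0 e0; apply: contraPP => no; apply/negP; rewrite -leNgt.
have le0 (g : 'rV[R]_n -> R) D : (forall x, 0 <= g x) -> (0 <= \int[mu]_(x in D) (g x)%:E)%E.
  by move=> g0; apply: integral_ge0 => x _; rewrite lee_fin.
have split_grid (g : 'rV[R]_n -> R) : measurable_fun (hcube l (N%:R * s)) g -> (forall x, 0 <= g x) ->
    (\int[mu]_(x in hcube l (N%:R * s)) (g x)%:E =
     \sum_(k <- index_enum {ffun 'I_n -> 'I_N}) \int[mu]_(x in hcube (corner l s k) s) (g x)%:E)%E.
  move=> mg g0; rewrite grid_cover// ge0_integral_bigsetU//.
  - by move=> k; exact: measurable_hcube.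
  - exact: index_enum_uniq.
  - exact: grid_trivIset.
  - by rewrite -grid_cover//; exact/measurable_EFinP.
  - by move=> x _; rewrite lee_fin.
rewrite !split_grid// ge0_sume_distrr; last by move=> k _; exact: le0.
apply: lee_sum => k _; rewrite leNgt; apply/negP => h; apply: no.
exists (corner l s k); split.
- move=> i; rewrite !mxE; have sk : 0 <= s * (k i : nat)%:R by rewrite mulr_ge0// ltW.
  have : s * (k i).+1%:R <= s * N%:R by rewrite ler_pM2l// ler_nat ltn_ord.
  by rewrite -natr1 mulrDr mulr1 (mulrC N%:R); lra.
- exact: ltW.
- rewrite lt_def le0// andbT; apply: contraTneq h => ->.
  by rewrite mule0 -leNgt; exact: le0.
Qed.

Definition obox c (d : R) : set 'rV[R]_n := [set x | forall i, `|x ord0 i - c ord0 i| < d / 2].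

Lemma cube_interior c d : (cube c d)° = obox c d.
Proof.
apply/seteqP; split=> x.
  move=> /nbhs_rVP[e e0 he] i.
  pose y (t : R) : 'rV[R]_n := \row_k (x ord0 k + if k == i then t else 0).
  have hy t : `|t| < e -> `|x ord0 i + t - c ord0 i| <= d / 2.
    move=> te; have := he (y t) _ i; rewrite mxE eqxx; apply=> k.
    by rewrite mxE addrAC subrr add0r; case: ifPn => // _; rewrite normr0.
  have e2 : `|e / 2| < e by rewrite gtr0_norm ?divr_gt0//; lra.
  have h1 := hy (e / 2) e2; have h2 := hy (- (e / 2)).
  rewrite normrN in h2; have {}h2 := h2 e2.
  by move: h1 h2; rewrite !ler_norml ltr_norml; lra.
move=> hx; have : \forall y \near x, obox c d y.
  apply: (@filter_forall _ 'I_n (fun i y => `|y ord0 i - c ord0 i| < d / 2) (nbhs x)) => i.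
  have cc : {for x, continuous (fun y : 'rV[R]_n => `|y ord0 i - c ord0 i|)}.
    apply: (@continuous_comp _ _ _ (fun y : 'rV[R]_n => y ord0 i)
      (fun t : R => `|t - c ord0 i|) x); first exact: coord_continuous.
    by apply: cvg_norm; apply: cvgB; [exact: cvg_id|exact: cvg_cst].
  by apply: (cvgr_lt _ cc); exact: hx.
by apply: filterS => y hy i; exact/ltW/hy.
Qed.

Lemma obox_open c d : open (obox c d).
Proof. by rewrite -cube_interior; exact: open_interior. Qed.

(** Functions competing in the local energy are smooth only inside the cube, whereas the truncation
    requires smoothness near a closed box. Concentric cubes exhaust the open cube, and keeping half
    the mass at most doubles the energy quotient. *)
Lemma half_integral_inner_cube c d f : 0 < d -> (forall x, 0 <= f x) ->
  measurable_fun (obox c d) f ->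
  (0 < \int[mu]_(x in obox c d) (f x)%:E < +oo)%E ->
  exists2 d', d / 2 <= d' < d &
    (\int[mu]_(x in obox c d) (f x)%:E <
     2%:E * \int[mu]_(x in hcube (c - const_mx (d' / 2))%R d') (f x)%:E)%E.
Proof.
move=> d0 f0 mf /andP[F0 Foo].
(* Edges increasing from d / 2, at k = 0, towards d. *)
pose dd k : R := d * (1 - k.+2%:R^-1).
have ddlt k : dd k < d.
  by rewrite /dd -[ltRHS]mulr1 ltr_pM2l// ltrBlDr ltrDl invr_gt0.
have ddge k : d / 2 <= dd k.
  rewrite /dd ler_pM2l// lerBrDr -lerBrDl.
  have -> : 1 - 2^-1 = 2^-1 :> R by field.
  by rewrite lef_pV2 ?posrE// ler_nat.
pose B k := hcube (c - const_mx (dd k / 2)) (dd k).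
have BE : \bigcup_k B k = obox c d.
  apply/seteqP; split=> [x [k _ Bx] i|x hx].
    have := Bx i; rewrite !mxE ltr_norml; have := ddlt k; lra.
  have [D [D0 hD]] : exists D, D < d / 2 /\ forall i, `|x ord0 i - c ord0 i| <= D.
    exists (\big[Num.max/0]_i `|x ord0 i - c ord0 i|); split.
      by apply/bigmax_ltP; split=> //; rewrite divr_gt0.
    by move=> i; exact: le_bigmax_cond.
  have e0 : 0 < (d / 2 - D) / d by rewrite divr_gt0// subr_gt0.
  have [k _ /(_ k (leqnn k))/= hk] := near_infty_natSinv_lt (PosNum e0).
  exists k => // i; rewrite !mxE; have := hD i; rewrite ler_norml.
  have : D < dd k / 2.
    rewrite ltr_pdivlMr// /dd.
    have h : k.+2%:R^-1 <= k.+1%:R^-1 :> R by rewrite lef_pV2 ?posrE// ler_nat.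
    have := le_lt_trans h hk; rewrite ltr_pdivlMr//.
    by set X := _^-1; rewrite mulrBr mulr1 (mulrC d) => ?; lra.
  lra.
have mB k : measurable (B k) by exact: measurable_hcube.
have BO k : B k `<=` obox c d by rewrite -BE; exact: bigcup_sup.
have mO : measurable (obox c d) by apply: open_measurable_rV; exact: obox_open.
have mfe : measurable_fun (obox c d) (EFin \o f) by exact/measurable_EFinP.
have ndB : nondecreasing_seq B.
  move=> i j ij; apply/subsetPset => x hx k; have := hx k; rewrite !mxE.
  have : dd i <= dd j.
    by rewrite ler_pM2l// lerD2l lerN2 lef_pV2 ?posrE// ler_nat !ltnS.
  lra.
have cv := @ge0_nondecreasing_set_cvg_integral _ _ R B (EFin \o f) mu ndB mB
  (fun k => measurable_funS mO (BO k) mfe) (fun k x _ => f0 x).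
rewrite BE in cv.
pose F := fine (\int[mu]_(x in obox c d) (f x)%:E).
have FE : (\int[mu]_(x in obox c d) (f x)%:E = F%:E)%E.
  by rewrite /F fineK// ge0_fin_numE// ltW.
have Fp : 0 < F by rewrite -lte_fin -FE.
apply: contrapT => no.
have : (F%:E <= (F / 2)%:E)%E.
  rewrite -[leLHS]FE -(cvg_lim _ cv)//; apply: lime_le; first by apply/cvg_ex; eexists; exact: cv.
  apply: nearW => k; rewrite leNgt; apply/negP => h; apply: no.
  exists (dd k); first by rewrite ddge ddlt.
  rewrite FE; apply: (@le_lt_trans _ _ (2%:E * (F / 2)%:E)%E).
    by rewrite -EFinM lee_fin mulrC divfK.
  by rewrite lte_pmul2l.
by rewrite lee_fin; lra.
Qed.

End subcubes.

(** * A test function on a cube where the conclusion fails *)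

Section bad_cube.
Context {R : realType} {n : nat}.
Local Notation mu := (@lebesgue_rV R n).

Lemma sqnorm_onE D (u : 'rV[R]_n -> R[i]) :
  sqnorm_on D u = (\int[mu]_(x in D) (sqmod (u x))%:E)%E.
Proof. by apply: eq_integral => x _; rewrite normc_sqr. Qed.

(** Makes the inverse in [rayleigh_quotient] a genuine one, not the default value at 0. *)
Lemma sqmod_integral_gt0 (U : set 'rV[R]_n) (u : 'rV[R]_n -> R[i]) x : open U ->
  csmooth_on U u -> U x -> u x != 0 -> (0 < \int[mu]_(y in U) (sqmod (u y))%:E)%E.
Proof.
move=> oU [/smooth_onP sr /smooth_onP si] Ux ux0.
have Cs : Ck 0 U (fun y => repart u y * repart u y + impart u y * impart u y).
  by apply: CkD => //; exact: CkM.
have sE y : sqmod (u y) = repart u y * repart u y + impart u y * impart u y.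
  by rewrite /sqmod -!expr2.
have sx : 0 < sqmod (u x).
  rewrite lt_def sqmod_ge0 andbT; apply: contraNneq ux0 => /eqP.
  rewrite paddr_eq0 ?sqr_ge0// !sqrf_eq0 => /andP[/eqP h1 /eqP h2].
  by apply/eqP; case: (u x) h1 h2 => ? ? /= -> ->.
have ms : measurable_fun U (fun y => sqmod (u y)).
  under eq_fun do rewrite sE.
  by apply: continuous_on_measurable => // y; exact: Ck_continuous Cs.
have : \forall y \near x, U y /\ sqmod (u x) / 2 < sqmod (u y).
  apply: filterI; first exact: open_nbhs_nbhs.
  have cx := Ck_continuous Cs Ux.
  have : \forall y \near x, sqmod (u x) / 2 <
      repart u y * repart u y + impart u y * impart u y.
    by apply: (cvgr_gt _ cx); rewrite -sE; lra.
  by apply: filterS => y; rewrite sE.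
move=> /nbhs_rVP[e e0 he].
pose q := hcube x e.
have mq : measurable q by exact: measurable_hcube.
have qh y : q y -> U y /\ sqmod (u x) / 2 < sqmod (u y).
  move=> qy; apply: he => i; have /andP[h1 h2] := qy i.
  by rewrite ger0_norm ?subr_ge0// ltrBlDl.
have qU : q `<=` U by move=> y /qh[].
apply: (@lt_le_trans _ _ (\int[mu]_(y in q) (sqmod (u x) / 2)%:E)%E).
  rewrite integral_cst//; apply: mule_gt0; first by rewrite lte_fin divr_gt0.
  by have := lebesgue_hcube x (ltW e0) => h; rewrite [X in (0 < X)%E]h lte_fin exprn_gt0.
apply: (@le_trans _ _ (\int[mu]_(y in q) (sqmod (u y))%:E)%E).
  apply: ge0_le_integral => //.
  - by move=> y _; rewrite lee_fin divr_ge0// ltW.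
  - by apply/measurable_EFinP; apply: measurable_funS ms => //; exact: open_measurable_rV.
  - by move=> y /qh[_ /ltW]; rewrite lee_fin.
apply: ge0_subset_integral => //.
- exact: open_measurable_rV.
- exact/measurable_EFinP.
- by move=> y _; rewrite lee_fin sqmod_ge0.
Qed.

(** [K] is chosen before a, V and the centre: a single bound has to serve a whole sequence of cubes
    going to infinity. *)
Lemma bad_cube_test_function (d M : R) : 0 < d -> exists K : R,
  forall (a : 'rV[R]_n -> 'rV[R]_n) (V : 'rV[R]_n -> R) (c : 'rV[R]_n),
  (forall j, measurable_fun setT (fun x => a x ord0 j)) ->
  measurable_fun setT V -> (forall x, 0 <= V x) ->
  (local_energy a (cube c d) +
    ((d ^+ n)^-1)%:E * \int[mu]_(x in cube c d) (V x)%:E < M%:E)%E ->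
  exists phi : 'rV[R]_n -> R[i],
  [/\ test_function phi,
      forall x, ~ cube c d x -> phi x = 0,
      forall j x, ~ cube c d x -> mpart_re a j phi x = 0 /\ mpart_im a j phi x = 0,
      (0 < \int[mu]_x (sqmod (phi x))%:E)%E &
      (\int[mu]_x (magnetic_energy_density a phi x)%:E +
       \int[mu]_x (V x * sqmod (phi x))%:E <= K%:E * \int[mu]_x (sqmod (phi x))%:E)%E].
Proof.
(* The constant of the smallness condition of the truncation, with 2 M for M because passing to the
   inner cube may double the quotient. *)
move=> d0; pose C : R := 2 ^+ n * 2 ^+ n * 2 * (2 * M + n%:R).
(* The subcubes have edge s <= d / N, hence s C <= 1. *)
pose N := (Num.trunc (d * C)).+1.
(* [A1 / m] bounds energy plus potential term, the latter by int_Q V <= M d^n and |phi|^2 <= 1 / (4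
   m). [L1 / m] bounds the squared norm from below, with s >= d / (2 N) because the inner cube has
   edge at least d / 2. *)
pose A1 : R := (2 * (2 * M) + n%:R * (4 * n)%:R ^+ 2 / 2) * d ^+ n + M * d ^+ n / 4.
pose L1 : R := (flat 0 (d / (8 * N%:R)) ^+ (2 * n)) ^+ 2 * (d / (4 * N%:R)) ^+ n / 8.
exists (A1 / L1) => a V c ma mV V0 bad.
have N0 : 0 < N%:R :> R by rewrite ltr0n.
have L10 : 0 < L1.
  by rewrite divr_gt0// mulr_gt0// ?exprn_gt0// ?flat0_gt0// divr_gt0// mulr_gt0.
have dn0 : 0 < d ^+ n by rewrite exprn_gt0.
have IV0 : (0 <= \int[mu]_(x in cube c d) (V x)%:E)%E.
  by apply: integral_ge0 => x _; rewrite lee_fin.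
have sq_ge0 D (u : 'rV[R]_n -> R[i]) : (0 <= \int[mu]_(x in D) (sqmod (u x))%:E)%E.
  by apply: integral_ge0 => x _; rewrite lee_fin sqmod_ge0.
have E_ge0 D (u : 'rV[R]_n -> R[i]) :
    (0 <= \int[mu]_(x in D) (magnetic_energy_density a u x)%:E)%E.
  by apply: integral_ge0 => x _; rewrite lee_fin energy_density_ge0.
have le0 : (0 <= local_energy a (cube c d))%E.
  apply: le_ereal_inf_tmp => _ [u _ <-]; apply: mule_ge0; first exact: E_ge0.
  rewrite lee_fin invr_ge0 fine_ge0// /sqnorm_on.
  by apply: integral_ge0 => x _; rewrite lee_fin sqr_ge0.
have leM : (local_energy a (cube c d) < M%:E)%E.
  apply: le_lt_trans bad; rewrite leeDl// mule_ge0// lee_fin invr_ge0 ltW//.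
have IVM : (\int[mu]_(x in cube c d) (V x)%:E <= (M * d ^+ n)%:E)%E.
  have h : (((d ^+ n)^-1)%:E * \int[mu]_(x in cube c d) (V x)%:E <= M%:E)%E.
    by apply: le_trans (ltW bad); rewrite leeDr.
  by rewrite EFinM -lee_pdivrMr// muleC.
have {leM}[_ [u [su L2u [x0 Ox0 ux0]] <-]] := ereal_inf_lt leM.
rewrite /rayleigh_quotient sqnorm_onE.
have O0 : open (obox c d) := @obox_open _ _ c d.
have mO := open_measurable_rV O0.
move: su L2u Ox0; rewrite cube_interior => su [_ _ L2u] Ox0.
rewrite sqnorm_onE in L2u.
set W := (\int[mu]_(x in obox c d) (sqmod (u x))%:E)%E in L2u *.
have W0 : (0 < W)%E by exact: sqmod_integral_gt0 Ox0 ux0.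
have WE : W = (fine W)%:E by rewrite fineK// ge0_fin_numE// ltW.
have fW0 : 0 < fine W by rewrite -lte_fin -WE.
rewrite lte_pdivrMr// => hEW.
have M0 : 0 < M.
  have : (0 < M%:E * (fine W)%:E)%E by exact: le_lt_trans hEW.
  by rewrite -EFinM lte_fin pmulr_lgt0.
have ms : measurable_fun (obox c d) (fun y => sqmod (u y)).
  have [/smooth_onP sr /smooth_onP si] := su.
  rewrite (_ : (fun y => _) = fun y => repart u y ^+ 2 + impart u y ^+ 2)//.
  by apply: measurable_funD; apply: measurable_funX; apply: continuous_on_measurable => // y;
    [exact: Ck_continuous (sr 0%N)|exact: Ck_continuous (si 0%N)].
have mEu : measurable_fun (obox c d) (magnetic_energy_density a u).
  exact: measurable_energy.
have [|d' /andP[d'1 d'2] hW] := half_integral_inner_cube d0 (fun x => sqmod_ge0 (u x)) ms.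
  by rewrite W0 L2u.
have d'0 : 0 < d' by apply: lt_le_trans d'1; rewrite divr_gt0.
set l := c - const_mx (d' / 2) in hW.
have lO : cbox l d' `<=` obox c d.
  move=> x hx i; have := hx i; rewrite !mxE ltr_norml; lra.
pose s := d' / N%:R.
have s0 : 0 < s by rewrite divr_gt0.
have Ns : N%:R * s = d' by rewrite mulrC divfK// gt_eqF.
have qO : hcube l d' `<=` obox c d by move=> x /hcube_sub_box/lO.
have mq := measurable_hcube l d'.
have key : (\int[mu]_(x in hcube l (N%:R * s)) (magnetic_energy_density a u x)%:E <
   (2 * M)%:E * \int[mu]_(x in hcube l (N%:R * s)) (sqmod (u x))%:E)%E.
  rewrite Ns; apply: (@le_lt_trans _ _
      (\int[mu]_(x in obox c d) (magnetic_energy_density a u x)%:E)%E).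
    apply: ge0_subset_integral => //; first exact/measurable_EFinP.
    by move=> x _; rewrite lee_fin energy_density_ge0.
  apply: (lt_le_trans hEW); rewrite -WE (mulrC 2) EFinM -muleA.
  by rewrite lee_pmul2l//; exact: ltW.
have [|||l' [hl' hE hW0]] := subcube_pigeonhole s0 (ltn0Sn _) _ _ _ (fun x => sqmod_ge0 (u x))
  (energy_density_ge0 a u) key.
- by rewrite mulr_ge0// ltW.
- by rewrite Ns; exact: measurable_funS ms.
- by rewrite Ns; exact: measurable_funS mEu.
rewrite Ns in hl'.
have l'O : cbox l' s `<=` obox c d.
  move=> x hx; apply: lO => i; have := hx i; have [] := hl' i; lra.
have q'O : hcube l' s `<=` obox c d by move=> x /hcube_sub_box/l'O.
have mq' := measurable_hcube l' s.
have hWoo : (\int[mu]_(x in hcube l' s) (sqmod (u x))%:E < +oo)%E.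
  apply: le_lt_trans L2u; apply: ge0_subset_integral => //; first exact/measurable_EFinP.
  by move=> x _; rewrite lee_fin sqmod_ge0.
have M20 : 0 <= 2 * M by rewrite mulr_ge0// ltW.
have C0 : 0 <= C.
  by apply: mulr_ge0; [rewrite !mulr_ge0 ?exprn_ge0|rewrite addr_ge0].
have sd : s <= d / N%:R by rewrite ler_wpM2r ?invr_ge0 ?ltW.
have hs : 2 ^+ n * 2 ^+ n * 2 * s * (2 * M + n%:R) <= 1.
  have -> : 2 ^+ n * 2 ^+ n * 2 * s * (2 * M + n%:R) = s * C by rewrite /C; ring.
  apply: (le_trans (ler_wpM2r C0 sd)); rewrite mulrAC ler_pdivrMr// mul1r ltW//.
  have dC0 : 0 <= d * C by rewrite mulr_ge0// ltW.
  by have /andP[] := truncn_itv dC0.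
have T1 := truncation_test_function s0 O0 l'O su hW0 hWoo.
have T2 := truncation_energy_le s0 O0 l'O su ma hE hW0 hWoo.
have T3 := truncation_sqnorm_ge s0 O0 l'O su ma hE hW0 hWoo hs.
have T4 := sqmod_truncation_le s0 hW0 hWoo.
have T5 := truncation_mpart_eq0 a s0 O0 l'O su hW0 hWoo.
set m := (_ / s ^+ n) in T2 T3 T4.
have sn0 : 0 < s ^+ n by rewrite exprn_gt0.
have m0 : 0 < m.
  rewrite /m divr_gt0// -lte_fin fineK//.
  by rewrite ge0_fin_numE// ltW.
have qc x : ~ cube c d x -> ~ hcube l' s x.
  by apply: contra_not => /q'O hx i; exact/ltW/hx.
set phi := truncation u l' s in T1 T2 T3 T4 T5 *.
have T6 x : ~ cube c d x -> phi x = 0 by move=> /qc; exact: truncation_eq0.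
have ss1 : s <= d.
  apply: (le_trans sd); rewrite ler_pdivrMr//.
  by apply: ler_peMr; [exact: ltW|rewrite ler1n].
have ss0 : d / (2 * N%:R) <= s.
  by rewrite /s invfM mulrA; apply: ler_wpM2r => //; rewrite invr_ge0 ltW.
have snd : s ^+ n <= d ^+ n by apply: lerXn2r => //; rewrite nnegrE ltW.
have T3' : ((L1 / m)%:E <= \int[mu]_x (sqmod (phi x))%:E)%E.
  apply: le_trans T3; rewrite lee_fin /L1.
  have f1 : flat 0 (d / (8 * N%:R)) <= flat 0 (s / 4).
    apply: flat0_mono; have -> : d / (8 * N%:R) = d / (2 * N%:R) / 4 by field; rewrite gt_eqF.
    by rewrite ler_wpM2r.
  have f2 : d / (4 * N%:R) <= s / 2.
    have -> : d / (4 * N%:R) = d / (2 * N%:R) / 2 by field; rewrite gt_eqF.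
    by rewrite ler_wpM2r.
  rewrite [leRHS](_ : _ = (flat 0 (s / 4) ^+ (2 * n)) ^+ 2 * (s / 2) ^+ n / 8 / m);
    last by field; rewrite gt_eqF.
  apply: ler_wpM2r; first by rewrite invr_ge0 ltW.
  apply: ler_wpM2r => //; apply: ler_pM.
  - exact: sqr_ge0.
  - by rewrite exprn_ge0// divr_ge0 ?mulr_ge0 ?(ltW d0) ?(ltW N0).
  - by rewrite -!exprM; apply: lerXn2r => //; rewrite nnegrE flat_ge0.
  - have h1 : 0 <= d / (4 * N%:R) by rewrite divr_ge0 ?mulr_ge0 ?(ltW d0) ?(ltW N0).
    by apply: lerXn2r; rewrite ?nnegrE// divr_ge0// ltW.
exists phi; split => //.
- by move=> j x /qc; exact: T5.
- by apply: lt_le_trans T3'; rewrite lte_fin divr_gt0.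
have VI : (\int[mu]_x (V x * sqmod (phi x))%:E <= (M * d ^+ n / (4 * m))%:E)%E.
  have mcube : measurable (cube c d).
    rewrite (_ : cube c d = cbox (c - const_mx (d / 2)) d).
      rewrite -[X in measurable X]setCK; apply: measurableC; apply: open_measurable_rV.
      by apply: closed_openC; exact: cbox_closed.
    by apply/seteqP; split=> x hx i; have := hx i; rewrite !mxE ler_norml; lra.
  rewrite (@integral_supported _ _ (cube c d)); last first.
    by move=> x /T6 ->; rewrite /sqmod /= expr0n addr0 mulr0.
  have mVc : measurable_fun (cube c d) (fun x => (V x)%:E).
    by apply/measurable_EFinP; exact: measurable_funTS.
  have mphi : measurable_fun setT (fun x => sqmod (phi x)).
    have [[/smooth_onP sr /smooth_onP si] _] := T1.
    rewrite (_ : (fun y => _) = fun y => repart phi y ^+ 2 + impart phi y ^+ 2)//.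
    by apply: measurable_funD; apply: measurable_funX; apply: continuous_on_measurable;
      try exact: openT; move=> y _; [exact: (Ck_continuous (sr 0%N) I)|exact: (Ck_continuous (si 0%N) I)].
  apply: (@le_trans _ _ (\int[mu]_(x in cube c d) (((4 * m)^-1)%:E * (V x)%:E))%E).
    apply: ge0_le_integral => //.
    - by move=> x _; rewrite lee_fin mulr_ge0// sqmod_ge0.
    - by apply/measurable_EFinP/measurable_funTS; exact: measurable_funM.
    - exact: measurable_funeM.
    - by move=> x _; rewrite -EFinM lee_fin mulrC ler_wpM2r.
  have m40 : 0 <= (4 * m)^-1 by rewrite invr_ge0 mulr_ge0// ltW.
  rewrite ge0_integralZl//; last by move=> x _; rewrite lee_fin.
  by rewrite (mulrC (M * d ^+ n)) EFinM; exact: lee_wpmul2l.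
apply: (@le_trans _ _ (A1 / m)%:E).
  apply: (le_trans (leeD T2 VI)); rewrite -EFinD lee_fin /A1.
  have -> : M * d ^+ n / (4 * m) = (M * d ^+ n / 4) / m by rewrite invfM mulrA.
  rewrite -mulrDl; apply: ler_wpM2r; first by rewrite invr_ge0 (ltW m0).
  rewrite lerD2r; apply: ler_wpM2l => //.
  by rewrite addr_ge0 ?mulr_ge0 ?sqr_ge0 ?invr_ge0 ?(ltW M0).
have A10 : 0 <= A1.
  rewrite /A1 addr_ge0 ?mulr_ge0 ?addr_ge0 ?mulr_ge0 ?sqr_ge0 ?invr_ge0 ?(ltW M0) ?(ltW dn0)//.
apply: le_trans (lee_wpmul2l _ T3').
  by rewrite -EFinM lee_fin mulrA divfK ?gt_eqF.
by rewrite lee_fin divr_ge0// ltW.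
Qed.

End bad_cube.

(** * Test functions and the magnetic form *)

Section test_functions.
Local Open Scope complex_scope.
Context {R : realType} {n : nat}.
Implicit Types (u v : 'rV[R]_n -> R[i]) (f : 'rV[R]_n -> R) (r t : R).
Local Notation mu := (@lebesgue_rV R n).

Definition bbox r : set 'rV[R]_n := [set x | forall i, `|x ord0 i| <= r].

Lemma bboxE r : bbox r = cbox (const_mx (- r)) (2 * r).
Proof.
by apply/seteqP; split=> x hx i; have := hx i; rewrite /= ?mxE ler_norml; lra.
Qed.

Lemma bbox_compact r : compact (bbox r).
Proof. by rewrite bboxE; exact: cbox_compact. Qed.

Lemma measurable_bbox r : measurable (bbox r).
Proof.
rewrite -[X in measurable X]setCK; apply: measurableC; apply: open_measurable_rV.
by apply: closed_openC; rewrite bboxE; exact: cbox_closed.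
Qed.

Lemma bbox_fin r : (mu (bbox r) < +oo)%E.
Proof.
pose s := 2 * `|r| + 1; have s0 : 0 <= s by have := normr_ge0 r; rewrite /s; lra.
apply: (@le_lt_trans _ _ (mu (hcube (const_mx (- `|r|)) s))).
  apply: le_measure; rewrite ?inE; [exact: measurable_bbox|exact: measurable_hcube|].
  move=> x hx i; have := hx i; have := ler_norm r; rewrite mxE ler_norml /s; lra.
by have := lebesgue_hcube (const_mx (- `|r|) : 'rV[R]_n) s0 => ->; rewrite ltry.
Qed.

Lemma coord_le_norm (x : 'rV[R]_n) i : `|x ord0 i| <= `|x|.
Proof.
by rewrite [leRHS]/Num.norm /= mx_normrE; apply/bigmax_geP; right => /=; exists (ord0, i).
Qed.

Lemma test_re u k : test_function u -> Ck k setT (repart u).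
Proof. by move=> [[/smooth_onP + _] _]; exact. Qed.

Lemma test_im u k : test_function u -> Ck k setT (impart u).
Proof. by move=> [[_ /smooth_onP +] _]; exact. Qed.

Lemma test_support u : test_function u -> exists2 r, 0 < r &
  forall x, ~ bbox r x -> [/\ u x = 0,
    forall j, 'D_(basis_rV j) (repart u) x = 0 &
    forall j, 'D_(basis_rV j) (impart u) x = 0].
Proof.
move=> [_ cK]; set K := closure _ in cK.
have [M [_ hM]] := compact_bounded cK.
exists (`|M| + 1); first by have := normr_ge0 M; lra.
move=> x nx; have nKx : ~ K x.
  apply: contra_not nx => Kx i; apply: (le_trans (coord_le_norm x i)).
  by apply: hM => //; have := ler_norm M; lra.
have nK : \near x, u x = 0.
  have : \forall y \near x, (~` K) y.
    by apply: open_nbhs_nbhs; split => //; apply: closed_openC; exact: closed_closure.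
  by apply: filterS => y nKy; apply: contrapT => /eqP uy0; apply: nKy; exact: subset_closure.
split.
- by apply: contrapT => /eqP ux0; apply: nKx; exact: subset_closure.
- move=> j; rewrite (@near_eq_derive _ _ _ _ (fun=> 0)) ?derive_cst//.
  by apply: filterS nK => y; rewrite /repart => ->.
- move=> j; rewrite (@near_eq_derive _ _ _ _ (fun=> 0)) ?derive_cst//.
  by apply: filterS nK => y; rewrite /impart => ->.
Qed.

Lemma continuous_supported_bounded f r : (forall x, {for x, continuous f}) ->
  (forall x, ~ bbox r x -> f x = 0) -> exists C, forall x, `|f x| <= C.
Proof.
move=> cf f0.
have cc : {within bbox r, continuous f}.
  by apply: continuous_subspaceT => x; exact: cf.
have /compact_bounded[M [_ hM]] := continuous_compact cc (@bbox_compact r).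
exists (`|M| + 1) => x; have [bx|nbx] := pselect (bbox r x).
  by apply: hM; [have := ler_norm M; lra|exists x].
by rewrite f0// normr0; have := normr_ge0 M; lra.
Qed.

Lemma test_bounds u : test_function u -> exists r C, [/\ 0 < r, 0 <= C,
  forall x, ~ bbox r x -> [/\ u x = 0,
    forall j, 'D_(basis_rV j) (repart u) x = 0 &
    forall j, 'D_(basis_rV j) (impart u) x = 0],
  forall x, `|repart u x| <= C /\ `|impart u x| <= C &
  forall j x, `|'D_(basis_rV j) (repart u) x| <= C /\
              `|'D_(basis_rV j) (impart u) x| <= C].
Proof.
move=> tu; have [r r0 hr] := test_support tu.
have cD f j : (forall k, Ck k setT f) -> forall x, {for x, continuous ('D_(basis_rV j) f)}.
  by move=> Cf x; exact: (Ck_continuous (Ck_derive j (Cf 1%N)) I).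
have c0 f : (forall k, Ck k setT f) -> forall x, {for x, continuous f}.
  by move=> Cf x; exact: (Ck_continuous (Cf 0%N) I).
have [A hA] := continuous_supported_bounded (c0 _ (fun k => test_re k tu))
  (fun x nx => let: And3 h _ _ := hr x nx in congr1 (@complex.Re R) h).
have [B hB] := continuous_supported_bounded (c0 _ (fun k => test_im k tu))
  (fun x nx => let: And3 h _ _ := hr x nx in congr1 (@complex.Im R) h).
have /choice[E hE] : forall j, exists C, forall x, `|'D_(basis_rV j) (repart u) x| <= C.
  move=> j; apply: (@continuous_supported_bounded _ r).
    by apply: cD => k; exact: test_re.
  by move=> x /hr[].
have /choice[F hF] : forall j, exists C, forall x, `|'D_(basis_rV j) (impart u) x| <= C.
  move=> j; apply: (@continuous_supported_bounded _ r).
    by apply: cD => k; exact: test_im.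
  by move=> x /hr[].
have A0 : 0 <= A by exact: le_trans (normr_ge0 _) (hA 0).
have B0 : 0 <= B by exact: le_trans (normr_ge0 _) (hB 0).
have E0 j : 0 <= E j by exact: le_trans (normr_ge0 _) (hE j 0).
have F0 j : 0 <= F j by exact: le_trans (normr_ge0 _) (hF j 0).
have sE : 0 <= \sum_j E j by apply: sumr_ge0.
have sF : 0 <= \sum_j F j by apply: sumr_ge0.
have leE j : E j <= \sum_j E j by rewrite (bigD1 j)//= lerDl sumr_ge0.
have leF j : F j <= \sum_j F j by rewrite (bigD1 j)//= lerDl sumr_ge0.
exists r, (A + B + \sum_j E j + \sum_j F j); split => //; first by lra.
  by move=> x; split; [apply: (le_trans (hA x))|apply: (le_trans (hB x))]; lra.
move=> j x; have := leE j; have := leF j.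
by split; [apply: (le_trans (hE j x))|apply: (le_trans (hF j x))]; lra.
Qed.

Definition lincomb t u v : 'rV[R]_n -> R[i] := fun x => u x + t%:C * v x.

Lemma re_lincomb t u v : repart (lincomb t u v) = fun x => repart u x + t * repart v x.
Proof.
apply/funext => x; rewrite /repart /lincomb; case: (u x) => a b; case: (v x) => c d /=.
by rewrite mul0r subr0.
Qed.

Lemma im_lincomb t u v : impart (lincomb t u v) = fun x => impart u x + t * impart v x.
Proof.
apply/funext => x; rewrite /impart /lincomb; case: (u x) => a b; case: (v x) => c d /=.
by rewrite mul0r addr0.
Qed.

Lemma test_closed_of_support u r : csmooth_on setT u -> (forall x, ~ bbox r x -> u x = 0) ->
  test_function u.
Proof.
move=> su hu; split=> //.
apply: (@subclosed_compact _ _ (bbox r)); [exact: closed_closure|exact: bbox_compact|].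
have /closure_id -> : closed (bbox r) by rewrite bboxE; exact: cbox_closed.
by apply: closure_subset => x /= ux; apply: contrapT => /hu h; rewrite h eqxx in ux.
Qed.

Lemma bboxS r r' : r <= r' -> bbox r `<=` bbox r'.
Proof. by move=> rr x hx i; exact: le_trans (hx i) rr. Qed.

Lemma test_lincomb t u v : test_function u -> test_function v -> test_function (lincomb t u v).
Proof.
move=> tu tv; have [r r0 hr] := test_support tu; have [r' r'0 hr'] := test_support tv.
apply: (@test_closed_of_support _ (Num.max r r')).
  split; apply/smooth_onP => k.
    rewrite -/(repart _) re_lincomb; apply: (CkD openT); first exact: test_re.
    by apply: (CkM openT); [exact: Ck_cst|exact: test_re].
  rewrite -/(impart _) im_lincomb; apply: (CkD openT); first exact: test_im.
  by apply: (CkM openT); [exact: Ck_cst|exact: test_im].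
move=> x nx; rewrite /lincomb.
have [|-> _ _] := hr x; first by apply: contra_not nx; apply: bboxS; rewrite le_max lexx.
have [|-> _ _] := hr' x; first by apply: contra_not nx; apply: bboxS; rewrite le_max lexx orbT.
by rewrite mulr0 addr0.
Qed.

Lemma sub_lincomb u v : u \- v = lincomb (-1) u v.
Proof.
apply/funext => x; rewrite /lincomb /=; case: (u x) => a b; case: (v x) => c d.
by apply/eqP; rewrite eq_complex /= !mul0r subr0 addr0 !mulN1r !eqxx.
Qed.

Lemma test0 : test_function ((fun=> 0) : 'rV[R]_n -> R[i]).
Proof.
apply: (@test_closed_of_support _ 0) => //; split; apply/smooth_onP => k; exact: Ck_cst.
Qed.

Lemma integrable_supported f r : mu.-integrable (bbox r) (EFin \o f) ->
  (forall x, ~ bbox r x -> f x = 0) -> mu.-integrable setT (EFin \o f).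
Proof.
move=> fi f0; have mb := @measurable_bbox r.
move: fi; rewrite (integrable_mkcond _ mb); congr (mu.-integrable _ _).
apply/funext => x; rewrite patchE; case: ifPn => //=.
by rewrite notin_setE => /f0 ->.
Qed.

Lemma measurable_test u : test_function u ->
  measurable_fun setT (repart u) /\ measurable_fun setT (impart u).
Proof.
by move=> tu; split; apply: continuous_on_measurable; try exact: openT; move=> x _;
  [exact: (Ck_continuous (test_re 0%N tu) I)|exact: (Ck_continuous (test_im 0%N tu) I)].
Qed.

Lemma measurable_test_derive u j : test_function u ->
  measurable_fun setT ('D_(basis_rV j) (repart u)) /\
  measurable_fun setT ('D_(basis_rV j) (impart u)).
Proof.
by move=> tu; split; apply: continuous_on_measurable; try exact: openT; move=> x _;
  [exact: (Ck_continuous (Ck_derive j (test_re 1%N tu)) I)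
  |exact: (Ck_continuous (Ck_derive j (test_im 1%N tu)) I)].
Qed.

End test_functions.

Section form.
Local Open Scope complex_scope.
Context {R : realType} {n : nat}.
Variables (a : 'rV[R]_n -> 'rV[R]_n) (V : 'rV[R]_n -> R).
Implicit Types (u v : 'rV[R]_n -> R[i]) (t : R).
Local Notation mu := (@lebesgue_rV R n).

(** Re (z conj(w)), the inner product of the complex plane over the reals. *)
Definition cdot (z w : R[i]) : R :=
  complex.Re z * complex.Re w + complex.Im z * complex.Im w.

Definition form_density u v (x : 'rV[R]_n) : R :=
  \sum_(j < n) (mpart_re a j u x * mpart_re a j v x + mpart_im a j u x * mpart_im a j v x)
  + V x * cdot (u x) (v x).

Definition hform u v : R := \int[mu]_x form_density u v x.

Lemma Re_sum (I : Type) (s : seq I) (F : I -> R[i]) :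
  complex.Re (\sum_(i <- s) F i) = \sum_(i <- s) complex.Re (F i).
Proof. by elim: s => [|i s IH]; rewrite ?big_nil// !big_cons -IH; case: (F i); case: (\sum_(_ <- _) _). Qed.

Lemma Re_magnetic_form u v : complex.Re (magnetic_form a V u v) = hform u v.
Proof.
rewrite /magnetic_form /Cintegral /hform /=; congr Rintegral; apply/funext => x.
transitivity (complex.Re (\sum_(j < n) magnetic_partial a j u x * conjc (magnetic_partial a j v x))
   + complex.Re ((V x)%:C * u x * conjc (v x))).
  by case: (\sum_(_ < _) _) => p q; case: (_ * _ * _).
rewrite Re_sum /form_density; congr (_ + _).
  by apply: eq_bigr => j _; rewrite !magnetic_partialE /=; ring.
by rewrite /cdot; case: (u x) => p q; case: (v x) => p' q' /=; ring.
Qed.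

(** From here on the local bounds on a and V >= 0 are assumed at every point; the final proof
    changes a and V on null sets to achieve this. *)
Hypothesis ma : forall j, measurable_fun setT (fun x => a x ord0 j).
Hypothesis ba : forall r : R, exists A : R, forall j x, bbox r x -> `|a x ord0 j| <= A.
Hypothesis mV : measurable_fun setT V.
Hypothesis V0 : forall x, 0 <= V x.
Hypothesis iV : forall r : R, mu.-integrable (bbox r) (EFin \o V).

Lemma mpart_bounds u : test_function u -> exists r C, [/\ 0 < r, 0 <= C,
  forall x, ~ bbox r x -> u x = 0 /\ forall j, mpart_re a j u x = 0 /\ mpart_im a j u x = 0,
  forall x, `|repart u x| <= C /\ `|impart u x| <= C &
  forall j x, `|mpart_re a j u x| <= C /\ `|mpart_im a j u x| <= C].
Proof.
move=> /test_bounds[r [C [r0 C0 sup b0 b1]]]; have [A hA] := ba r.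
pose A' : R := `|A|; have A0 : 0 <= A' by exact: normr_ge0.
have out x : ~ bbox r x -> u x = 0 /\ forall j, mpart_re a j u x = 0 /\ mpart_im a j u x = 0.
  move=> nx; have [u0 d1 d2] := sup x nx; split => // j.
  by rewrite /mpart_re /mpart_im /repart /impart d1 d2 u0 /= !mulr0 subr0 addr0.
have AC : 0 <= A' * C by rewrite mulr_ge0.
exists r, (C + A' * C); split => //.
- by lra.
- by move=> x; have [h1 h2] := b0 x; split; lra.
- move=> j x; have [bx|nbx] := pselect (bbox r x); last first.
    by have [_ /(_ j)[-> ->]] := out x nbx; rewrite normr0; split; lra.
  have hAx : `|a x ord0 j| <= A' by apply: (le_trans (hA j x bx)); exact: ler_norm.
  have [h1 h2] := b0 x; have [h3 h4] := b1 j x.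
  split; (apply: (le_trans (ler_normD _ _)); rewrite ?normrN normrM; apply: lerD => //;
    exact: ler_pM).
Qed.

Lemma measurable_mpart u j : test_function u ->
  measurable_fun setT (mpart_re a j u) /\ measurable_fun setT (mpart_im a j u).
Proof.
move=> tu; have [m1 m2] := measurable_test tu; have [d1 d2] := measurable_test_derive j tu.
split; first by apply: measurable_funB => //; exact: measurable_funM.
by apply: measurable_funD => //; exact: measurable_funM.
Qed.

Lemma measurable_cdot u v : test_function u -> test_function v ->
  measurable_fun setT (fun x => cdot (u x) (v x)).
Proof.
move=> /measurable_test[m1 m2] /measurable_test[m3 m4].
by apply: measurable_funD; exact: measurable_funM.
Qed.

Lemma integrable_form_density u v : test_function u -> test_function v ->
  mu.-integrable setT (EFin \o form_density u v).
Proof.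
move=> tu tv; have [r [C [r0 C0 out bu bmu]]] := mpart_bounds tu.
have [r' [C' [r'0 C'0 out' bv bmv]]] := mpart_bounds tv.
have mb := @measurable_bbox R n r.
apply: (@integrable_supported _ _ _ r); last first.
  move=> x /out[u0 m0]; rewrite /form_density u0 /cdot /= !mul0r addr0 mulr0 addr0.
  by rewrite big1// => j _; have [-> ->] := m0 j; rewrite !mul0r addr0.
rewrite (_ : EFin \o form_density u v = (fun x =>
  (\sum_(j < n) (mpart_re a j u x * mpart_re a j v x + mpart_im a j u x * mpart_im a j v x))%:E
  + (V x * cdot (u x) (v x))%:E)%E); last by apply/funext => x.
have CC : 0 <= C * C' by rewrite mulr_ge0.
apply: integrableD => //.
  apply: (@bounded_integrable _ _ _ _ (\sum_(j < n) (C * C' + C * C'))) => //.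
  - exact: bbox_fin.
  - apply: measurable_funTS; apply: measurable_sum => j.
    have [m1 m2] := measurable_mpart j tu; have [m3 m4] := measurable_mpart j tv.
    by apply: measurable_funD; exact: measurable_funM.
  - move=> x _; apply: (le_trans (ler_norm_sum _ _ _)); apply: ler_sum => j _.
    have [h1 h2] := bmu j x; have [h3 h4] := bmv j x.
    by apply: (le_trans (ler_normD _ _)); rewrite !normrM; apply: lerD; exact: ler_pM.
apply: (@le_integrable _ _ _ mu _ mb _ (EFin \o (fun x => (C * C' + C * C') * V x))).
- apply/measurable_EFinP/measurable_funTS; apply: measurable_funM => //.
  exact: measurable_cdot.
- move=> x _; rewrite lee_fin !normrM (ger0_norm (V0 x)) mulrC.
  apply: ler_wpM2r => //; rewrite [leRHS]ger0_norm ?addr_ge0//.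
  have [h1 h2] := bu x; have [h3 h4] := bv x.
  by apply: (le_trans (ler_normD _ _)); rewrite !normrM; apply: lerD; exact: ler_pM.
- exact: integrableZl (iV r).
Qed.

Lemma mpart_lincomb t u v j x : test_function u -> test_function v ->
  mpart_re a j (lincomb t u v) x = mpart_re a j u x + t * mpart_re a j v x /\
  mpart_im a j (lincomb t u v) x = mpart_im a j u x + t * mpart_im a j v x.
Proof.
move=> tu tv; rewrite /mpart_re /mpart_im re_lincomb im_lincomb.
have D f g : (forall k, Ck k setT f) -> (forall k, Ck k setT g) ->
    'D_(basis_rV j) (fun x => f x + t * g x) x =
    'D_(basis_rV j) f x + t * 'D_(basis_rV j) g x.
  move=> Cf Cg; have df : derivable f x (basis_rV j) := Ck_derivable (Cf 1%N) I.
  have dg : derivable g x (basis_rV j) := Ck_derivable (Cg 1%N) I.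
  have dtg : derivable (t \*: g) x (basis_rV j) by exact: derivableZ.
  by rewrite [LHS](deriveD df dtg) [X in _ + X]deriveZ.
rewrite !D; try by move=> k; first [exact: test_re|exact: test_im].
by split; ring.
Qed.

Lemma form_density_lincomb t u v w x : test_function u -> test_function v ->
  form_density (lincomb t u v) w x = form_density u w x + t * form_density v w x.
Proof.
move=> tu tv; rewrite /form_density.
have -> : \sum_(j < n) (mpart_re a j (lincomb t u v) x * mpart_re a j w x +
    mpart_im a j (lincomb t u v) x * mpart_im a j w x) =
  \sum_(j < n) (mpart_re a j u x * mpart_re a j w x + mpart_im a j u x * mpart_im a j w x) +
  t * \sum_(j < n) (mpart_re a j v x * mpart_re a j w x + mpart_im a j v x * mpart_im a j w x).
  rewrite mulr_sumr -big_split; apply: eq_bigr => j _ /=.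
  by have [-> ->] := mpart_lincomb t j x tu tv; ring.
rewrite /cdot -/(repart (lincomb t u v) x) -/(impart (lincomb t u v) x).
by rewrite re_lincomb im_lincomb /repart /impart; ring.
Qed.

Lemma hformC u v : hform u v = hform v u.
Proof.
congr Rintegral; apply/funext => x; rewrite /form_density /cdot; congr (_ + _ * _).
  by apply: eq_bigr => j _; ring.
by ring.
Qed.

Lemma hform_lincomb t u v w : test_function u -> test_function v -> test_function w ->
  hform (lincomb t u v) w = hform u w + t * hform v w.
Proof.
move=> tu tv tw; rewrite /hform.
have iu := integrable_form_density tu tw; have iv := integrable_form_density tv tw.
rewrite -RintegralZl// -RintegralD//; last exact: integrableZl iv.
by congr Rintegral; apply/funext => x; rewrite form_density_lincomb.
Qed.

Lemma form_density_ge0 u x : 0 <= form_density u u x.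
Proof.
rewrite addr_ge0//; last by rewrite mulr_ge0// /cdot -!expr2 addr_ge0 ?sqr_ge0.
by apply: sumr_ge0 => j _; rewrite -!expr2 addr_ge0 ?sqr_ge0.
Qed.

Lemma hform_ge0 u : 0 <= hform u u.
Proof. by apply: fine_ge0; apply: integral_ge0 => x _; rewrite lee_fin form_density_ge0. Qed.

Lemma hform_cauchy_schwarz u v : test_function u -> test_function v ->
  hform u v ^+ 2 <= hform u u * hform v v.
Proof.
move=> tu tv; apply: quadratic_ge0_discriminant.
  exact: hform_ge0.
move=> t; have := hform_ge0 (lincomb t u v).
rewrite hform_lincomb//; last exact: test_lincomb.
rewrite hformC hform_lincomb// (hformC v (lincomb t u v)) hform_lincomb// (hformC v u).
by move/le_trans; apply; rewrite le_eqVlt; apply/orP; left; apply/eqP; ring.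
Qed.

End form.

(** * Closability of the form *)

Section vanishing.
Context {R : realType}.
Implicit Types (x y : nat -> \bar R).
Local Open Scope ereal_scope.

(** For the nonnegative sequences it is applied to, this is convergence to 0; infinite initial terms
    are allowed. *)
Definition vanishing x := forall e : R, (0 < e)%R -> exists N, forall k, (N <= k)%N -> x k <= e%:E.

Lemma vanishing_le x y : (forall k, x k <= y k) -> vanishing y -> vanishing x.
Proof.
move=> xy vy e /vy[N hN]; exists N => k /hN; exact: le_trans.
Qed.

Lemma vanishingD x y : vanishing x -> vanishing y -> vanishing (fun k => x k + y k).
Proof.
move=> vx vy e e0; have e2 : (0 < e / 2)%R by rewrite divr_gt0.
have [N hN] := vx _ e2; have [N' hN'] := vy _ e2.
exists (maxn N N') => k; rewrite geq_max => /andP[/hN h1 /hN' h2].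
by rewrite [e]splitr EFinD; exact: leeD.
Qed.

Lemma vanishingZ x (c : R) : (0 <= c)%R -> vanishing x -> vanishing (fun k => c%:E * x k).
Proof.
move=> c0 vx e e0; have [|N hN] := vx (e / (c + 1))%R; first by rewrite divr_gt0//; lra.
exists N => k /hN h; apply: (@le_trans _ _ (c%:E * (e / (c + 1))%:E)).
  by apply: lee_wpmul2l; rewrite ?lee_fin.
rewrite -EFinM lee_fin mulrA ler_pdivrMr; [nra|lra].
Qed.

Lemma vanishing_sum n (F : 'I_n -> nat -> \bar R) : (forall j, vanishing (F j)) ->
  vanishing (fun k => \sum_(j < n) F j k).
Proof.
elim: n F => [|n IH] F vF.
  by move=> e e0; exists 0%N => k _; rewrite big_ord0 lee_fin ltW.
apply: (@vanishing_le _ (fun k => \sum_(j < n) F (widen_ord (leqnSn n) j) k + F ord_max k)).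
  by move=> k; rewrite big_ord_recr.
by apply: vanishingD => //; exact: IH.
Qed.

Lemma cvg_vanishing x : x @ \oo --> 0 -> vanishing x.
Proof.
move=> c e e0.
have /fine_cvgP[[N' _ hN'] /cvgrPdist_lt/(_ e e0)[N _ hN]] := c.
exists (maxn N N') => m; rewrite geq_max => /andP[Nm N'm].
have := hN m Nm; rewrite sub0r normrN /= => h.
rewrite -[leLHS]fineK; last exact: hN'.
by rewrite lee_fin ltW// (le_lt_trans (ler_norm _) h).
Qed.

End vanishing.

Section closability.
Local Open Scope complex_scope.
Context {R : realType} {n : nat}.
Variables (a : 'rV[R]_n -> 'rV[R]_n) (V : 'rV[R]_n -> R).
Implicit Types (u v : 'rV[R]_n -> R[i]) (t r : R) (f : 'rV[R]_n -> R).
Local Notation mu := (@lebesgue_rV R n).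
Hypothesis ma : forall j, measurable_fun setT (fun x => a x ord0 j).
Hypothesis ba : forall r : R, exists A : R, forall j x, bbox r x -> `|a x ord0 j| <= A.
Hypothesis mV : measurable_fun setT V.
Hypothesis V0 : forall x, 0 <= V x.
Hypothesis iV : forall r : R, mu.-integrable (bbox r) (EFin \o V).

Let L1 r f := (\int[mu]_(x in bbox r) `|f x|%:E)%E.

Let mb r : measurable (bbox r : set 'rV[R]_n) := @measurable_bbox R n r.

(** Integrates the pointwise inequality |f| <= e + g / e, which plays the part of Cauchy-Schwarz on
    a box without square roots of integrals. *)
Lemma L1_le_sqr r f g (e : R) : 0 < e -> measurable_fun setT f -> measurable_fun setT g ->
  (forall x, f x ^+ 2 <= g x) ->
  (L1 r f <= e%:E * mu (bbox r) + e^-1%:E * \int[mu]_x (g x)%:E)%E.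
Proof.
move=> e0 mf mg fg; have g0 x : 0 <= g x by exact: le_trans (sqr_ge0 _) (fg x).
have ei0 : 0 <= e^-1 by rewrite invr_ge0 ltW.
have mge : measurable_fun (bbox r) (fun x => (g x)%:E).
  by apply/measurable_EFinP; exact: measurable_funTS.
have ge0 x : bbox r x -> (0 <= (g x)%:E)%E by rewrite lee_fin.
have gz0 x : bbox r x -> (0 <= e^-1%:E * (g x)%:E)%E by move=> ?; rewrite mule_ge0// lee_fin.
have ce0 (x : 'rV[R]_n) : bbox r x -> (0 <= e%:E)%E by rewrite lee_fin ltW.
apply: (@le_trans _ _ (\int[mu]_(x in bbox r) (e%:E + e^-1%:E * (g x)%:E))%E).
  apply: ge0_le_integral => //.
  - by apply/measurable_EFinP/measurable_funTS; exact: measurableT_comp.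
  - by apply: emeasurable_funD => //; exact: measurable_funeM.
  move=> x _; rewrite -EFinM -EFinD lee_fin.
  have h : `|f x| ^+ 2 <= g x by rewrite real_normK ?num_real.
  have h2 : e * (e + e^-1 * g x - `|f x|) = e ^+ 2 + g x - e * `|f x|.
    by field; rewrite gt_eqF.
  rewrite -subr_ge0 -(pmulr_rge0 _ e0) h2.
  by have := sqr_ge0 (e - `|f x|); have := normr_ge0 (f x); rewrite !expr2 in h *; nra.
rewrite (ge0_integralD mu (mb r) ce0 _ gz0 (measurable_funeM _ mge))//.
apply: leeD; first by rewrite integral_cst.
rewrite (ge0_integralZl mu (mb r) mge ge0)//; apply: lee_wpmul2l; first by rewrite lee_fin.
apply: ge0_subset_integral => //; first exact/measurable_EFinP.
by move=> x _; rewrite lee_fin.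
Qed.

Lemma L1_small r (e : R) : 0 < e -> exists2 d : R, 0 < d & forall f g,
  measurable_fun setT f -> measurable_fun setT g -> (forall x, f x ^+ 2 <= g x) ->
  (\int[mu]_x (g x)%:E <= d%:E)%E -> (L1 r f <= e%:E)%E.
Proof.
move=> e0.
have mB : mu (bbox r) = (fine (mu (bbox r)))%:E by rewrite fineK// ge0_fin_numE// bbox_fin.
set b := fine _ in mB; have b0 : 0 <= b by exact: fine_ge0.
pose d := e / (2 * (b + 1)); have d0 : 0 < d by rewrite divr_gt0// mulr_gt0//; lra.
exists (d * (e / 2)); first by rewrite mulr_gt0// divr_gt0.
move=> f g mf mg fg h; apply: (le_trans (L1_le_sqr r d0 mf mg fg)).
rewrite [e in leRHS]splitr EFinD; apply: leeD.
  rewrite mB -EFinM lee_fin /d mulrAC ler_pdivrMr ?mulr_gt0//; last by lra.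
  by have := ltW e0; nra.
apply: (@le_trans _ _ (d^-1%:E * (d * (e / 2))%:E)%E).
  by apply: lee_wpmul2l => //; rewrite lee_fin invr_ge0; exact: ltW.
by rewrite -EFinM lee_fin mulKf// gt_eqF.
Qed.

Lemma vanishing_L1 r (f g : nat -> 'rV[R]_n -> R) :
  (forall k, measurable_fun setT (f k)) -> (forall k, measurable_fun setT (g k)) ->
  (forall k x, f k x ^+ 2 <= g k x) ->
  vanishing (fun k => \int[mu]_x (g k x)%:E)%E -> vanishing (fun k => L1 r (f k)).
Proof.
move=> mf mg fg vg e e0; have [d d0 hd] := L1_small r e0.
by have [N hN] := vg d d0; exists N => k /hN; exact: hd.
Qed.

Lemma L1_triangle r f (g h : 'rV[R]_n -> R) : measurable_fun setT f -> measurable_fun setT g ->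
  measurable_fun setT h -> (forall x, bbox r x -> `|f x| <= `|g x| + `|h x|) ->
  (L1 r f <= L1 r g + L1 r h)%E.
Proof.
move=> mf mg mh fgh.
have mn (k : 'rV[R]_n -> R) : measurable_fun setT k -> measurable_fun (bbox r) (fun x => `|k x|%:E).
  by move=> mk; apply/measurable_EFinP/measurable_funTS; exact: measurableT_comp.
rewrite -ge0_integralD//; [|exact: mn|exact: mn].
apply: ge0_le_integral => //.
- exact: mn.
- by apply: emeasurable_funD; exact: mn.
Qed.

Lemma L1_scale r f (g : 'rV[R]_n -> R) (C : R) : 0 <= C -> measurable_fun setT f -> measurable_fun setT g ->
  (forall x, bbox r x -> `|f x| <= C * `|g x|) -> (L1 r f <= C%:E * L1 r g)%E.
Proof.
move=> C0 mf mg fg.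
have mn (k : 'rV[R]_n -> R) : measurable_fun setT k -> measurable_fun (bbox r) (fun x => `|k x|%:E).
  by move=> mk; apply/measurable_EFinP/measurable_funTS; exact: measurableT_comp.
rewrite -ge0_integralZl//; last exact: mn.
apply: ge0_le_integral => //.
- exact: mn.
- by apply: measurable_funeM; exact: mn.
Qed.

Lemma L1_subset r r' f : r <= r' -> measurable_fun setT f -> (L1 r f <= L1 r' f)%E.
Proof.
move=> rr mf; apply: ge0_subset_integral => //; last exact: bboxS.
by apply/measurable_EFinP/measurable_funTS; exact: measurableT_comp.
Qed.

Lemma L1_le_cst r f (C : R) : measurable_fun setT f -> (forall x, `|f x| <= C) ->
  (L1 r f <= C%:E * mu (bbox r))%E.
Proof.
move=> mf fC; rewrite -integral_cst//; apply: ge0_le_integral => //.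
  by apply/measurable_EFinP/measurable_funTS; exact: measurableT_comp.
by move=> x _; rewrite lee_fin.
Qed.

(* f_k -> 0 in L^1 and D_j f_k Cauchy in L^1: the difference quotients of f_k
   vanish in the limit, and they approximate D_j f_k uniformly in k. *)
Lemma derivative_vanishing (f : nat -> 'rV[R]_n -> R) (j : 'I_n) :
  (forall k p, Ck p setT (f k)) ->
  (forall k, exists r, forall x, ~ bbox r x -> f k x = 0) ->
  (forall r, vanishing (fun k => L1 r (f k))) ->
  (forall r (e : R), 0 < e -> exists N, forall k l, (N <= k)%N -> (N <= l)%N ->
    (L1 r (fun x => 'D_(basis_rV j) (f k) x - 'D_(basis_rV j) (f l) x)%R <= e%:E)%E) ->
  forall r, vanishing (fun k => L1 r ('D_(basis_rV j) (f k))).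
Proof.
move=> Cf sf vf cf r e e0.
pose D k := 'D_(basis_rV j) (f k).
have mf k : measurable_fun setT (f k).
  by apply: continuous_on_measurable => [|x _]; [exact: openT|exact: (Ck_continuous (Cf k 0%N) I)].
have mD k : measurable_fun setT (D k).
  apply: continuous_on_measurable => [|x _]; first exact: openT.
  exact: (Ck_continuous (Ck_derive j (Cf k 1%N)) I).
have mshift (g : 'rV[R]_n -> R) (t : R) : measurable_fun setT g ->
    measurable_fun setT (fun x : 'rV[R]_n => g (x + t *: basis_rV j)).
  by move=> mg; apply: (measurableT_comp mg); exact: measurable_shift_rV.
have e4 : 0 < e / 4 by rewrite divr_gt0.
(* [N] is fixed from here on. A bound on the second derivative of this single f_N controls the error
   of its difference quotient; the other f_k are compared with f_N. *)
have [N hN] := cf (r + 1) (e / 4) e4.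
have [C hC] : exists C, forall x, `|'D_(basis_rV j) (D N) x| <= C.
  have [r' hr'] := sf N; apply: (@continuous_supported_bounded _ _ _ r').
    by move=> x; exact: (Ck_continuous (Ck_derive j (Ck_derive j (Cf N 2%N))) I).
  have oB : open (~` (bbox r' : set 'rV[R]_n)).
    by apply: closed_openC; rewrite bboxE; exact: cbox_closed.
  have D0 x : ~ bbox r' x -> D N x = 0.
    move=> nx; rewrite /D (@near_eq_derive _ _ _ _ (fun=> 0)) ?derive_cst//.
    have : \forall y \near x, (~` bbox r') y by exact: open_nbhs_nbhs.
    by apply: filterS => y /hr'.
  move=> x nx; rewrite (@near_eq_derive _ _ _ _ (fun=> 0)) ?derive_cst//.
  have : \forall y \near x, (~` bbox r') y by exact: open_nbhs_nbhs.
  by apply: filterS => y /D0.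
have C0 : 0 <= C by exact: le_trans (normr_ge0 _) (hC 0).
have mB : mu (bbox r) = (fine (mu (bbox r)))%:E by rewrite fineK// ge0_fin_numE// bbox_fin.
set b := fine _ in mB; have b0 : 0 <= b by exact: fine_ge0.
(* The step of the difference quotient, chosen after [N] and before [N']: t <= 1 keeps shifted
   points in [bbox (r + 1)], and the other bound makes the Taylor error of f_N at most t e / 4. *)
pose t := Num.min 1 (e / (4 * (C * b + 1))).
have Cb0 : 0 <= C * b by rewrite mulr_ge0.
have t0 : 0 < t by rewrite lt_min ltr01 divr_gt0// mulr_gt0//; lra.
have t1 : t <= 1 by rewrite ge_min lexx.
have tC : C * t * b <= e / 4.
  have : t <= e / (4 * (C * b + 1)) by rewrite ge_min lexx orbT.
  rewrite ler_pdivlMr ?mulr_gt0//; [nra|lra].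
have [N' hN'] := vf (r + 1) (t * (e / 8)) (mulr_gt0 t0 (divr_gt0 e0 (ltr0Sn R 7))).
exists (maxn N N') => k; rewrite geq_max => /andP[Nk N'k].
pose S (g : 'rV[R]_n -> R) (x : 'rV[R]_n) : R := g (x + t *: basis_rV j) - g x.
pose dd (x : 'rV[R]_n) := f k x - f N x.
have mS (g : 'rV[R]_n -> R) : measurable_fun setT g -> measurable_fun setT (S g).
  by move=> mg; apply: measurable_funB => //; exact: mshift.
have Cdd p : Ck p setT dd.
  apply: (Ck_ext openT _ (CkD openT (Cf k p) (CkM openT (Ck_cst p setT (-1)) (Cf N p)))).
  by move=> x _; rewrite mulN1r.
have mdd : measurable_fun setT dd by exact: measurable_funB.
have Ddd x : 'D_(basis_rV j) dd x = D k x - D N x.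
  have dk : derivable (f k) x (basis_rV j) := Ck_derivable (Cf k 1%N) I.
  have dN : derivable (f N) x (basis_rV j) := Ck_derivable (Cf N 1%N) I.
  exact: (deriveB dk dN).
have shift_in x s : bbox r x -> 0 <= s <= t -> bbox (r + 1) (x + s *: basis_rV j).
  move=> bx /andP[s0 st] i; rewrite !mxE; apply: (le_trans (ler_normD _ _)).
  apply: lerD; first exact: bx.
  by case: (_ && _); rewrite ?mulr1 ?mulr0 ?normr0// ger0_norm// (le_trans st).
have incr (g : 'rV[R]_n -> R) : (forall p, Ck p setT g) -> (L1 r (S g) <= t%:E * L1 (r + 1) ('D_(basis_rV j) g))%E.
  move=> Cg; have := @integral_increment_le R n g 0 (basis_rV j) (bbox r) (bbox (r + 1))
    setT 0 t (ltW t0) openT (mb r) (mb (r + 1)) (@subsetT _ _) _ _ _.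
  rewrite subr0 /L1 /S; under eq_integral do rewrite scale0r !addr0.
  apply.
  - by move=> x _; exact: (Ck_continuous (Cg 0%N) I).
  - move=> x _; split; first exact: (Ck_derivable (Cg 1%N) I).
    exact: (Ck_continuous (Ck_derive j (Cg 1%N)) I).
  - by move=> x s bx st; rewrite addr0; exact: shift_in.
have taylor x : `|t * D N x - S (f N) x| <= t * (C * t).
  have dl (g : 'rV[R]_n -> R) (s : R) : (forall p, Ck p setT g) ->
      is_derive s 1 (fun s => g (x + s *: basis_rV j)) ('D_(basis_rV j) g (x + s *: basis_rV j)).
    move=> Cg; have dg : derivable g (x + s *: basis_rV j) (basis_rV j) := Ck_derivable (Cg 1%N) I.
    by apply: DeriveDef; [exact: derivable_line|exact: derive_line].
  have cl (g : 'rV[R]_n -> R) : (forall p, Ck p setT g) -> forall s, {within `[0, s], continuous (fun s => g (x + s *: basis_rV j))}.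
    move=> Cg s; apply: continuous_subspaceT => y; apply: continuous_line.
    exact: (Ck_derivable (Cg 1%N) I).
  have [s1 s1t E1] := MVT t0 (fun s _ => dl (f N) s (Cf N)) (cl (f N) (Cf N) t).
  move: s1t; rewrite in_itv/= => /andP[s10 s1t].
  have CD p : Ck p setT (D N) by exact: (Ck_derive j (Cf N p.+1)).
  have [s2 _ E2] := MVT s10 (fun s _ => dl (D N) s CD) (cl (D N) CD s1).
  rewrite scale0r addr0 subr0 in E1; rewrite scale0r addr0 subr0 in E2.
  rewrite /S E1 (mulrC _ t) -mulrBr normrM (gtr0_norm t0) ler_pM2l// distrC E2 normrM.
  by apply: ler_pM => //; rewrite gtr0_norm// ltW.
have m1 : measurable_fun setT (fun x => t * 'D_(basis_rV j) dd x).
  by apply: measurable_funM => //; rewrite (_ : 'D_ _ dd = fun x => D k x - D N x);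
    [exact: measurable_funB|exact/funext].
have m2 : measurable_fun setT (fun x => t * D N x - S (f N) x).
  by apply: measurable_funB; [exact: measurable_funM|exact: mS].
(* t D f_k = t D (f_k - f_N) + (t D f_N - S f_N) - S (f_k - f_N) + S f_k. The first and third terms
   are small by the Cauchy property, the second by Taylor, the fourth because f_k tends to 0; each
   costs at most t e / 4. *)
have key : (t%:E * L1 r (D k) <= t%:E * (e / 4)%:E + (t * (C * t))%:E * mu (bbox r)
    + t%:E * (e / 4)%:E + ((t * (e / 8))%:E + (t * (e / 8))%:E))%E.
  apply: (@le_trans _ _ (L1 r (fun x => t * D k x)%R)).
    have mDk : measurable_fun (bbox r) (fun x => `|D k x|%:E).
      by apply/measurable_EFinP/measurable_funTS; exact: measurableT_comp.
    have t0' : (0 <= t%:E)%E by rewrite lee_fin ltW.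
    rewrite -(ge0_integralZl mu (mb r) mDk _ t0')//.
    apply: ge0_le_integral => //.
    - by move=> x _; rewrite mule_ge0.
    - exact: measurable_funeM mDk.
    - by apply/measurable_EFinP/measurable_funTS/measurableT_comp => //; exact: measurable_funM.
    - by move=> x _; rewrite -EFinM lee_fin normrM (gtr0_norm t0).
  apply: (@le_trans _ _ (L1 r (fun x => t * 'D_(basis_rV j) dd x)%R +
      L1 r (fun x => t * D N x - S (f N) x)%R + L1 r (S dd) +
      (L1 r (fun x => f k (x + t *: basis_rV j))%R + L1 r (f k)))%E).
    have m3 : measurable_fun setT (S dd) by exact: mS.
    have m4 : measurable_fun setT (S (f k)) by exact: mS.
    have mk : measurable_fun setT (fun x => t * D k x) by exact: measurable_funM.
    pose p (x : 'rV[R]_n) := t * 'D_(basis_rV j) dd x + (t * D N x - S (f N) x).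
    have mp : measurable_fun setT p by exact: measurable_funD.
    pose p' (x : 'rV[R]_n) := p x - S dd x.
    have mp' : measurable_fun setT p' by exact: measurable_funB.
    apply: (le_trans (L1_triangle mk mp' m4 _)).
      move=> x _; rewrite (_ : t * D k x = p' x + S (f k) x); first exact: ler_normD.
      by rewrite /p' /p Ddd /S /dd; ring.
    apply: leeD; last by apply: L1_triangle => // [|x _]; [exact: mshift|exact: ler_normB].
    apply: (le_trans (L1_triangle mp' mp m3 _)); first by move=> x _; exact: ler_normB.
    by apply: leeD => //; apply: L1_triangle => // x _; exact: ler_normD.
  have cN r' : r' <= r + 1 -> (L1 r' ('D_(basis_rV j) dd) <= (e / 4)%:E)%E.
    move=> rr; have E : 'D_(basis_rV j) dd = fun x => D k x - D N x by exact/funext.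
    rewrite E; apply: le_trans (hN k N Nk (leqnn _)).
    by apply: L1_subset => //; exact: measurable_funB.
  have t0' : (0 <= t%:E)%E by rewrite lee_fin ltW.
  apply: leeD; [apply: leeD; [apply: leeD|]|apply: leeD].
  - apply: (@le_trans _ _ (t%:E * L1 r ('D_(basis_rV j) dd))%E).
      apply: L1_scale => //.
        by rewrite (_ : 'D_ _ dd = fun x => D k x - D N x); [exact: measurable_funB|exact/funext].
      by move=> x _; rewrite normrM (gtr0_norm t0).
    by apply: lee_wpmul2l => //; apply: cN; lra.
  - exact: L1_le_cst.
  - by apply: (le_trans (incr _ Cdd)); apply: lee_wpmul2l => //; exact: cN.
  - apply: le_trans (hN' k N'k); rewrite /L1.
    have msf : measurable_fun setT (fun x => `|f k x|%:E).
      by apply/measurable_EFinP; exact: measurableT_comp.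
    rewrite integral_mkcond [leRHS]integral_mkcond -[leRHS](ge0_integral_shift (t *: basis_rV j)).
    + apply: ge0_le_integral => //.
      * by move=> x _; rewrite patchE; case: ifPn.
      * apply/(measurable_restrictT _ (mb r)); apply: measurable_funTS.
        by apply: (measurableT_comp msf); exact: measurable_shift_rV.
      * apply: (@measurableT_comp _ _ _ _ _ _ ((fun x => `|f k x|%:E) \_ (bbox (r + 1)))).
          by apply/(measurable_restrictT _ (mb (r + 1))); exact: measurable_funTS.
        exact: measurable_shift_rV.
      * move=> x _; rewrite patchE; case: ifPn => [bx|_]; rewrite patchE; last first.
          by case: ifPn => _; rewrite ?lee_fin.
        rewrite ifT//; rewrite inE; apply: shift_in; first by rewrite inE in bx.
        by rewrite lexx ltW.
    + by apply/(measurable_restrictT _ (mb (r + 1))); exact: measurable_funTS.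
    + by move=> x; rewrite patchE; case: ifPn.
  - by apply: le_trans (hN' k N'k); apply: L1_subset => //; lra.
rewrite -(@lee_pmul2l _ t%:E)//; apply: (le_trans key).
rewrite mB -!EFinM -!EFinD lee_fin.
have := mulr_ge0 (ltW t0) (ltW e0); have := ler_wpM2l (ltW t0) tC; lra.
Qed.

Local Notation form_density := (form_density a V).
Local Notation hform := (hform a V).

Lemma measurable_form_density u : test_function u -> measurable_fun setT (form_density u u).
Proof.
by move=> tu; apply/measurable_EFinP; exact: measurable_int (integrable_form_density ma ba mV V0 iV tu tu).
Qed.

Lemma integral_form_density u : test_function u ->
  (\int[mu]_x (form_density u u x)%:E = (hform u u)%:E)%E.
Proof.
move=> tu; rewrite /hform /Rintegral fineK//.
exact: integrable_fin_num (integrable_form_density ma ba mV V0 iV tu tu).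
Qed.

Lemma mpart_sqr_le_density u j x : mpart_re a j u x ^+ 2 <= form_density u u x /\
  mpart_im a j u x ^+ 2 <= form_density u u x.
Proof.
have s0 (k : 'I_n) : 0 <= mpart_re a k u x * mpart_re a k u x + mpart_im a k u x * mpart_im a k u x.
  by rewrite -!expr2 addr_ge0 ?sqr_ge0.
have V0' : 0 <= V x * cdot (u x) (u x) by rewrite mulr_ge0// /cdot -!expr2 addr_ge0 ?sqr_ge0.
have T0 : 0 <= \sum_(k < n | k != j) (mpart_re a k u x * mpart_re a k u x + mpart_im a k u x * mpart_im a k u x).
  by apply: sumr_ge0 => k _.
rewrite /form_density (bigD1 j)//=.
have := sqr_ge0 (mpart_re a j u x); have := sqr_ge0 (mpart_im a j u x).
by rewrite !expr2 => ? ?; split; lra.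
Qed.

Lemma potential_le_density u x : V x * sqmod (u x) <= form_density u u x.
Proof.
rewrite /form_density /cdot /sqmod !expr2 lerDr.
by apply: sumr_ge0 => k _; rewrite -!expr2 addr_ge0 ?sqr_ge0.
Qed.

Lemma hform_sqr_lincomb t u v : test_function u -> test_function v ->
  hform (lincomb t u v) (lincomb t u v) = hform u u + 2 * t * hform u v + t ^+ 2 * hform v v.
Proof.
move=> tu tv; have tl := test_lincomb t tu tv.
rewrite (hform_lincomb ma ba mV V0 iV)// hformC (hform_lincomb ma ba mV V0 iV)//.
rewrite (hformC _ _ v (lincomb t u v)) (hform_lincomb ma ba mV V0 iV)// (hformC _ _ v u).
by ring.
Qed.

Lemma hform_sub_le u v : test_function u -> test_function v ->
  hform (u \- v) (u \- v) <= 2 * hform u u + 2 * hform v v.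
Proof.
move=> tu tv; rewrite sub_lincomb hform_sqr_lincomb//.
by have := hform_ge0 a V0 (lincomb 1 u v); rewrite hform_sqr_lincomb//; lra.
Qed.

Lemma hform_le_sub u v : test_function u -> test_function v ->
  hform u u <= 2 * hform (u \- v) (u \- v) + 2 * hform v v.
Proof.
move=> tu tv; rewrite sub_lincomb hform_sqr_lincomb//.
by have := hform_ge0 a V0 (lincomb (-2) u v); rewrite hform_sqr_lincomb//; lra.
Qed.

Definition form_cauchy (w : nat -> 'rV[R]_n -> R[i]) := forall e : R, 0 < e ->
  exists N, forall k l, (N <= k)%N -> (N <= l)%N -> hform (w k \- w l) (w k \- w l) < e.

Lemma form_cauchy_bounded w : (forall k, test_function (w k)) -> form_cauchy w ->
  exists2 H : R, 0 < H & exists N, forall k, (N <= k)%N -> hform (w k) (w k) <= H.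
Proof.
move=> tw /(_ 1 ltr01)[N hN]; have h0 := hform_ge0 a V0 (w N).
exists (2 + 2 * hform (w N) (w N)); first by lra.
exists N => k Nk; apply: (le_trans (hform_le_sub (tw k) (tw N))).
by have := hN k N Nk (leqnn _); lra.
Qed.

Lemma test_sub u v : test_function u -> test_function v -> test_function (u \- v).
Proof. by move=> tu tv; rewrite sub_lincomb; exact: test_lincomb. Qed.

Lemma re_sub u v : repart (u \- v) = repart u \- repart v.
Proof. by rewrite sub_lincomb re_lincomb; apply/funext => x /=; rewrite mulN1r. Qed.

Lemma im_sub u v : impart (u \- v) = impart u \- impart v.
Proof. by rewrite sub_lincomb im_lincomb; apply/funext => x /=; rewrite mulN1r. Qed.

Section vanishing_sequence.
Variable w : nat -> 'rV[R]_n -> R[i].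
Hypothesis tw : forall k, test_function (w k).
Hypothesis cw : form_cauchy w.
Hypothesis w0 : vanishing (fun k => \int[mu]_x (sqmod (w k x))%:E)%E.

Lemma measurable_sqmod_test u : test_function u -> measurable_fun setT (fun x => sqmod (u x)).
Proof.
by move=> /measurable_test[m1 m2]; apply: measurable_funD; exact: measurable_funX.
Qed.

Lemma part_vanishing r : vanishing (fun k => L1 r (repart (w k))) /\
  vanishing (fun k => L1 r (impart (w k))).
Proof.
split; apply: (@vanishing_L1 _ _ (fun k x => sqmod (w k x))) => //; try by move=> k;
  first [exact: (measurable_test (tw k)).1|exact: (measurable_test (tw k)).2|exact: measurable_sqmod_test].
- by move=> k x; rewrite /sqmod lerDl sqr_ge0.
- by move=> k x; rewrite /sqmod lerDr sqr_ge0.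
Qed.

(** On a box, where a is bounded, D_j w differs from (grad_a w)_j by a multiple of a_j w. The former
    is L^1-Cauchy since w is h-Cauchy, the latter vanishes with w, so [derivative_vanishing] applies
    to both parts. *)
Lemma derivative_part_vanishing r j : vanishing (fun k => L1 r ('D_(basis_rV j) (repart (w k)))) /\
  vanishing (fun k => L1 r ('D_(basis_rV j) (impart (w k)))).
Proof.
have key (r' e : R) : 0 < e -> exists N, forall k l, (N <= k)%N -> (N <= l)%N ->
    (L1 r' ('D_(basis_rV j) (repart (w k \- w l)%R)) <= e%:E)%E /\
    (L1 r' ('D_(basis_rV j) (impart (w k \- w l)%R)) <= e%:E)%E.
  move=> e0; have [A hA] := ba r'; pose A' : R := `|A|.
  have A0 : 0 <= A' by exact: normr_ge0.
  have e2 : 0 < e / 2 by rewrite divr_gt0.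
  have [d d0 hd] := L1_small r' e2; have [N hN] := cw d0.
  have e4 : 0 < e / (4 * (A' + 1)) by rewrite divr_gt0// mulr_gt0//; lra.
  have [[N1 h1] [N2 h2]] := ((part_vanishing r').1 _ e4, (part_vanishing r').2 _ e4).
  exists (maxn N (maxn N1 N2)) => k l; rewrite !geq_max => /and3P[k0 k1 k2] /and3P[l0 l1 l2].
  have tu := test_sub (tw k) (tw l); set u := w k \- w l in tu *.
  have [mr mi] := measurable_test tu; have [mdr mdi] := measurable_test_derive j tu.
  have [mpr mpi] := measurable_mpart ma j tu.
  have mden := measurable_form_density tu.
  have hu : (\int[mu]_x (form_density u u x)%:E <= d%:E)%E.
    by rewrite integral_form_density// lee_fin ltW// hN.
  have Lr : (L1 r' (repart u) <= (e / (2 * (A' + 1)))%:E)%E.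
    have -> : e / (2 * (A' + 1)) = e / (4 * (A' + 1)) + e / (4 * (A' + 1)).
      by field; apply/eqP; lra.
    rewrite EFinD; apply: le_trans (leeD (h1 k k1) (h1 l l1)).
    apply: L1_triangle => //; try exact: (measurable_test (tw _)).1.
    by move=> x _; rewrite /u re_sub; exact: ler_normB.
  have Li : (L1 r' (impart u) <= (e / (2 * (A' + 1)))%:E)%E.
    have -> : e / (2 * (A' + 1)) = e / (4 * (A' + 1)) + e / (4 * (A' + 1)).
      by field; apply/eqP; lra.
    rewrite EFinD; apply: le_trans (leeD (h2 k k2) (h2 l l2)).
    apply: L1_triangle => //; try exact: (measurable_test (tw _)).2.
    by move=> x _; rewrite /u im_sub; exact: ler_normB.
  have fin (f g h : 'rV[R]_n -> R) : measurable_fun setT f -> measurable_fun setT g ->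
      measurable_fun setT h -> (forall x, bbox r' x -> `|f x| <= `|g x| + A' * `|h x|) ->
      (L1 r' g <= (e / 2)%:E)%E -> (L1 r' h <= (e / (2 * (A' + 1)))%:E)%E -> (L1 r' f <= e%:E)%E.
    move=> mf mg mh fgh hg hh; have mAh : measurable_fun setT (fun x => A' * h x) by exact: measurable_funM.
    apply: (le_trans (L1_triangle mf mg mAh _)).
      by move=> x /fgh; rewrite normrM (ger0_norm A0).
    rewrite [e in leRHS]splitr EFinD; apply: leeD => //.
    apply: (@le_trans _ _ (A'%:E * L1 r' h)%E).
      by apply: L1_scale => // x _; rewrite normrM (ger0_norm A0).
    apply: (@le_trans _ _ (A'%:E * (e / (2 * (A' + 1)))%:E)%E); first exact: lee_wpmul2l.
    rewrite -EFinM lee_fin mulrA ler_pdivrMr ?mulr_gt0//; [nra|lra].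
  split.
  - apply: (fin _ (mpart_re a j u) (impart u)) => //.
      move=> x bx; rewrite -{1}(subrK (a x ord0 j * impart u x) ('D_(basis_rV j) (repart u) x)).
      apply: (le_trans (ler_normD _ _)); apply: lerD => //; rewrite normrM; apply: ler_wpM2r => //.
      by apply: (le_trans (hA j x bx)); exact: ler_norm.
    by apply: (hd _ (form_density u u)) => // x; exact: (mpart_sqr_le_density u j x).1.
  - apply: (fin _ (mpart_im a j u) (repart u)) => //.
      move=> x bx; rewrite -{1}(addrK (a x ord0 j * repart u x) ('D_(basis_rV j) (impart u) x)).
      apply: (le_trans (ler_normB _ _)); apply: lerD => //; rewrite normrM; apply: ler_wpM2r => //.
      by apply: (le_trans (hA j x bx)); exact: ler_norm.
    by apply: (hd _ (form_density u u)) => // x; exact: (mpart_sqr_le_density u j x).2.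
have D (f g : 'rV[R]_n -> R) : (forall p, Ck p setT f) -> (forall p, Ck p setT g) ->
    'D_(basis_rV j) (f \- g) = (fun x => 'D_(basis_rV j) f x - 'D_(basis_rV j) g x).
  move=> Cf Cg; apply/funext => x.
  have df : derivable f x (basis_rV j) := Ck_derivable (Cf 1%N) I.
  have dg : derivable g x (basis_rV j) := Ck_derivable (Cg 1%N) I.
  exact: (deriveB df dg).
split; apply: derivative_vanishing.
- by move=> k p; exact: test_re.
- by move=> k; have [r' _ h] := test_support (tw k); exists r' => x /h[hx _ _]; rewrite /repart hx.
- by move=> r'; exact: (part_vanishing r').1.
- move=> r' e e0; have [N hN] := key r' e e0; exists N => k l Nk Nl.
  have := (hN k l Nk Nl).1; rewrite re_sub D// => p; exact: test_re.
- by move=> k p; exact: test_im.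
- by move=> k; have [r' _ h] := test_support (tw k); exists r' => x /h[hx _ _]; rewrite /impart hx.
- by move=> r'; exact: (part_vanishing r').2.
- move=> r' e e0; have [N hN] := key r' e e0; exists N => k l Nk Nl.
  have := (hN k l Nk Nl).2; rewrite im_sub D// => p; exact: test_im.
Qed.

Lemma mpart_vanishing r j : vanishing (fun k => L1 r (mpart_re a j (w k))) /\
  vanishing (fun k => L1 r (mpart_im a j (w k))).
Proof.
have [A hA] := ba r; pose A' : R := `|A|.
have A0 : 0 <= A' by exact: normr_ge0.
have [vr vi] := part_vanishing r; have [dr di] := derivative_part_vanishing r j.
split; [apply: (vanishing_le _ (vanishingD dr (vanishingZ A0 vi)))
  |apply: (vanishing_le _ (vanishingD di (vanishingZ A0 vr)))] => k;
have [mr mi] := measurable_test (tw k); have [mdr mdi] := measurable_test_derive j (tw k);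
have [mpr mpi] := measurable_mpart ma j (tw k).
- have mA : measurable_fun setT (fun x => A' * impart (w k) x) by exact: measurable_funM.
  apply: (@le_trans _ _ (L1 r ('D_(basis_rV j) (repart (w k))) + L1 r (fun x => A' * impart (w k) x)%R)%E).
    apply: L1_triangle => // x bx; apply: (le_trans (ler_normB _ _)); apply: lerD => //.
    rewrite !normrM; apply: ler_wpM2r => //; rewrite normr_id.
    by apply: (le_trans (hA j x bx)); exact: ler_norm.
  by apply: leeD => //; apply: L1_scale => // x _; rewrite normrM (ger0_norm A0).
- have mA : measurable_fun setT (fun x => A' * repart (w k) x) by exact: measurable_funM.
  apply: (@le_trans _ _ (L1 r ('D_(basis_rV j) (impart (w k))) + L1 r (fun x => A' * repart (w k) x)%R)%E).
    apply: L1_triangle => // x bx; apply: (le_trans (ler_normD _ _)); apply: lerD => //.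
    rewrite !normrM; apply: ler_wpM2r => //; rewrite normr_id.
    by apply: (le_trans (hA j x bx)); exact: ler_norm.
  by apply: leeD => //; apply: L1_scale => // x _; rewrite normrM (ger0_norm A0).
Qed.

Lemma potential_tail r : vanishing (fun m => \int[mu]_(x in bbox r) (Num.max 0 (V x - m%:R))%:E)%E.
Proof.
have mm (m : nat) : measurable_fun (bbox r) (fun x => (Num.max 0 (V x - m%:R))%:E).
  apply/measurable_EFinP/measurable_funTS; apply: measurable_maxr => //.
  exact: measurable_funB.
have c0 x : bbox r x -> (fun m : nat => (Num.max 0 (V x - m%:R))%:E) @ \oo --> (0 : \bar R)%E.
  move=> _; apply: cvg_near_cst; near=> m; congr EFin; apply/max_idPl.
  rewrite subr_le0; near: m; exact: nbhs_infty_ger.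
have := dominated_cvg (mb r) mm c0 _ (iV r) _.
rewrite integral0 => hc e e0.
have /(_ _ _)/wrap[//||c] := hc.
  by move=> m x _ /=; rewrite ger0_norm ?le_max ?lexx// lee_fin ge_max V0/= gerBl.
have [N hN] := cvg_vanishing c e0; by exists N.
Unshelve. all: by end_near. Qed.

(** V is unbounded, so L^1 convergence of f_k is not enough by itself. The splitting V |f| <= m |f|
    + d V f^2 + max(0, V - m) / d uses it for the first term, boundedness of the form for the second
    and [potential_tail] for the third. *)
Lemma weighted_part_vanishing r (f : nat -> 'rV[R]_n -> R) :
  (forall k, measurable_fun setT (f k)) -> (forall k x, f k x ^+ 2 <= sqmod (w k x)) ->
  vanishing (fun k => L1 r (f k)) ->
  vanishing (fun k => \int[mu]_(x in bbox r) (V x * `|f k x|)%:E)%E.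
Proof.
move=> mf fw vf e e0; have eqle (x y : \bar R) : x = y -> (x <= y)%E by move=> ->.
have [H H0 [N0 hH]] := form_cauchy_bounded tw cw.
(* With this [d] the middle term costs at most d H = e / 3; then [m] is chosen for the tail, and the
   index last. *)
pose d := e / (3 * H); have d0 : 0 < d by rewrite divr_gt0// mulr_gt0.
have di0 : 0 < d^-1 by rewrite invr_gt0.
have e3 : 0 < e / 3 by rewrite divr_gt0.
have [m /(_ m (leqnn m)) hm] := @potential_tail r (d * (e / 3)) (mulr_gt0 d0 e3).
have m1 : (0 : R) < m%:R + 1 by rewrite ltr_wpDl.
have [N1 hN1] := vf (e / 3 / (m%:R + 1)) (divr_gt0 e3 m1).
exists (maxn N0 N1) => k; rewrite geq_max => /andP[k0 k1].
pose g1 x := m%:R * `|f k x|; pose g2 x := d * form_density (w k) (w k) x.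
pose g3 x := d^-1 * Num.max 0 (V x - m%:R).
have mfk : measurable_fun setT (fun x => `|f k x|) by exact: measurableT_comp.
have mfd := measurable_form_density (tw k).
have mg1 : measurable_fun (bbox r) (EFin \o g1).
  by apply/measurable_EFinP/measurable_funTS; exact: measurable_funM.
have mg2 : measurable_fun (bbox r) (EFin \o g2).
  by apply/measurable_EFinP/measurable_funTS; exact: measurable_funM.
have mx : measurable_fun (bbox r) (fun x => (Num.max 0 (V x - m%:R))%:E).
  by apply/measurable_EFinP/measurable_funTS; apply: measurable_maxr => //; exact: measurable_funB.
have mg3 : measurable_fun (bbox r) (EFin \o g3).
  by apply/measurable_EFinP; apply: measurable_funM => //; exact/measurable_EFinP.
have p1 x : bbox r x -> (0 <= (g1 x)%:E)%E by rewrite lee_fin mulr_ge0.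
have p2 x : bbox r x -> (0 <= (g2 x)%:E)%E.
  by rewrite lee_fin mulr_ge0 ?(ltW d0)// form_density_ge0.
have x0 x : 0 <= Num.max 0 (V x - m%:R) by rewrite le_max lexx.
have p3 x : bbox r x -> (0 <= (g3 x)%:E)%E by rewrite lee_fin mulr_ge0 ?(ltW di0).
apply: (@le_trans _ _ (\int[mu]_(x in bbox r) (((g1 x)%:E + (g2 x)%:E) + (g3 x)%:E))%E).
  apply: ge0_le_integral => //.
  - by move=> x _; rewrite lee_fin mulr_ge0.
  - by apply/measurable_EFinP/measurable_funTS; exact: measurable_funM.
  - by apply: emeasurable_funD => //; exact: emeasurable_funD.
  - move=> x bx; rewrite -!EFinD lee_fin /g1 /g2 /g3.
    have hV : d * (V x * `|f k x| ^+ 2) <= d * form_density (w k) (w k) x.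
      rewrite ler_pM2l//; apply: le_trans (potential_le_density _ _).
      by apply: ler_wpM2l => //; rewrite real_normK ?num_real.
    have F0 := normr_ge0 (f k x); have dK : d * d^-1 = 1 by rewrite divff// gt_eqF.
    set F := `|f k x| in hV F0 *; set P := Num.max _ _.
    have P1 : V x - m%:R <= P by rewrite le_max lexx orbT.
    have PV : P <= V x by rewrite ge_max V0/= gerBl.
    have P0 : 0 <= P := x0 x.
    have q : F <= d * F ^+ 2 + d^-1.
      have : 0 <= d * (d * F ^+ 2 + d^-1 - F).
        by rewrite mulrBr mulrDr dK; have := sqr_ge0 (d * F - 1); have := mulr_ge0 (ltW d0) F0; rewrite !expr2; nra.
      by rewrite pmulr_rge0//; lra.
    have h1 : P * F <= P * (d * F ^+ 2 + d^-1) by exact: ler_wpM2l.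
    have h2 : P * (d * F ^+ 2) <= V x * (d * F ^+ 2).
      by apply: ler_wpM2r => //; rewrite mulr_ge0 ?sqr_ge0 ?(ltW d0).
    have h3 : (V x - m%:R) * F <= P * F by exact: ler_wpM2r.
    lra.
rewrite ge0_integralD//; [|by move=> x bx; rewrite adde_ge0 ?p1 ?p2|exact: emeasurable_funD].
rewrite ge0_integralD//.
have -> : e%:E = ((e / 3)%:E + (e / 3)%:E + (e / 3)%:E)%E by rewrite -!EFinD; congr EFin; field.
apply: leeD; first apply: leeD.
- apply: (@le_trans _ _ (m%:R%:E * L1 r (f k))%E).
    have mfr : measurable_fun (bbox r) (fun x => `|f k x|%:E) by exact/measurable_EFinP/measurable_funTS.
    rewrite -(ge0_integralZl mu (mb r) mfr)//.
  apply: (@le_trans _ _ (m%:R%:E * (e / 3 / (m%:R + 1))%:E)%E).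
    by apply: lee_wpmul2l; [rewrite lee_fin|exact: hN1].
  by rewrite -EFinM lee_fin mulrA ler_pdivrMr//; nra.
- apply: (@le_trans _ _ (d%:E * \int[mu]_x (form_density (w k) (w k) x)%:E)%E).
    rewrite -ge0_integralZl//; [|exact/measurable_EFinP|by move=> x _; rewrite lee_fin form_density_ge0|by rewrite lee_fin ltW].
    apply: (@le_trans _ _ (\int[mu]_x (g2 x)%:E)%E).
      apply: ge0_subset_integral => //; first by apply/measurable_EFinP; exact: measurable_funM.
      by move=> x _; rewrite lee_fin mulr_ge0 ?(ltW d0)// form_density_ge0.
    by under [X in (_ <= X)%E]eq_integral do rewrite -EFinM.
  rewrite integral_form_density// -EFinM lee_fin.
  apply: (@le_trans _ _ (d * H)); first by rewrite ler_pM2l//; exact: hH.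
  by rewrite /d invfM mulrA mulfVK// gt_eqF.
- apply: (@le_trans _ _ (d^-1%:E * (d * (e / 3))%:E)%E); last first.
    by rewrite -EFinM lee_fin mulKf// gt_eqF.
  apply: (@le_trans _ _ (d^-1%:E * \int[mu]_(x in bbox r) (Num.max 0 (V x - m%:R))%:E)%E).
    rewrite -(ge0_integralZl mu (mb r) mx)//; last by rewrite lee_fin ltW.
    by move=> x _; rewrite lee_fin.
  by apply: lee_wpmul2l => //; rewrite lee_fin ltW.
Qed.

(** chi and its magnetic gradient are bounded and supported in a box, so |h(w_k, chi)| is at most a
    constant times finitely many L^1 quantities that vanish. *)
Lemma hform_vanishing_test chi : test_function chi ->
  forall e : R, 0 < e -> exists N, forall k, (N <= k)%N -> `|hform (w k) chi| <= e.
Proof.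
move=> tc e e0; have [r [C [r0 C0 out bc bmc]]] := mpart_bounds ba tc.
pose G k := (C%:E * (\sum_(j < n) (L1 r (mpart_re a j (w k)) + L1 r (mpart_im a j (w k))) +
  (\int[mu]_(x in bbox r) (V x * `|repart (w k) x|)%:E + \int[mu]_(x in bbox r) (V x * `|impart (w k) x|)%:E)))%E.
have vG : vanishing G.
  have [pr pi] := part_vanishing r.
  apply: vanishingZ => //; apply: vanishingD; last first.
    apply: vanishingD; apply: weighted_part_vanishing => // k; try (by have [] := measurable_test (tw k)).
      by move=> x; rewrite /sqmod lerDl sqr_ge0.
    by move=> x; rewrite /sqmod lerDr sqr_ge0.
  by apply: vanishing_sum => j; have [h1 h2] := mpart_vanishing r j; exact: vanishingD.
have [N hN] := vG e e0; exists N => k /hN; apply: contraTT; rewrite -!ltNge => hlt.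
apply: (@lt_le_trans _ _ `|hform (w k) chi|%:E); first by rewrite lte_fin.
have ti := integrable_form_density ma ba mV V0 iV (tw k) tc.
have mt := measurable_int _ ti.
have -> : (`|hform (w k) chi|%:E = `|\int[mu]_x (form_density (w k) chi x)%:E|)%E.
  by rewrite /hform /Rintegral -abse_EFin fineK//; exact: integrable_fin_num ti.
apply: (le_trans (le_abse_integral mu measurableT mt)).
have mb' := mb r.
have -> : (\int[mu]_x `|(form_density (w k) chi x)%:E| =
    \int[mu]_(x in bbox r) `|(form_density (w k) chi x)%:E|)%E.
  rewrite [RHS]integral_mkcond; apply: eq_integral => x _; rewrite patchE; case: ifPn => //.
  rewrite notin_setE => /out[u0 m0]; rewrite /form_density u0 /cdot /= !mulr0 addr0 mulr0 addr0.
  by rewrite big1 ?normr0// => j _; have [-> ->] := m0 j; rewrite !mulr0 addr0.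
pose s j x := `|mpart_re a j (w k) x| + `|mpart_im a j (w k) x|.
pose v x := V x * `|repart (w k) x| + V x * `|impart (w k) x|.
have [mr mi] := measurable_test (tw k).
have mrm j : measurable_fun setT (fun x => `|mpart_re a j (w k) x|).
  by apply: measurableT_comp => //; exact: (measurable_mpart ma j (tw k)).1.
have mim j : measurable_fun setT (fun x => `|mpart_im a j (w k) x|).
  by apply: measurableT_comp => //; exact: (measurable_mpart ma j (tw k)).2.
have mVr : measurable_fun setT (fun x => V x * `|repart (w k) x|).
  by apply: measurable_funM => //; exact: measurableT_comp.
have mVi : measurable_fun setT (fun x => V x * `|impart (w k) x|).
  by apply: measurable_funM => //; exact: measurableT_comp.
have E0 (f : 'rV[R]_n -> R) : measurable_fun setT f -> measurable_fun (bbox r) (fun x => (f x)%:E).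
  by move=> mf; apply/measurable_EFinP; exact: measurable_funTS.
have ms : measurable_fun setT (fun x => \sum_(j < n) s j x).
  by apply: measurable_sum => j; exact: measurable_funD.
have mv : measurable_fun setT v by exact: measurable_funD.
have Vr0 x : bbox r x -> (0 <= (V x * `|repart (w k) x|)%:E)%E by rewrite lee_fin mulr_ge0.
have Vi0 x : bbox r x -> (0 <= (V x * `|impart (w k) x|)%:E)%E by rewrite lee_fin mulr_ge0.
have s0 j x : 0 <= s j x by rewrite addr_ge0.
have v0 x : 0 <= v x by rewrite addr_ge0// mulr_ge0.
have EG : G k = (\int[mu]_(x in bbox r) (C%:E * ((\sum_(j < n) s j x)%:E + (v x)%:E)))%E.
  rewrite ge0_integralZl//; last first.
  - by move=> x _; rewrite -EFinD lee_fin addr_ge0 ?sumr_ge0.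
  - by apply: emeasurable_funD; exact: E0.
  rewrite ge0_integralD//; last first.
  
  - exact: E0.
  - by move=> x _; rewrite lee_fin.
  - exact: E0.
  - by move=> x _; rewrite lee_fin sumr_ge0.
  rewrite /G; congr (_ * (_ + _))%E.
    under [RHS]eq_integral do rewrite -sumEFin.
    rewrite ge0_integral_sum//; last first.
    - by move=> j x _; rewrite lee_fin.
    - by move=> j; apply: E0; exact: measurable_funD.
    apply: eq_bigr => j _; rewrite -ge0_integralD//; exact: E0.
  by rewrite -ge0_integralD//; exact: E0.
rewrite EG; apply: ge0_le_integral => //.
- by apply: measurableT_comp => //; exact: measurable_funTS mt.
- by apply: measurable_funeM; apply: emeasurable_funD; exact: E0.
move=> x _; rewrite -EFinD -EFinM lee_fin /form_density.
apply: (le_trans (ler_normD _ _)); rewrite [leRHS]mulrDr; apply: lerD.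
  apply: (le_trans (ler_norm_sum _ _ _)); rewrite mulr_sumr; apply: ler_sum => j _.
  apply: (le_trans (ler_normD _ _)); rewrite !normrM mulrDr; have [h1 h2] := bmc j x.
  by apply: lerD; rewrite mulrC; apply: ler_wpM2r.
rewrite normrM (ger0_norm (V0 x)) /v -mulrDr mulrCA; apply: ler_wpM2l => //.
rewrite /cdot; apply: (le_trans (ler_normD _ _)); rewrite !normrM mulrDr; have [h1 h2] := bc x.
by apply: lerD; rewrite mulrC; apply: ler_wpM2r.
Qed.

(** Expansion around a fixed w_N gives h(w_k, w_k) <= h(w_k - w_N, w_k - w_N) + 2 h(w_k, w_N), and
    w_N serves as the fixed test function. *)
Lemma form_closable : forall e : R, 0 < e -> exists N, forall k, (N <= k)%N -> hform (w k) (w k) <= e.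
Proof.
move=> e e0; have e2 : 0 < e / 2 by rewrite divr_gt0.
have e4 : 0 < e / 4 by rewrite divr_gt0.
have [N hN] := cw e2; have [N' hN'] := hform_vanishing_test (tw N) e4.
exists (maxn N N') => k; rewrite geq_max => /andP[Nk N'k].
have := hN k N Nk (leqnn _); have := hN' k N'k; have := hform_ge0 a V0 (w N).
by rewrite sub_lincomb hform_sqr_lincomb// ler_norml; lra.
Qed.

End vanishing_sequence.

Lemma sqnormE u : sqnorm u = (\int[mu]_x (sqmod (u x))%:E)%E.
Proof. by apply: eq_integral => x _; rewrite normc_sqr. Qed.

Lemma sqnorm_sub_le u v w : measurable_fun setT (repart u) -> measurable_fun setT (impart u) ->
  measurable_fun setT (repart v) -> measurable_fun setT (impart v) ->
  measurable_fun setT (repart w) -> measurable_fun setT (impart w) ->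
  (sqnorm (u \- v)%R <= 2%:E * (sqnorm (u \- w)%R + sqnorm (v \- w)%R))%E.
Proof.
move=> m1 m2 m3 m4 m5 m6; rewrite !sqnormE.
have ms (f g : 'rV[R]_n -> R[i]) : measurable_fun setT (repart f) -> measurable_fun setT (impart f) ->
    measurable_fun setT (repart g) -> measurable_fun setT (impart g) ->
    measurable_fun setT (fun x => (sqmod ((f \- g) x))%:E).
  move=> a1 a2 a3 a4; apply/measurable_EFinP.
  apply: measurable_funD; apply: measurable_funX.
    by move: (measurable_funB a1 a3); rewrite -re_sub.
  by move: (measurable_funB a2 a4); rewrite -im_sub.
have p (f : 'rV[R]_n) : setT f -> (0 <= (sqmod ((u \- w) f))%:E)%E by rewrite lee_fin sqmod_ge0.
have q (f : 'rV[R]_n) : setT f -> (0 <= (sqmod ((v \- w) f))%:E)%E by rewrite lee_fin sqmod_ge0.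
rewrite -ge0_integralD//; [|exact: ms|exact: ms].
have mD := emeasurable_funD (ms u w m1 m2 m5 m6) (ms v w m3 m4 m5 m6).
rewrite -(ge0_integralZl mu measurableT mD)//; last by move=> x _; rewrite adde_ge0// ?p ?q.
apply: ge0_le_integral => //.
- by move=> x _; rewrite lee_fin sqmod_ge0.
- exact: ms.
- exact: measurable_funeM.
- move=> x _; rewrite -EFinD -EFinM lee_fin /sqmod.
  rewrite -!/(repart _ x) -!/(impart _ x) !re_sub !im_sub /=.
  set p1 := repart u x; set p2 := impart u x; set q1 := repart v x; set q2 := impart v x.
  set s1 := repart w x; set s2 := impart w x.
  have := sqr_ge0 (p1 + q1 - 2 * s1); have := sqr_ge0 (p2 + q2 - 2 * s2).
  by rewrite !expr2; nra.
Qed.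

Lemma approximates_measurable us u : form_approximates a V us u ->
  [/\ forall k, measurable_fun setT (repart (us k)) /\ measurable_fun setT (impart (us k)),
  measurable_fun setT (repart u) & measurable_fun setT (impart u)].
Proof. by move=> [tus [m1 m2 _] _ _]; split => // k; exact: measurable_test. Qed.

Lemma approximates_cauchy us u : form_approximates a V us u -> form_cauchy us.
Proof.
move=> [_ _ _ c] e /c[N hN]; exists N => k l Nk Nl.
by rewrite -(Re_magnetic_form a V); exact: hN.
Qed.

(** The differences us_k - us'_k are h-Cauchy and tend to 0 in L^2, so closability applies to
    them. *)
Lemma approximants_close us us' u : form_approximates a V us u -> form_approximates a V us' u ->
  forall e : R, 0 < e -> exists N, forall k, (N <= k)%N ->
  hform (us k \- us' k) (us k \- us' k) <= e.
Proof.
move=> au au'; have [tu _ vu _] := au; have [tu' _ vu' _] := au'.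
have [ms mr mi] := approximates_measurable au.
have [ms' _ _] := approximates_measurable au'.
apply: (form_closable (w := fun k => us k \- us' k)).
- by move=> k; exact: test_sub.
- move=> e e0; have e4 : 0 < e / 4 by rewrite divr_gt0.
  have [N hN] := approximates_cauchy au e4; have [N' hN'] := approximates_cauchy au' e4.
  exists (maxn N N') => k l; rewrite !geq_max => /andP[k1 k2] /andP[l1 l2].
  rewrite (_ : _ \- _ = (us k \- us l) \- (us' k \- us' l)); last first.
    by apply/funext => x /=; ring.
  have := hN k l k1 l1; have := hN' k l k2 l2.
  by have := hform_sub_le (test_sub (tu k) (tu l)) (test_sub (tu' k) (tu' l)); lra.
have h := vanishingZ (ler0n R 2) (vanishingD (cvg_vanishing vu) (cvg_vanishing vu')).
apply: vanishing_le h => k; rewrite -sqnormE; apply: sqnorm_sub_le => //.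
- exact: (ms k).1.
- exact: (ms k).2.
- exact: (ms' k).1.
- exact: (ms' k).2.
Qed.

Lemma hform_small u v (H e : R) : test_function u -> test_function v -> 0 < H -> 0 < e ->
  hform u u <= e ^+ 2 / H -> hform v v <= H -> `|hform u v| <= e.
Proof.
move=> tu tv H0 e0 hu hv; have := hform_cauchy_schwarz ma ba mV V0 iV tu tv.
have h1 : hform u u * hform v v <= e ^+ 2.
  rewrite -[leRHS](divfK (lt0r_neq0 H0)).
  by apply: ler_pM => //; exact: hform_ge0.
move=> h2; rewrite -(@ler_pXn2r _ 2)//; last by rewrite nnegrE ltW.
by rewrite real_normK ?num_real//; exact: le_trans h1.
Qed.

(** [closed_form] provides some pair of approximating sequences; this carries its value over to any
    other pair. *)
Lemma form_limit_unique us us' vs vs' u v :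
  form_approximates a V us u -> form_approximates a V us' u ->
  form_approximates a V vs v -> form_approximates a V vs' v ->
  forall e : R, 0 < e -> exists N, forall k, (N <= k)%N ->
  `|hform (us k) (vs k) - hform (us' k) (vs' k)| <= e.
Proof.
move=> au au' av av' e e0; have e2 : 0 < e / 2 by rewrite divr_gt0.
have [tu _ _ _] := au; have [tu' _ _ _] := au'; have [tv _ _ _] := av; have [tv' _ _ _] := av'.
have [H H0 [N1 hN1]] := form_cauchy_bounded tv (approximates_cauchy av).
have [H' H'0 [N2 hN2]] := form_cauchy_bounded tu' (approximates_cauchy au').
have [|N3 hN3] := @approximants_close us us' u au au' ((e / 2) ^+ 2 / H).
  by rewrite divr_gt0// exprn_gt0.
have [|N4 hN4] := @approximants_close vs vs' v av av' ((e / 2) ^+ 2 / H').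
  by rewrite divr_gt0// exprn_gt0.
exists (maxn (maxn N1 N2) (maxn N3 N4)) => k; rewrite !geq_max => /andP[/andP[k1 k2] /andP[k3 k4]].
have E : hform (us k) (vs k) - hform (us' k) (vs' k) =
    hform (us k \- us' k) (vs k) + hform (vs k \- vs' k) (us' k).
  rewrite !sub_lincomb !(hform_lincomb ma ba mV V0 iV)// (hformC _ _ (vs k)) (hformC _ _ (vs' k)).
  by ring.
rewrite E [e]splitr; apply: (le_trans (ler_normD _ _)); apply: lerD.
  apply: (@hform_small _ _ H) => //; [exact: test_sub|exact: hN3|exact: hN1].
by apply: (@hform_small _ _ H') => //; [exact: test_sub|exact: hN4|exact: hN2].
Qed.

End closability.

(** * The Hilbert space L^2 *)

Section geometric_steps.
Context {R : realType}.

(* Cauchy-Schwarz with the weights p^j turns a bound on the weighted sum of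
   the squared steps into geometric convergence. *)
Lemma weighted_steps_bound (f : nat -> R) (p G : R) : 0 < p -> p < 1 ->
  (forall m, \sum_(j < m) (p ^+ j)^-1 * (f j.+1 - f j) ^+ 2 <= G) ->
  forall k l, (f (k + l)%N - f k) ^+ 2 <= p ^+ k / (1 - p) * G.
Proof.
move=> p0 p1 hG k l; have q0 : 0 < 1 - p by lra.
pose S m := \sum_(j < m) (p ^+ j)^-1 * (f j.+1 - f j) ^+ 2.
have S0 m : 0 <= S m.
  by apply: sumr_ge0 => j _; rewrite mulr_ge0 ?sqr_ge0// invr_ge0 exprn_ge0// ltW.
have pk0 m : 0 < p ^+ m by exact: exprn_gt0.
have ple m : p ^+ (k + m) <= p ^+ k.
  by rewrite exprD ler_piMr ?(ltW (pk0 _))// exprn_ile1 ?(ltW p0)// ltW.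
(* The first factor is the sum of p^j for k <= j < k + m. It vanishes only for m = 0, which the
   induction treats apart because it divides by it. *)
have key m : (f (k + m)%N - f k) ^+ 2 <= (p ^+ k - p ^+ (k + m)) / (1 - p) * (S (k + m)%N - S k).
  elim: m => [|m IH]; first by rewrite !addn0 !subrr expr0n mulr0.
  rewrite addnS [S _.+1]/S big_ord_recr /= -/(S (k + m)%N).
  set x := f (k + m)%N - f k in IH; set t := f (k + m).+1 - f (k + m)%N.
  set A := (p ^+ k - p ^+ (k + m)) / (1 - p) in IH.
  set B := S (k + m)%N - S k in IH; set P := p ^+ (k + m).
  have A0 : 0 <= A by rewrite divr_ge0 ?(ltW q0)// subr_ge0.
  have -> : (p ^+ k - p ^+ (k + m).+1) / (1 - p) = A + P.
    by rewrite /A /P exprS; field; rewrite gt_eqF.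
  have -> : f (k + m).+1 - f k = x + t by rewrite /x /t; ring.
  have -> : S (k + m)%N + P^-1 * t ^+ 2 - S k = B + P^-1 * t ^+ 2 by rewrite /B; ring.
  have P0 : 0 < P := pk0 _.
  have [A00|A1] := eqVneq A 0.
    have x0 : x = 0.
      by apply/eqP; rewrite -sqrf_eq0 eq_le sqr_ge0 andbT; rewrite A00 mul0r in IH.
    have m0 : m = 0%N.
      apply/eqP; apply: contraT => m0; move/eqP: A00; rewrite /A mulf_eq0 invr_eq0 (gt_eqF q0) orbF.
      rewrite subr_eq0 exprD => /eqP E.
      have : p ^+ k * (1 - p ^+ m) = 0 by rewrite mulrBr mulr1 -E subrr.
      move/eqP; rewrite mulf_eq0 gt_eqF//= subr_eq0 => /eqP E1.
      have : p ^+ m <= p.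
        by rewrite -(prednK (n := m)) ?lt0n// exprS ler_piMr ?(ltW p0)// exprn_ile1// ltW.
      by rewrite -E1 leNgt p1.
    have B0 : B = 0 by rewrite /B m0 addn0 subrr.
    by rewrite x0 A00 B0 !add0r mulrA divff ?gt_eqF// mul1r.
  have Ap : 0 < A by rewrite lt_neqAle eq_sym A1.
  have Bx : x ^+ 2 / A <= B by rewrite ler_pdivrMr// mulrC.
  (* Two-term Cauchy-Schwarz: this product exceeds (x + t)^2 by (P x - A t)^2 / (A P). *)
  apply: (@le_trans _ _ ((A + P) * (x ^+ 2 / A + P^-1 * t ^+ 2))); last first.
    by apply: ler_wpM2l; [rewrite addr_ge0// ltW|rewrite lerD2r].
  have -> : (A + P) * (x ^+ 2 / A + P^-1 * t ^+ 2) =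
      (x + t) ^+ 2 + (P * x - A * t) ^+ 2 / (A * P).
    by field; rewrite A1 gt_eqF.
  by rewrite lerDl divr_ge0 ?sqr_ge0// mulr_ge0 ?(ltW P0).
apply: (le_trans (key l)); apply: ler_pM.
- by rewrite divr_ge0 ?(ltW q0)// subr_ge0.
- rewrite /S big_split_ord /= [X in X - _]addrC addrK; apply: sumr_ge0 => j _.
  by rewrite mulr_ge0 ?sqr_ge0// invr_ge0 exprn_ge0// ltW.
- by rewrite ler_pM2r ?invr_gt0// gerBl ltW.
- by apply: le_trans (hG (k + l)%N); rewrite gerBl.
Qed.

Lemma weighted_steps_cvg (f : nat -> R) (p G : R) : 0 < p -> p < 1 ->
  (forall m, \sum_(j < m) (p ^+ j)^-1 * (f j.+1 - f j) ^+ 2 <= G) ->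
  cvgn f /\ forall k, (limn f - f k) ^+ 2 <= p ^+ k / (1 - p) * G.
Proof.
move=> p0 p1 hG; have hb := weighted_steps_bound p0 p1 hG.
have cf : cvgn f.
  apply/cauchy_cvgP/cauchy_ballP => e e0.
  have e2 : 0 < (e / 2) ^+ 2 / 2 by rewrite divr_gt0// exprn_gt0// divr_gt0.
  have [N hN] := small_geometric (G / (1 - p)) (ltW p0) p1 e2.
  have near_N k : (N <= k)%N -> `|f k - f N| < e / 2.
    move=> Nk; rewrite -(ltr_pXn2r (ltn0Sn 1)) ?nnegrE ?divr_ge0 ?(ltW e0)//.
    rewrite real_normK ?num_real// -(subnKC Nk); apply: (le_lt_trans (hb N _)).
    apply: (@le_lt_trans _ _ ((e / 2) ^+ 2 / 2)); last first.
      by rewrite ltr_pdivrMr// ltr_pMr ?ltr1n// exprn_gt0// divr_gt0.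
    by apply: le_trans (hN N (leqnn _)); rewrite mulrC [X in _ * X]mulrC mulrA.
  exists ([set y | `|y - f N| < e / 2], [set y | `|y - f N| < e / 2]) => /=.
    by split; exists N => //= k Nk; exact: near_N.
  move=> [y z] /= [h1 h2]; rewrite /ball /=.
  rewrite (_ : y - z = (y - f N) - (z - f N)); last by ring.
  by rewrite [e]splitr; apply: le_lt_trans (ler_normB _ _) _; apply: ltrD.
split=> // k.
have c2 : (fun m => (f m - f k) ^+ 2) @ \oo --> (limn f - f k) ^+ 2.
  under eq_fun do rewrite expr2; rewrite expr2.
  by apply: cvgM; apply: cvgB => //; exact: cvg_cst.
rewrite -(cvg_lim (@Rhausdorff R) c2); apply: limr_le; first by apply/cvg_ex; eexists; exact: c2.
exists k => // m /= km; rewrite -(subnKC km); exact: hb.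
Qed.

End geometric_steps.

Section L2_functions.
Local Open Scope complex_scope.
Context {R : realType} {n : nat}.
Implicit Types (u v w : 'rV[R]_n -> R[i]) (t : R).
Local Notation mu := (@lebesgue_rV R n).

Lemma aeq_refl u : aeq u u.
Proof. by apply: (filterS _ filterT). Qed.

Lemma aeq_sym u v : aeq u v -> aeq v u.
Proof. by apply: filterS => x ->. Qed.

Lemma aeq_trans u v w : aeq u v -> aeq v w -> aeq u w.
Proof. by apply: filterS2 => x -> ->. Qed.

Lemma measurable_L2 u : L2 u -> measurable_fun setT (repart u) /\ measurable_fun setT (impart u).
Proof. by case. Qed.

Lemma measurable_sqmod u : measurable_fun setT (repart u) -> measurable_fun setT (impart u) ->
  measurable_fun setT (fun x => sqmod (u x)).
Proof. by move=> m1 m2; apply: measurable_funD; exact: measurable_funX. Qed.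

Lemma integrable_sqmod u : L2 u -> mu.-integrable setT (fun x => (sqmod (u x))%:E).
Proof.
move=> [m1 m2 fu]; apply/integrableP; split.
  by apply/measurable_EFinP; exact: measurable_sqmod.
move: fu; rewrite -/(sqnorm u) sqnormE; apply: le_lt_trans.
by under eq_integral do rewrite abse_EFin ger0_norm ?sqmod_ge0//.
Qed.

Lemma L2P u : measurable_fun setT (repart u) -> measurable_fun setT (impart u) ->
  mu.-integrable setT (fun x => (sqmod (u x))%:E) -> L2 u.
Proof.
move=> m1 m2 /integrableP[_ fu]; split => //; rewrite -/(sqnorm u) sqnormE.
by apply: le_lt_trans fu; under [leRHS]eq_integral do rewrite abse_EFin ger0_norm ?sqmod_ge0//.
Qed.

Lemma L2_lincomb t u v : L2 u -> L2 v -> L2 (lincomb t u v).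
Proof.
move=> Lu Lv; have [m1 m2] := measurable_L2 Lu; have [m3 m4] := measurable_L2 Lv.
have mr : measurable_fun setT (repart (lincomb t u v)).
  by rewrite re_lincomb; apply: measurable_funD => //; exact: measurable_funM.
have mi : measurable_fun setT (impart (lincomb t u v)).
  by rewrite im_lincomb; apply: measurable_funD => //; exact: measurable_funM.
apply: L2P => //.
apply: (@le_integrable _ _ _ mu _ measurableT _
    (fun x => 2%:E * (sqmod (u x))%:E + (2 * t ^+ 2)%:E * (sqmod (v x))%:E)%E).
- by apply/measurable_EFinP; exact: measurable_sqmod.
- move=> x _; rewrite -!EFinM -EFinD !abse_EFin lee_fin !ger0_norm ?sqmod_ge0//; last first.
    by rewrite addr_ge0// mulr_ge0 ?sqmod_ge0// mulr_ge0// sqr_ge0.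
  rewrite /sqmod -!/(repart _ x) -!/(impart _ x) re_lincomb im_lincomb.
  have := sqr_ge0 (repart u x - t * repart v x); have := sqr_ge0 (impart u x - t * impart v x).
  by rewrite !expr2; nra.
- by apply: integrableD => //; apply: integrableZl => //; exact: integrable_sqmod.
Qed.

Lemma L2_sub u v : L2 u -> L2 v -> L2 (u \- v).
Proof. by rewrite sub_lincomb; exact: L2_lincomb. Qed.

Lemma L2_0 : L2 ((fun=> 0) : 'rV[R]_n -> R[i]).
Proof.
apply: L2P; try exact: measurable_cst.
rewrite (_ : (fun _ => _) = cst 0%E); first exact: integrable0.
by apply/funext => x; rewrite /sqmod /= expr0n /= addr0.
Qed.

Lemma integrable_cdot u v : L2 u -> L2 v -> mu.-integrable setT (fun x => (cdot (u x) (v x))%:E).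
Proof.
move=> Lu Lv; have [m1 m2] := measurable_L2 Lu; have [m3 m4] := measurable_L2 Lv.
apply: (@le_integrable _ _ _ mu _ measurableT _ (fun x => (sqmod (u x))%:E + (sqmod (v x))%:E)%E).
- by apply/measurable_EFinP; apply: measurable_funD; exact: measurable_funM.
- move=> x _; rewrite -EFinD !abse_EFin lee_fin [leRHS]ger0_norm; last by rewrite addr_ge0 ?sqmod_ge0.
  rewrite ler_norml /cdot /sqmod; set p := complex.Re _; set q := complex.Im _.
  set p' := complex.Re _; set q' := complex.Im _.
  have := sqr_ge0 (p - p'); have := sqr_ge0 (q - q'); have := sqr_ge0 (p + p').
  have := sqr_ge0 (q + q'); rewrite !expr2 => h1 h2 h3 h4; apply/andP; split; nra.
- exact: (integrableD measurableT (integrable_sqmod Lu) (integrable_sqmod Lv)).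
Qed.

Definition ip0 u v : R := \int[mu]_x cdot (u x) (v x).

Lemma Re_inner u v : complex.Re (inner u v) = ip0 u v.
Proof.
rewrite /inner /Cintegral /ip0 /=; congr Rintegral; apply/funext => x.
by rewrite /cdot; case: (u x) => p q; case: (v x) => p' q' /=; ring.
Qed.

Lemma ip0C u v : ip0 u v = ip0 v u.
Proof. by congr Rintegral; apply/funext => x; rewrite /cdot; ring. Qed.

Lemma cdot_lincomb t u v w x :
  cdot (lincomb t u v x) (w x) = cdot (u x) (w x) + t * cdot (v x) (w x).
Proof.
rewrite /cdot -/(repart (lincomb t u v) x) -/(impart (lincomb t u v) x).
by rewrite re_lincomb im_lincomb /repart /impart; ring.
Qed.

Lemma ip0_lincomb t u v w : L2 u -> L2 v -> L2 w ->
  ip0 (lincomb t u v) w = ip0 u w + t * ip0 v w.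
Proof.
move=> Lu Lv Lw; have iu := integrable_cdot Lu Lw; have iv := integrable_cdot Lv Lw.
rewrite /ip0 -RintegralZl// -RintegralD//; last exact: integrableZl iv.
by congr Rintegral; apply/funext => x; exact: cdot_lincomb.
Qed.

Lemma ip0_ge0 u : 0 <= ip0 u u.
Proof.
apply: fine_ge0; apply: integral_ge0 => x _; rewrite lee_fin /cdot -!expr2.
by rewrite addr_ge0 ?sqr_ge0.
Qed.

Lemma sqnorm_ip0 u : L2 u -> sqnorm u = (ip0 u u)%:E.
Proof.
move=> Lu; rewrite sqnormE /ip0 /Rintegral.
have E : (fun x => (sqmod (u x))%:E) = (fun x => (cdot (u x) (u x))%:E).
  by apply/funext => x; rewrite /cdot /sqmod !expr2.
by rewrite E fineK// -E; exact: integrable_fin_num (integrable_sqmod Lu).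
Qed.

Lemma ip0_aeq u u' v : L2 u -> L2 u' -> L2 v -> aeq u u' -> ip0 u v = ip0 u' v.
Proof.
move=> Lu Lu' Lv uu'; congr fine; apply: ae_eq_integral => //.
- exact: measurable_int (integrable_cdot Lu Lv).
- exact: measurable_int (integrable_cdot Lu' Lv).
- by apply: filterS uu' => x /= -> _.
Qed.

Lemma ip0_eq0 u : L2 u -> ip0 u u = 0 -> aeq u (fun=> 0).
Proof.
move=> Lu h; have := sqnorm_ip0 Lu; rewrite h sqnormE => E.
have mu0 := measurable_int _ (integrable_sqmod Lu).
have : (\int[mu]_x `|(sqmod (u x))%:E| = 0)%E.
  by rewrite -[RHS]E; apply: eq_integral => x _; rewrite abse_EFin ger0_norm ?sqmod_ge0.
move/(ae_eq_integral_abs _ measurableT mu0); apply: filterS => x /(_ I)/= [] /eqP.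
rewrite /sqmod paddr_eq0 ?sqr_ge0// !sqrf_eq0 => /andP[/eqP h1 /eqP h2].
by apply/eqP; rewrite eq_complex h1 h2 !eqxx.
Qed.

Lemma L2_test u : test_function u -> L2 u.
Proof.
move=> tu; have [m1 m2] := measurable_test tu; have [r [C [r0 C0 out bu _]]] := test_bounds tu.
apply: L2P => //; apply: (@integrable_supported _ _ (fun x => sqmod (u x)) r).
  apply: (@bounded_integrable _ _ _ _ (C ^+ 2 + C ^+ 2)) => //.
  - exact: measurable_bbox.
  - exact: bbox_fin.
  - by apply: measurable_funTS; exact: measurable_sqmod.
  - move=> x _; rewrite ger0_norm ?sqmod_ge0// /sqmod; have [h1 h2] := bu x.
    by rewrite -![complex.Re _ ^+ 2]real_normK ?num_real// -![complex.Im _ ^+ 2]real_normK ?num_real//;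
      apply: lerD; rewrite ler_pXn2r ?nnegrE.
by move=> x /out[-> _ _]; rewrite /sqmod /= expr0n /= addr0.
Qed.

End L2_functions.

(** * The Riesz-Fischer theorem *)

Section riesz_fischer.
Local Open Scope complex_scope.
Context {R : realType} {n : nat}.
Local Notation mu := (@lebesgue_rV R n).
Variables (u : nat -> 'rV[R]_n -> R[i]) (K q p : R).
Hypothesis q0 : 0 <= q.
Hypothesis p0 : 0 < p.
Hypothesis p1 : p < 1.
Hypothesis qp : q < p.
Hypothesis Lu : forall k, L2 (u k).
Hypothesis uK : forall k, ip0 (u k.+1 \- u k) (u k.+1 \- u k) <= K * q ^+ k.

Let step k x : \bar R := ((p ^+ k)^-1 * sqmod ((u k.+1 \- u k) x))%:E.

Let step_ge0 k x : (0 <= step k x)%E.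
Proof. by rewrite lee_fin mulr_ge0 ?sqmod_ge0// invr_ge0 exprn_ge0// ltW. Qed.

Let measurable_step k : measurable_fun setT (step k).
Proof.
apply/measurable_EFinP; apply: measurable_funM => //.
by have [m1 m2] := measurable_L2 (L2_sub (Lu k.+1) (Lu k)); exact: measurable_sqmod.
Qed.

(** An integrable majorant: its integral is at most K times the sum of (q / p)^k, finite because q <
    p. Wherever [G] is finite, [weighted_steps_cvg] gives convergence with a rate. *)
Let G x : \bar R := (\sum_(0 <= k <oo) step k x)%E.

Let measurable_G : measurable_fun setT G.
Proof. by apply: ge0_emeasurable_sum => // k x _ _; exact: step_ge0. Qed.

Let G_ge0 x : (0 <= G x)%E.
Proof. by apply: nneseries_ge0 => k _ _; exact: step_ge0. Qed.

Let integral_G : exists2 C : R, 0 <= C & (\int[mu]_x G x <= C%:E)%E.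
Proof.
have K0 : 0 <= K by have := uK 0; rewrite expr0 mulr1; apply: le_trans; exact: ip0_ge0.
have qp0 : 0 <= q / p by rewrite divr_ge0// ltW.
have qp1 : q / p < 1 by rewrite ltr_pdivrMr// mul1r.
have d0 : 0 < 1 - q / p by lra.
exists (K / (1 - q / p)); first by rewrite divr_ge0// ltW.
rewrite /G integral_nneseries//.
apply: lime_le; first by apply: is_cvg_nneseries => k _ _; apply: integral_ge0 => x _.
near=> m.
have le k : (\int[mu]_x step k x <= (K * (q / p) ^+ k)%:E)%E.
  have Ls := L2_sub (Lu k.+1) (Lu k).
  have [m1 m2] := measurable_L2 Ls.
  have ms : measurable_fun setT (fun x => (sqmod ((u k.+1 \- u k) x))%:E).
    by apply/measurable_EFinP; exact: measurable_sqmod.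
  have pk : 0 <= (p ^+ k)^-1 by rewrite invr_ge0 exprn_ge0// ltW.
  under eq_integral do rewrite /step EFinM.
  rewrite (ge0_integralZl mu measurableT ms)//; last by move=> x _; rewrite lee_fin sqmod_ge0.
  rewrite -sqnormE sqnorm_ip0// -EFinM lee_fin expr_div_n.
  rewrite [leRHS](_ : _ = (p ^+ k)^-1 * (K * q ^+ k)); last by ring.
  exact: ler_wpM2l.
apply: (@le_trans _ _ (\sum_(0 <= k < m) (K * (q / p) ^+ k)%:E)%E); first by apply: lee_sum => k _; exact: le.
rewrite sumEFin lee_fin -mulr_sumr; apply: ler_wpM2l => //.
rewrite -(ler_pM2l d0) divff ?gt_eqF// big_mkord -opprB mulNr -subrX1 opprB.
by rewrite gerBl exprn_ge0.
Unshelve. all: by end_near. Qed.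

(** The upper limit made real by [fine]: defined and measurable everywhere, and the limit wherever
    [G] is finite. *)
Let limpart (f : ('rV[R]_n -> R[i]) -> 'rV[R]_n -> R) x : R :=
  fine (limn_esup (fun k => (f (u k) x)%:E)).

Let measurable_limpart f : (forall k, measurable_fun setT (f (u k))) ->
  measurable_fun setT (limpart f).
Proof.
move=> mf; apply: measurableT_comp => //.
by apply: measurable_fun_limn_esup => k; exact/measurable_EFinP.
Qed.

Let limpart_close (f : ('rV[R]_n -> R[i]) -> 'rV[R]_n -> R) x k : (G x < +oo)%E ->
  (forall v w, f (v \- w) x = f v x - f w x) ->
  (forall v, f v x ^+ 2 <= sqmod (v x)) ->
  (limpart f x - f (u k) x) ^+ 2 <= p ^+ k / (1 - p) * fine (G x).
Proof.
move=> Gx fB fs.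
have hG m : \sum_(j < m) (p ^+ j)^-1 * (f (u j.+1) x - f (u j) x) ^+ 2 <= fine (G x).
  rewrite -lee_fin fineK; last by rewrite ge0_fin_numE.
  apply: (@le_trans _ _ (\sum_(0 <= j < m) step j x)%E); last first.
    by apply: nneseries_lim_ge => j _ _; exact: step_ge0.
  rewrite sumEFin lee_fin big_mkord; apply: ler_sum => j _; apply: ler_wpM2l.
    by rewrite invr_ge0 exprn_ge0// ltW.
  by rewrite -fB; exact: fs.
have [c hc] := @weighted_steps_cvg R (fun j => f (u j) x) p _ p0 p1 hG.
have ce : (fun j => (f (u j) x)%:E) @ \oo --> (limn (fun j => f (u j) x))%:E.
  by apply: cvg_EFin => //; exact: nearW.
by rewrite /limpart (cvg_limn_einf_sup ce).2 /=; exact: hc.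
Qed.

Lemma riesz_fischer_weighted : exists v, L2 v /\ forall e : R, 0 < e ->
  exists N, forall k, (N <= k)%N -> ip0 (u k \- v) (u k \- v) <= e.
Proof.
have [C C0 hC] := integral_G; have q'0 : 0 < 1 - p by have := p1; lra.
pose v x : R[i] := limpart (@repart R n) x +i* limpart (@impart R n) x.
have mr : measurable_fun setT (repart v).
  by apply: measurable_limpart => k; exact: (measurable_L2 (Lu k)).1.
have mi : measurable_fun setT (impart v).
  by apply: measurable_limpart => k; exact: (measurable_L2 (Lu k)).2.
have msub k : measurable_fun setT (repart (u k \- v)) /\ measurable_fun setT (impart (u k \- v)).
  have [m1 m2] := measurable_L2 (Lu k); split.
    by rewrite re_sub; exact: measurable_funB.
  by rewrite im_sub; exact: measurable_funB.
have mG := measurable_G.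
have bound k : (\int[mu]_x (sqmod ((u k \- v) x))%:E <= (2 * (p ^+ k / (1 - p)) * C)%:E)%E.
  have c0 : 0 <= 2 * (p ^+ k / (1 - p)).
    by rewrite mulr_ge0// divr_ge0 ?(ltW q'0)// exprn_ge0// ltW.
  apply: (@le_trans _ _ (\int[mu]_x ((2 * (p ^+ k / (1 - p)))%:E * G x))%E); last first.
    by rewrite (ge0_integralZl mu measurableT mG)// [leRHS]EFinM; apply: lee_wpmul2l; rewrite ?lee_fin.
  apply: ge0_le_integral => //.
  - by move=> x _; rewrite lee_fin sqmod_ge0.
  - by apply/measurable_EFinP; have [m1 m2] := msub k; exact: measurable_sqmod.
  - exact: measurable_funeM.
  (* Where [G] is infinite the majorant is infinite, so the inequality holds at every point and no
     null set has to be removed. *)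
  move=> x _; have [Gx|] := boolP (G x < +oo)%E; last first.
    rewrite -leNgt leye_eq => /eqP ->; have [z|z] := eqVneq (2 * (p ^+ k / (1 - p))) 0.
      exfalso; move/eqP: z; rewrite mulf_eq0 pnatr_eq0/= gt_eqF// divr_gt0//.
      by rewrite exprn_gt0.
    by rewrite gt0_muley ?leey// lte_fin lt_neqAle eq_sym z.
  have h1 := limpart_close k Gx (fun v w => congr1 (@^~ x) (re_sub v w)) _.
  have h2 := limpart_close k Gx (fun v w => congr1 (@^~ x) (im_sub v w)) _.
  have GE : G x = (fine (G x))%:E by rewrite fineK// ge0_fin_numE.
  rewrite [X in (_ <= _ * X)%E]GE -EFinM lee_fin /sqmod.
  rewrite -/(repart (u k \- v) x) -/(impart (u k \- v) x) re_sub im_sub /=.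
  rewrite -(sqrrN (repart _ _ - _)) -(sqrrN (impart _ _ - _)) !opprB.
  have {}h1 := h1 _; have {}h2 := h2 _.
  rewrite -mulrA mulr2n mulrDl mul1r; apply: lerD.
    by apply: h1 => w; rewrite /sqmod lerDl sqr_ge0.
  by apply: h2 => w; rewrite /sqmod lerDr sqr_ge0.
have Ls k : L2 (u k \- v).
  have [m1 m2] := msub k; split => //.
  by rewrite -/(sqnorm _) sqnormE; exact: le_lt_trans (bound k) (ltry _).
exists v; split.
  have -> : v = u 0%N \- (u 0%N \- v) by apply/funext => x /=; ring.
  exact: L2_sub.
move=> e e0; have [N hN] := small_geometric (2 / (1 - p) * C) (ltW p0) p1 e0.
exists N => k Nk; rewrite -lee_fin -sqnorm_ip0// sqnormE; apply: (le_trans (bound k)).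
rewrite lee_fin; apply: le_trans (hN k Nk).
by rewrite le_eqVlt; apply/orP; left; apply/eqP; ring.
Qed.

End riesz_fischer.

Lemma riesz_fischer {R : realType} {n : nat} (u : nat -> 'rV[R]_n -> R[i]) (K q : R) :
  0 <= q -> q < 1 -> (forall k, L2 (u k)) ->
  (forall k, ip0 (u k.+1 \- u k) (u k.+1 \- u k) <= K * q ^+ k) ->
  exists v, L2 v /\ forall e : R, 0 < e ->
  exists N, forall k, (N <= k)%N -> ip0 (u k \- v) (u k \- v) <= e.
Proof.
move=> q0 q1 Lu uK; apply: (@riesz_fischer_weighted _ _ u K q ((1 + q) / 2)) => //; lra.
Qed.

(* L^2 modulo equality almost everywhere: one chosen representative per class. *)
Section representatives.
Context {R : realType} {n : nat}.
Implicit Types f g : 'rV[R]_n -> R[i].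

Lemma ae_and (A B : 'rV[R]_n -> Prop) : {ae lebesgue_rV, forall x, A x} ->
  {ae lebesgue_rV, forall x, B x} -> {ae lebesgue_rV, forall x, A x /\ B x}.
Proof. by apply: filterS2. Qed.

Lemma ae_impl (A B : 'rV[R]_n -> Prop) : {ae lebesgue_rV, forall x, A x} ->
  (forall x, A x -> B x) -> {ae lebesgue_rV, forall x, B x}.
Proof. by move=> h AB; apply: filterS h. Qed.

Definition canon f := xget (fun=> 0) [set g | L2 g /\ aeq g f].

Lemma canonP f : L2 f -> L2 (canon f) /\ aeq (canon f) f.
Proof.
move=> Lf; apply: (@xgetPex _ (fun=> 0) [set g | L2 g /\ aeq g f]).
by exists f; split => //; exact: aeq_refl.
Qed.

Lemma canon_eq f g : aeq f g -> canon f = canon g.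
Proof.
move=> fg; congr xget; apply/seteqP; split => h [Lh hf]; split => //.
  exact: aeq_trans hf fg.
exact: aeq_trans hf (aeq_sym fg).
Qed.

End representatives.

(** Fixed points of [canon]: functions equal almost everywhere are equal elements, and the module
    laws hold for plain equality. *)
Record L2space (R : realType) (n : nat) := MkL2space {
  L2val :> 'rV[R]_n -> R[i];
  L2val_L2 : L2 L2val;
  L2val_canon : canon L2val = L2val }.

HB.instance Definition _ (R : realType) (n : nat) := gen_eqMixin (L2space R n).
HB.instance Definition _ (R : realType) (n : nat) := gen_choiceMixin (L2space R n).

Section L2_space.
Local Open Scope complex_scope.
Context {R : realType} {n : nat}.
Implicit Types (f g : 'rV[R]_n -> R[i]) (x y z : L2space R n) (s t : R).

Lemma L2_ext x y : aeq x y -> x = y.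
Proof.
case: x y => [f Lf cf] [g Lg cg] /= /canon_eq; rewrite cf cg => fg.
by subst g; congr MkL2space; exact: Prop_irrelevance.
Qed.

(** The class map is total, with the class of 0 as default off L^2, and is kept opaque so that only
    [clsE] describes it. *)
Lemma cls_exists : {c : ('rV[R]_n -> R[i]) -> L2space R n | forall f, L2 f -> aeq (c f) f}.
Proof.
have c f : {x : L2space R n | L2 f -> aeq x f}.
  case: (pselect (L2 f)) => [Lf|nLf].
    by exists (MkL2space (canonP Lf).1 (canon_eq (canonP Lf).2)) => _; exact: (canonP Lf).2.
  by exists (MkL2space (canonP L2_0).1 (canon_eq (canonP L2_0).2)).
by exists (fun f => sval (c f)) => f; exact: (svalP (c f)).
Qed.

Definition cls := sval cls_exists.

Lemma clsE f : L2 f -> aeq (cls f) f.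
Proof. exact: (svalP cls_exists). Qed.

Lemma clsK x : cls x = x.
Proof. by apply: L2_ext; apply: clsE; exact: L2val_L2. Qed.

Definition L2add x y := cls (lincomb 1 x y).
Definition L2zero := cls (fun=> 0).
Definition L2opp x := cls (lincomb (-1) (fun=> 0) x).
Definition L2scale t x := cls (lincomb t (fun=> 0) x).

Lemma L2addE x y : aeq (L2add x y) (fun p => x p + y p).
Proof.
apply: aeq_trans (clsE _) _; first by apply: L2_lincomb; exact: L2val_L2.
by apply: (filterS _ filterT) => p _; rewrite /lincomb rmorph1 mul1r.
Qed.

Lemma L2zeroE : aeq L2zero (fun=> 0).
Proof. exact: clsE L2_0. Qed.

Lemma L2scaleE t x : aeq (L2scale t x) (fun p => t%:C * x p).
Proof.
apply: aeq_trans (clsE _) _; first by apply: L2_lincomb; [exact: L2_0|exact: L2val_L2].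
by apply: (filterS _ filterT) => p _; rewrite /lincomb add0r.
Qed.

Lemma L2oppE x : aeq (L2opp x) (fun p => - x p).
Proof.
apply: aeq_trans (clsE _) _; first by apply: L2_lincomb; [exact: L2_0|exact: L2val_L2].
by apply: (filterS _ filterT) => p _; rewrite /lincomb rmorphN1 mulN1r add0r.
Qed.

Fact L2addA : associative L2add.
Proof.
move=> x y z; apply: L2_ext.
by apply: ae_impl (ae_and (ae_and (L2addE x (L2add y z)) (L2addE y z))
  (ae_and (L2addE (L2add x y) z) (L2addE x y))) _ => p [[-> ->] [-> ->]]; rewrite addrA.
Qed.

Fact L2addC : commutative L2add.
Proof.
move=> x y; apply: L2_ext; by apply: ae_impl (ae_and (L2addE x y) (L2addE y x)) _ => p [-> ->]; rewrite addrC.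
Qed.

Fact L2add0 : left_id L2zero L2add.
Proof.
move=> x; apply: L2_ext; by apply: ae_impl (ae_and (L2addE L2zero x) L2zeroE) _ => p [-> ->]; rewrite add0r.
Qed.

Fact L2addN : left_inverse L2zero L2opp L2add.
Proof.
move=> x; apply: L2_ext.
by apply: ae_impl (ae_and (ae_and (L2addE (L2opp x) x) (L2oppE x)) L2zeroE) _ => p [[-> ->] ->]; rewrite addNr.
Qed.

HB.instance Definition _ := GRing.isZmodule.Build (L2space R n) L2addA L2addC L2add0 L2addN.

Lemma L2DE x y : aeq (x + y) (fun p => x p + y p).
Proof. exact: L2addE. Qed.

Lemma L2NE x : aeq (- x) (fun p => - x p).
Proof. exact: L2oppE. Qed.

Fact L2scaleA s t x : L2scale s (L2scale t x) = L2scale (s * t) x.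
Proof.
apply: L2_ext; by apply: ae_impl (ae_and (ae_and (L2scaleE s (L2scale t x)) (L2scaleE t x))
  (L2scaleE (s * t) x)) _ => p [[-> ->] ->]; rewrite rmorphM mulrA.
Qed.

Fact L2scale1 : left_id 1 L2scale.
Proof.
by move=> x; apply: L2_ext; have := L2scaleE 1 x; apply: filterS => p ->; rewrite rmorph1 mul1r.
Qed.

Fact L2scaleDr : right_distributive L2scale +%R.
Proof.
move=> s x y; apply: L2_ext.
by apply: ae_impl (ae_and (ae_and (L2scaleE s (x + y)) (L2DE x y))
  (ae_and (L2DE (L2scale s x) (L2scale s y)) (ae_and (L2scaleE s x) (L2scaleE s y)))) _ => p [[-> ->] [-> [-> ->]]]; rewrite mulrDr.
Qed.

Fact L2scaleDl x : {morph L2scale^~ x : s t / s + t}.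
Proof.
move=> s t; apply: L2_ext.
by apply: ae_impl (ae_and (L2scaleE (s + t) x)
  (ae_and (L2DE (L2scale s x) (L2scale t x)) (ae_and (L2scaleE s x) (L2scaleE t x)))) _ => p [-> [-> [-> ->]]]; rewrite rmorphD mulrDl.
Qed.

HB.instance Definition _ := GRing.Zmodule_isLmodule.Build R (L2space R n)
  L2scaleA L2scale1 L2scaleDr L2scaleDl.

Lemma L2ZE t x : aeq (t *: x) (fun p => t%:C * x p).
Proof. exact: L2scaleE. Qed.

Lemma L2lincombE t x y : aeq (y + t *: x) (lincomb t y x).
Proof.
by apply: ae_impl (ae_and (L2DE y (t *: x)) (L2ZE t x)) _ => p [-> ->].
Qed.

Lemma L2subE x y : aeq (x - y) (x \- y : 'rV[R]_n -> R[i]).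
Proof.
by apply: ae_impl (ae_and (L2DE x (- y)) (L2NE y)) _ => p [-> ->].
Qed.

Lemma L2lincomb t x y : cls (lincomb t y x) = y + t *: x.
Proof.
apply: L2_ext; apply: aeq_trans (clsE _) _; last exact: aeq_sym (L2lincombE t x y).
by apply: L2_lincomb; exact: L2val_L2.
Qed.

Definition ip x y : R := ip0 x y.

Lemma ipC x y : ip x y = ip y x.
Proof. exact: ip0C. Qed.

Lemma ip_cls f g : L2 f -> L2 g -> ip (cls f) (cls g) = ip0 f g.
Proof.
move=> Lf Lg; rewrite /ip (@ip0_aeq _ _ _ f)//; try exact: L2val_L2; last exact: clsE.
by rewrite ip0C (@ip0_aeq _ _ _ g)//; [exact: ip0C|exact: L2val_L2|exact: clsE].
Qed.

Lemma ip_linear t x y z : ip (t *: x + y) z = t * ip x z + ip y z.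
Proof.
have [Lx Ly Lz] := And3 (L2val_L2 x) (L2val_L2 y) (L2val_L2 z).
rewrite addrC -L2lincomb -(clsK z) ip_cls//; last exact: L2_lincomb.
by rewrite ip0_lincomb// addrC /ip clsK.
Qed.

Lemma ip_ge0 x : 0 <= ip x x.
Proof. exact: ip0_ge0. Qed.

Lemma ip_eq0 x : ip x x = 0 -> x = 0.
Proof.
move=> /(ip0_eq0 (L2val_L2 x)) h; apply: L2_ext; apply: aeq_trans h _.
exact: aeq_sym L2zeroE.
Qed.

Lemma L2space_complete : complete_nsq ip.
Proof.
move=> f K q q0 q1 fK; have Lf k := L2val_L2 (f k).
have subE x y : nsq ip (x - y) = ip0 (x \- y) (x \- y).
  have Ls := L2_sub (L2val_L2 x) (L2val_L2 y).
  rewrite /nsq -ip_cls//; congr (ip _ _); apply: L2_ext;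
    exact: aeq_trans (L2subE x y) (aeq_sym (clsE Ls)).
have [|v [Lv hv]] := @riesz_fischer _ _ (fun k => f k : 'rV[R]_n -> R[i]) K q q0 q1 Lf.
  by move=> k; rewrite -subE.
exists (cls v) => e e0; have [N hN] := hv e e0; exists N => k /hN.
have Ls := L2_sub (Lf k) Lv; rewrite -ip_cls//; congr (_ <= _).
have -> : cls (f k \- v) = f k - cls v; last by [].
apply: L2_ext; apply: aeq_trans (clsE Ls) _.
by apply: ae_impl (ae_and (L2subE (f k) (cls v)) (clsE Lv)) _ => p [-> /= ->].
Qed.

End L2_space.

(** * The operator and its resolvent *)

Section tends.
Context {R : realType}.
Implicit Types (f g : nat -> R) (A B t : R).

Definition tends f A := forall e : R, 0 < e -> exists N, forall k, (N <= k)%N -> `|f k - A| <= e.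

Lemma tends_unique f A B : tends f A -> tends f B -> A = B.
Proof.
move=> fA fB; apply/eqP; rewrite -subr_eq0 -normr_le0; apply/ler_addgt0Pr => e e0.
rewrite add0r; have e2 : 0 < e / 2 by rewrite divr_gt0.
have [N hN] := fA _ e2; have [N' hN'] := fB _ e2.
have h := hN _ (leq_maxl N N'); have h' := hN' _ (leq_maxr N N').
set k := maxn N N' in h h'; rewrite (_ : A - B = (f k - B) - (f k - A)); last by ring.
by rewrite [e]splitr; apply: le_trans (ler_normB _ _) _; apply: lerD.
Qed.

Lemma tends_ge0 f A : (forall k, 0 <= f k) -> tends f A -> 0 <= A.
Proof.
move=> f0 fA; apply/ler_addgt0Pr => e e0; have [N /(_ N (leqnn _))] := fA e e0.
by have := f0 N; rewrite ler_norml; lra.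
Qed.

Lemma tends_combine f g A B t c : tends f A -> tends g B ->
  tends (fun k => f k + t * g k + c) (A + t * B + c).
Proof.
move=> fA gB e e0; have t1 : 0 < `|t| + 1 by have := normr_ge0 t; lra.
have [N hN] := fA _ (divr_gt0 e0 (ltr0Sn R 1)).
have [N' hN'] := gB _ (divr_gt0 (divr_gt0 e0 (ltr0Sn R 1)) t1).
exists (maxn N N') => k; rewrite geq_max => /andP[/hN h1 /hN' h2].
rewrite (_ : _ - _ = (f k - A) + t * (g k - B)); last by ring.
rewrite [e]splitr; apply: le_trans (ler_normD _ _) _; apply: lerD => //.
rewrite normrM; rewrite ler_pdivlMr// in h2; apply: le_trans h2; rewrite mulrC.
by apply: ler_wpM2l => //; lra.
Qed.

End tends.

(** * Multiplication by complex constants *)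

Section constant_multiple.
Local Open Scope complex_scope.
Context {R : realType} {n : nat}.
Variables (a : 'rV[R]_n -> 'rV[R]_n) (V : 'rV[R]_n -> R).
Implicit Types (u v w f g : 'rV[R]_n -> R[i]) (t : R) (c : R[i]).
Local Notation mu := (@lebesgue_rV R n).

(** Multiplication by -i turns the imaginary parts of the form and of the inner product into real
    parts, the only ones seen by [hform] and [ip0]. *)
Definition cmul c u : 'rV[R]_n -> R[i] := fun x => c * u x.

Lemma re_cmul c u : repart (cmul c u) =
  fun x => complex.Re c * repart u x + (- complex.Im c) * impart u x.
Proof. by apply/funext => x; rewrite /repart /impart /cmul; case: c (u x) => p q [s t] /=; ring. Qed.

Lemma im_cmul c u : impart (cmul c u) =
  fun x => complex.Re c * impart u x + complex.Im c * repart u x.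
Proof. by apply/funext => x; rewrite /repart /impart /cmul; case: c (u x) => p q [s t] /=; ring. Qed.

Lemma test_cmul c u : test_function u -> test_function (cmul c u).
Proof.
move=> tu; have [r r0 hr] := test_support tu.
apply: (@test_closed_of_support _ _ _ r).
  split; apply/smooth_onP => k.
    rewrite -/(repart _) re_cmul; apply: (CkD openT); apply: (CkM openT); try exact: Ck_cst.
      exact: test_re.
    exact: test_im.
  rewrite -/(impart _) im_cmul; apply: (CkD openT); apply: (CkM openT); try exact: Ck_cst.
    exact: test_im.
  exact: test_re.
by move=> x /hr[h _ _]; rewrite /cmul h mulr0.
Qed.

Lemma mpart_cmul c u j x : test_function u ->
  mpart_re a j (cmul c u) x = complex.Re c * mpart_re a j u x - complex.Im c * mpart_im a j u x /\
  mpart_im a j (cmul c u) x = complex.Re c * mpart_im a j u x + complex.Im c * mpart_re a j u x.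
Proof.
move=> tu; rewrite /mpart_re /mpart_im re_cmul im_cmul.
have D (s t : R) (f g : 'rV[R]_n -> R) : (forall k, Ck k setT f) -> (forall k, Ck k setT g) ->
    'D_(basis_rV j) (fun x => s * f x + t * g x) x =
    s * 'D_(basis_rV j) f x + t * 'D_(basis_rV j) g x.
  move=> Cf Cg; have df : derivable f x (basis_rV j) := Ck_derivable (Cf 1%N) I.
  have dg : derivable g x (basis_rV j) := Ck_derivable (Cg 1%N) I.
  have dsf : derivable (s \*: f) x (basis_rV j) by exact: derivableZ.
  have dtg : derivable (t \*: g) x (basis_rV j) by exact: derivableZ.
  by rewrite [LHS](deriveD dsf dtg) [X in X + _]deriveZ// [X in _ + X]deriveZ.
rewrite !D; try by move=> k; first [exact: test_re|exact: test_im].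
by split; ring.
Qed.

Lemma cdotMl c (z z' : R[i]) : cdot (c * z) z' = cdot z (conjc c * z').
Proof. by rewrite /cdot; case: c z z' => p q [r s] [r' s'] /=; ring. Qed.

Lemma hform_cmul c u v : test_function u -> test_function v ->
  hform a V (cmul c u) v = hform a V u (cmul (conjc c) v).
Proof.
move=> tu tv; congr Rintegral; apply/funext => x; rewrite /form_density cdotMl; congr (_ + _).
apply: eq_bigr => j _; have [-> ->] := mpart_cmul c j x tu.
have [-> ->] := mpart_cmul (conjc c) j x tv; case: c => p q /=; ring.
Qed.

Lemma sqmodM c (z : R[i]) : sqmod (c * z) = sqmod c * sqmod z.
Proof. by rewrite /sqmod; case: c z => p q [r s] /=; ring. Qed.

Lemma L2_cmul c u : L2 u -> L2 (cmul c u).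
Proof.
move=> Lu; have [m1 m2] := measurable_L2 Lu; apply: L2P.
- by rewrite re_cmul; apply: measurable_funD; exact: measurable_funM.
- by rewrite im_cmul; apply: measurable_funD; exact: measurable_funM.
- under [X in mu.-integrable _ X]eq_fun do rewrite /cmul sqmodM EFinM.
  by apply: integrableZl => //; exact: integrable_sqmod.
Qed.

Lemma ip0_cmul c u v : ip0 (cmul c u) v = ip0 u (cmul (conjc c) v).
Proof. by congr Rintegral; apply/funext => x; exact: cdotMl. Qed.

End constant_multiple.

Section operator.
Local Open Scope complex_scope.
Context {R : realType} {n : nat}.
Variables (a : 'rV[R]_n -> 'rV[R]_n) (V : 'rV[R]_n -> R).
Implicit Types (u v w f g : 'rV[R]_n -> R[i]) (t r : R).
Local Notation mu := (@lebesgue_rV R n).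
Hypothesis ma : forall j, measurable_fun setT (fun x => a x ord0 j).
Hypothesis ba : forall r : R, exists A : R, forall j x, bbox r x -> `|a x ord0 j| <= A.
Hypothesis mV : measurable_fun setT V.
Hypothesis V0 : forall x, 0 <= V x.
Hypothesis iV : forall r : R, mu.-integrable (bbox r) (EFin \o V).
Local Notation hform := (hform a V).
Local Notation approximates := (form_approximates a V).
Local Notation T := (magnetic_schrodinger a V).

Lemma hform_cmul_self c u : test_function u -> hform (cmul c u) (cmul c u) = sqmod c * hform u u.
Proof.
move=> tu; have iu := integrable_form_density ma ba mV V0 iV tu tu.
rewrite /hform -RintegralZl//; congr Rintegral; apply/funext => x.
rewrite /form_density [RHS]mulrDr mulr_sumr; congr (_ + _).
  by apply: eq_bigr => j _; have [-> ->] := mpart_cmul a c j x tu; rewrite /sqmod; ring.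
by rewrite /cmul /cdot /sqmod; case: c (u x) => p q [r s] /=; ring.
Qed.

Lemma approximates_cmul c us u : approximates us u -> approximates (fun k => cmul c (us k)) (cmul c u).
Proof.
move=> [tu Lu cu hu].
have cB v w : cmul c v \- cmul c w = cmul c (v \- w).
  by apply/funext => x; rewrite /cmul /= mulrBr.
split.
- by move=> k; exact: test_cmul.
- exact: L2_cmul.
- have -> : (fun k => sqnorm (cmul c (us k) \- cmul c u)) =
      (fun k => (sqmod c)%:E * sqnorm (us k \- u)%R)%E.
    apply/funext => k; rewrite cB !sqnormE.
    have Ls : L2 (us k \- u) by apply: L2_sub => //; exact: L2_test.
    have [m1 m2] := measurable_L2 Ls.
    have ms : measurable_fun setT (fun x => (sqmod ((us k \- u) x))%:E).
      by apply/measurable_EFinP; exact: measurable_sqmod.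
    rewrite -(ge0_integralZl mu measurableT ms); first last.
    + by rewrite lee_fin sqmod_ge0.
    + by move=> x _; rewrite lee_fin sqmod_ge0.
    by apply: eq_integral => x _; rewrite /cmul sqmodM EFinM.
  by rewrite -(mule0 (sqmod c)%:E); apply: cvgeZl.
- move=> e e0; have c0 := sqmod_ge0 c; have c1 : 0 < sqmod c + 1 by lra.
  have [N hN] := hu _ (divr_gt0 e0 c1); exists N => k l Nk Nl.
  have := hN k l Nk Nl; rewrite !Re_magnetic_form cB hform_cmul_self; last exact: test_sub.
  rewrite ltr_pdivlMr//; apply: le_lt_trans; rewrite mulrC; apply: ler_wpM2l; last by lra.
  exact: hform_ge0.
Qed.

Lemma approximates_test u : test_function u -> approximates (fun=> u) u.
Proof.
move=> tu.
have u0 : u \- u = fun=> 0 by apply/funext => x /=; rewrite subrr.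
split => //; first exact: L2_test.
  rewrite u0 (_ : sqnorm _ = 0)%E; first exact: cvg_cst.
  rewrite sqnormE; apply: integral0_eq => x _; by rewrite /sqmod /= expr0n /= addr0.
move=> e e0; exists 0%N => k l _ _; rewrite Re_magnetic_form sub_lincomb hform_sqr_lincomb//.
by apply: le_lt_trans e0; rewrite le_eqVlt; apply/orP; left; apply/eqP; ring.
Qed.

Lemma Re_le_normc (z : R[i]) : `|complex.Re z| <= Normc.normc z.
Proof.
have n0 : 0 <= Normc.normc z by case: z => p q; exact: sqrtr_ge0.
rewrite -(@ler_pXn2r _ 2)// real_normK ?num_real// normc_sqr /sqmod.
by rewrite lerDl sqr_ge0.
Qed.

(** By [form_limit_unique], (f, v) is the limit of the form along any approximating sequences.
    Symmetry, positivity and Cauchy-Schwarz for the operator are then limits of the same facts for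
    test functions. *)
Lemma T_pairing u f v us vs : T u f -> approximates us u -> approximates vs v ->
  tends (fun k => hform (us k) (vs k)) (ip0 f v).
Proof.
move=> [_ Lf cf] au av e e0; have e2 : 0 < e / 2 by rewrite divr_gt0.
have [|us' [vs' [au' av' c]]] := cf v; first by exists vs.
have /cvgrPdist_lt/(_ _ e2)[N _ hN] := c.
have [N' hN'] := form_limit_unique ma ba mV V0 iV au au' av av' e2.
exists (maxn N N') => k; rewrite geq_max => /andP[/hN/= h1 /hN' h2].
rewrite sub0r normrN in h1.
have h3 : `|hform (us' k) (vs' k) - ip0 f v| <= e / 2.
  rewrite -(Re_magnetic_form a V) -Re_inner.
  have -> : complex.Re (magnetic_form a V (us' k) (vs' k)) - complex.Re (inner f v) =
    complex.Re (magnetic_form a V (us' k) (vs' k) - inner f v).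
    by case: (magnetic_form _ _ _ _) => p q; case: (inner _ _).
  apply: (le_trans (Re_le_normc _)); apply: (le_trans (ler_norm _)); exact: ltW.
rewrite (_ : _ - ip0 f v = (hform (us k) (vs k) - hform (us' k) (vs' k)) +
  (hform (us' k) (vs' k) - ip0 f v)); last by ring.
by rewrite [e]splitr; apply: (le_trans (ler_normD _ _)); exact: lerD.
Qed.

Lemma T_dom u f : T u f -> exists us, approximates us u.
Proof. by case. Qed.

Lemma T_L2 u f : T u f -> L2 u /\ L2 f.
Proof. by move=> [[us [_ Lu _ _]] Lf _]. Qed.

Lemma T_symmetric u f w g : T u f -> T w g -> ip0 f w = ip0 g u.
Proof.
move=> Tu Tw; have [us au] := T_dom Tu; have [ws aw] := T_dom Tw.
apply: tends_unique (T_pairing Tu au aw) _ => e e0.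
by have [N hN] := T_pairing Tw aw au e0; exists N => k /hN; rewrite hformC.
Qed.

(** The constant is moved from f to u through the form; this handles complex multiples of an
    eigenfunction in a real inner product. *)
Lemma T_symmetric_cmul c u f w g : T u f -> T w g -> ip0 (cmul c f) w = ip0 g (cmul c u).
Proof.
move=> Tu Tw; have [us au] := T_dom Tu; have [ws aw] := T_dom Tw.
have [tu _ _ _] := au; have [tw _ _ _] := aw.
rewrite ip0_cmul; apply: tends_unique (T_pairing Tu au (approximates_cmul (conjc c) aw)) _ => e e0.
have [N hN] := T_pairing Tw aw (approximates_cmul c au) e0; exists N => k /hN.
by rewrite hformC hform_cmul.
Qed.

Lemma T_ge0 u f : T u f -> 0 <= ip0 f u.
Proof.
move=> Tu; have [us au] := T_dom Tu; apply: tends_ge0 (T_pairing Tu au au) => k.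
exact: hform_ge0.
Qed.

(** Cauchy-Schwarz for the closed form, with h(u, v) = (f, v) and h(u, u) = (f, u). *)
Lemma T_cauchy_schwarz u f v : T u f -> test_function v ->
  ip0 f v ^+ 2 <= ip0 f u * hform v v.
Proof.
move=> Tu tv; have [us au] := T_dom Tu; have [tu _ _ _] := au.
apply: quadratic_ge0_discriminant; first exact: hform_ge0.
move=> t; apply: tends_ge0 (tends_combine (2 * t) (t ^+ 2 * hform v v) (T_pairing Tu au au)
  (T_pairing Tu au (approximates_test tv))) => k.
by rewrite -hform_sqr_lincomb//; exact: hform_ge0.
Qed.

Lemma Im_inner f v : complex.Im (inner f v) = ip0 (cmul (0 -i* 1) f) v.
Proof.
rewrite /inner /Cintegral /ip0 /=; congr Rintegral; apply/funext => x.
by rewrite /cmul /cdot; case: (f x) => p q; case: (v x) => p' q' /=; ring.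
Qed.

Lemma T_aeq u f g : T u f -> L2 g -> aeq f g -> T u g.
Proof.
move=> [Du Lf cf] Lg fg; split => // v Dv.
have [us [_ Lv _ _]] := Dv.
suff -> : inner g v = inner f v by exact: cf.
apply/eqP; rewrite eq_complex !Re_inner !Im_inner (@ip0_aeq _ _ g f)//; last exact: aeq_sym.
rewrite (@ip0_aeq _ _ (cmul _ g) (cmul (0 -i* 1) f)) ?eqxx//; try exact: L2_cmul.
by apply: ae_impl fg _ => x; rewrite /cmul => ->.
Qed.

End operator.

Section ip0_lemmas.
Local Open Scope complex_scope.
Context {R : realType} {n : nat}.
Implicit Types (u v w f g : 'rV[R]_n -> R[i]) (t : R) (c : R[i]) (x y : L2space R n).

Lemma realC_neq0 t : t != 0 -> t%:C != 0 :> R[i].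
Proof. by move=> t0; rewrite eq_complex /= eqxx andbT. Qed.

Lemma ip0B u v w : L2 u -> L2 v -> L2 w -> ip0 (u \- v) w = ip0 u w - ip0 v w.
Proof. by move=> Lu Lv Lw; rewrite sub_lincomb ip0_lincomb// mulN1r. Qed.

Lemma ip0_real t u v : L2 u -> L2 v -> ip0 (cmul t%:C u) v = t * ip0 u v.
Proof.
move=> Lu Lv; rewrite /ip0 -RintegralZl//; last exact: integrable_cdot.
by congr Rintegral; apply/funext => x; rewrite /cmul /cdot; case: (u x) => p q /=; ring.
Qed.

Lemma ip_clsl f y : L2 f -> ip (cls f) y = ip0 f y.
Proof. by move=> Lf; rewrite -[in LHS](clsK y) ip_cls//; exact: L2val_L2. Qed.

(** c_k e_k = Re(c_k) e_k + Im(c_k) (i e_k): complex combinations of the e_k are real ones of the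
    e_k and i e_k. *)
Lemma ip0_sum N (e : 'I_N -> 'rV[R]_n -> R[i]) (c : 'I_N -> R[i]) v :
  (forall k, L2 (e k)) -> L2 v -> L2 (fun p => \sum_(k < N) c k * e k p) /\
  ip0 (fun p => \sum_(k < N) c k * e k p) v =
  \sum_(k < N) (complex.Re (c k) * ip0 (cmul 1 (e k)) v +
                complex.Im (c k) * ip0 (cmul (0 +i* 1) (e k)) v).
Proof.
elim: N e c => [|N IH] e c Le Lv.
  rewrite (_ : (fun p => _) = fun=> 0); last by apply/funext => p; rewrite big_ord0.
  split; first exact: L2_0.
  rewrite big_ord0 (_ : (fun=> 0) = v \- v); first by rewrite ip0B// subrr.
  by apply/funext => p /=; rewrite subrr.
have [LS ES] := IH (fun k => e (widen_ord (leqnSn N) k)) (fun k => c (widen_ord (leqnSn N) k))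
  (fun k => Le _) Lv.
set S := fun p => _ in LS ES.
rewrite (_ : (fun p => _) = lincomb (complex.Im (c ord_max))
  (lincomb (complex.Re (c ord_max)) S (cmul 1 (e ord_max))) (cmul (0 +i* 1) (e ord_max))); last first.
  apply/funext => p; rewrite big_ord_recr /= /lincomb /cmul /S -addrA; congr (_ + _).
  by case: (c ord_max) (e ord_max p) => r s [r' s']; apply/eqP; rewrite eq_complex /=;
    apply/andP; split; apply/eqP; ring.
have L1 := L2_cmul 1 (Le ord_max); have L2 := L2_cmul (0 +i* 1) (Le ord_max).
have L3 := L2_lincomb (complex.Re (c ord_max)) LS L1.
split; first exact: L2_lincomb.
by rewrite ip0_lincomb// ip0_lincomb// ES big_ord_recr /= addrA.
Qed.

End ip0_lemmas.

(** * The resolvent at -1 *)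

Section resolvent.
Local Open Scope complex_scope.
Context {R : realType} {n : nat}.
Variables (a : 'rV[R]_n -> 'rV[R]_n) (V : 'rV[R]_n -> R).
Implicit Types (u v w f g : 'rV[R]_n -> R[i]) (t : R) (x y : L2space R n).
Local Notation mu := (@lebesgue_rV R n).
Hypothesis ma : forall j, measurable_fun setT (fun x : 'rV[R]_n => a x ord0 j).
Hypothesis ba : forall r : R, exists A : R, forall j (x : 'rV[R]_n), bbox r x -> `|a x ord0 j| <= A.
Hypothesis mV : measurable_fun setT V.
Hypothesis V0 : forall x : 'rV[R]_n, 0 <= V x.
Hypothesis iV : forall r : R, mu.-integrable (bbox r) (EFin \o V).
Local Notation hform := (hform a V).
Local Notation T := (magnetic_schrodinger a V).

(** A point of a discrete spectrum is an eigenvalue, and T u = - u with T >= 0 forces u = 0. *)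
Lemma minus1_resolvent : discrete_spectrum T -> in_resolvent_set T (-1).
Proof.
move=> hd; apply: contrapT => /hd[_ [u [Tu u0]] _]; apply: u0.
have [Lu _] := T_L2 Tu; apply: ip0_eq0 => //.
have := T_ge0 ma ba mV V0 iV Tu.
have -> : ip0 (fun x : 'rV[R]_n => -1 * u x) u = - ip0 u u.
  transitivity (-1 * ip0 u u); last by rewrite mulN1r.
  by rewrite -(ip0_real (-1) Lu Lu); congr ip0; apply/funext => p; rewrite /cmul rmorphN1.
by rewrite oppr_ge0 => h; apply/eqP; rewrite eq_le h ip0_ge0.
Qed.

Lemma resolvent_exists : in_resolvent_set T (-1) ->
  exists (r : L2space R n -> 'rV[R]_n -> R[i]) (C : R), [/\ 0 <= C,
    forall x, T (r x) (x \- r x) & forall x, ip0 (r x) (r x) <= C * ip x x].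
Proof.
move=> [C hC].
have /choice[r hr] : forall x : L2space R n, exists u, T u (x \- u) /\ ip0 u u <= `|C| * ip x x.
  move=> x; have [u [Tu uC _]] := hC x (L2val_L2 x).
  have {}Tu : T u (x \- u).
    rewrite (_ : x \- u = fun p => x p + -1 * u p)//.
    by apply/funext => p /=; rewrite mulN1r.
  exists u; split => //; have [Lu _] := T_L2 Tu.
  move: uC; rewrite !sqnorm_ip0//; last exact: L2val_L2.
  rewrite -EFinM lee_fin => /le_trans; apply; apply: ler_wpM2r (ler_norm C).
  exact: ip0_ge0.
exists r, `|C|; split => // x; exact: (hr x).1 || exact: (hr x).2.
Qed.

Variables (r : L2space R n -> 'rV[R]_n -> R[i]) (C : R).
Hypothesis Tr : forall x, T (r x) (x \- r x).
Hypothesis rC : forall x, ip0 (r x) (r x) <= C * ip x x.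

(** B = (H + 1)^-1 on classes: [Tr] says that H (r x) = x - r x. *)
Definition resB x : L2space R n := cls (r x).

Lemma L2_res x : L2 (r x).
Proof. exact: (T_L2 (Tr x)).1. Qed.

Lemma resBl x y : ip (resB x) y = ip0 (r x) y.
Proof. by rewrite ip_clsl//; exact: L2_res. Qed.

Lemma nsq_resB x : nsq ip (resB x) = ip0 (r x) (r x).
Proof. by rewrite /nsq ip_cls//; exact: L2_res. Qed.

Lemma resB_sym x y : ip (resB x) y = ip x (resB y).
Proof.
rewrite (ipC x) !resBl.
have := T_symmetric ma ba mV V0 iV (Tr x) (Tr y).
have [Lx Ly] := (L2val_L2 x, L2val_L2 y); have [Lrx Lry] := (L2_res x, L2_res y).
rewrite !ip0B// (ip0C (r y) (r x)) (ip0C (r x) y) (ip0C (r y) x) => h; lra.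
Qed.

(** The difference of the two sides is (H B x, B x) >= 0. *)
Lemma resB_le x : nsq ip (resB x) <= ip (resB x) x.
Proof.
rewrite nsq_resB resBl; have := T_ge0 ma ba mV V0 iV (Tr x).
rewrite ip0B//; [|exact: L2val_L2|exact: L2_res|exact: L2_res].
by rewrite (ip0C x); lra.
Qed.

Lemma resB_ge0 x : 0 <= ip (resB x) x.
Proof. exact: le_trans (ip_ge0 _) (resB_le x). Qed.

Lemma resB_bounded x : nsq ip (resB x) <= C * nsq ip x.
Proof. by rewrite nsq_resB. Qed.

(** Put N = |v|^2, b = (B v, v), U = |B v|^2. As H B v = v - B v, Cauchy-Schwarz for the form gives
    (N - b)^2 <= (b - U) h(v, v) <= (b - U) K N, and b^2 <= U N turns this into (N - b)^2 <= K b (N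
    - b). If N > b, then N - b <= K b. *)
Lemma resB_test_lower v (K : R) : test_function v -> 0 <= K -> hform v v <= K * ip0 v v ->
  (1 + K)^-1 * nsq ip (cls v) <= ip (resB (cls v)) (cls v).
Proof.
move=> tv K0 hK; set x := cls v; have Lv := L2_test tv; have Lr := L2_res x.
have Lx := L2val_L2 x; have xv : aeq x v := clsE Lv.
have := T_cauchy_schwarz ma ba mV V0 iV (Tr x) tv.
have -> : ip0 (x \- r x) v = nsq ip x - ip (resB x) x.
  rewrite ip0B// resBl (ip0C (r x)) (ip0C (r x)) (ip0_aeq Lx Lv Lr xv); congr (_ - _).
  by rewrite /nsq /ip (ip0_aeq Lx Lv Lx xv) (ip0C v) .
have -> : ip0 (x \- r x) (r x) = ip (resB x) x - nsq ip (resB x).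
  by rewrite ip0B// nsq_resB resBl (ip0C x).
have hv : hform v v <= K * nsq ip x by rewrite /nsq ip_cls.
have h1 := resB_le x.
have h2 : ip (resB x) x ^+ 2 <= nsq ip (resB x) * nsq ip x.
  by apply: (cauchy_schwarz ipC ip_linear ip_ge0).
have N0 : 0 <= nsq ip x := ip_ge0 x; have U0 : 0 <= nsq ip (resB x) := ip_ge0 _.
move: (nsq ip x) (ip (resB x) x) (nsq ip (resB x)) (hform v v) hv h1 h2 N0 U0 => N b U H hH h1 h2 N0 U0 h3.
rewrite ler_pdivrMl; last by lra.
rewrite leNgt; apply/negP => lt; have b0 : 0 <= b by lra.
have Nb : 0 < N - b by have := mulr_ge0 K0 b0; lra.
have h4 : (N - b) ^+ 2 <= K * b * (N - b).
  apply: (le_trans h3); apply: (@le_trans _ _ ((b - U) * (K * N))).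
    by apply: ler_wpM2l => //; lra.
  have := ler_wpM2l K0 h2; rewrite !expr2; lra.
rewrite expr2 ler_pM2r// in h4; lra.
Qed.

(** For y = B x - k x, eliminating x from H B x = x - B x gives (H - (1 / k - 1)) B x = - y / k.
    Hence |B x| is controlled by |y|, and so is k x = B x - y. *)
Lemma resB_bounded_below (k : R) : 0 < k -> in_resolvent_set T (k^-1 - 1)%:C ->
  bounded_below ip (fun x => resB x - k *: x).
Proof.
move=> k0 [C' hC']; pose D := 2 * (`|C'| * (k ^+ 2)^-1) + 2.
have D0 : 0 < D by rewrite ltr_wpDl// mulr_ge0// mulr_ge0// invr_ge0 sqr_ge0.
exists (k ^+ 2 / D); first by rewrite divr_gt0// exprn_gt0.
move=> x; set y := resB x - k *: x.
have kC0 : k%:C != 0 :> R[i] by rewrite realC_neq0// gt_eqF.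
have Ly := L2val_L2 y; have Lr := L2_res x; have Lx := L2val_L2 x.
pose g := cmul (- k^-1)%:C y; have Lg : L2 g by exact: L2_cmul.
have Tg : T (r x) (fun p => g p + (k^-1 - 1)%:C * r x p).
  apply: T_aeq (Tr x) (L2_lincomb _ Lg Lr) _.
  apply: ae_impl (ae_and (clsE Lr) (ae_and (L2subE (resB x) (k *: x)) (L2ZE k x))) _ => p [e1 [e2 e3]].
  rewrite /lincomb /g /cmul -/(y : 'rV[R]_n -> R[i]) e2 /= e3 e1 rmorphN rmorphB rmorph1 fmorphV /=.
  by field.
have [u0 [Tu0 u0C uniq]] := hC' g Lg; have Lu0 := (T_L2 Tu0).1.
have bu : nsq ip (resB x) <= `|C'| * ((k ^+ 2)^-1 * nsq ip y).
  have au := uniq _ Tg; rewrite nsq_resB (ip0_aeq Lr Lu0 Lr au) ip0C (ip0_aeq Lr Lu0 Lu0 au).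
  move: u0C; rewrite !sqnorm_ip0// -EFinM lee_fin => h.
  have -> : (k ^+ 2)^-1 * nsq ip y = ip0 g g.
    rewrite /g ip0_real//.
    by rewrite (ip0C y) ip0_real// /nsq /ip mulrA mulrNN -expr2 exprVn.
  apply: (le_trans h); apply: ler_wpM2r (ler_norm C'); exact: ip0_ge0.
have kx : k *: x = resB x + (- y) by rewrite /y opprB addrCA subrr addr0.
have h1 : k ^+ 2 * nsq ip x <= 2 * nsq ip (resB x) + 2 * nsq ip y.
  rewrite -(nsqZ ipC ip_linear) kx; apply: (le_trans (nsqD_le ipC ip_linear ip_ge0 _ _)).
  by rewrite (nsqN ipC ip_linear).
rewrite mulrAC ler_pdivrMr//; apply: (le_trans h1); rewrite /D; lra.
Qed.

Lemma resB_eigen (k : R) c e : 0 < k -> eigenfunction T (k^-1 - 1)%:C e ->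
  resB (cls (cmul c e)) = k *: cls (cmul c e).
Proof.
move=> k0 Te; have Le := (T_L2 Te).1; have Lce := L2_cmul c Le.
apply: (ip_inj ip_linear ip_eq0) => y; rewrite (ipZl ip_linear).
rewrite resB_sym (ip_clsl _ Lce) (ip_clsl _ Lce) /resB.
have Ly := L2val_L2 y; have Lr := L2_res y.
rewrite ip0C (ip0_aeq (L2val_L2 _) Lr Lce (clsE Lr)).
have := T_symmetric_cmul ma ba mV V0 iV c Te (Tr y).
have -> : cmul c (fun x : 'rV[R]_n => (k^-1 - 1)%:C * e x) = cmul (k^-1 - 1)%:C (cmul c e).
  by apply/funext => p; rewrite /cmul mulrCA.
rewrite ip0_real// ip0B// (ip0C (cmul c e)) (ip0C y) => h.
have h2 : k^-1 * ip0 (r y) (cmul c e) = ip0 (cmul c e) y by lra.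
by rewrite -h2 mulVKf// gt_eqF.
Qed.

Lemma resB_eigen_conv (k : R) x : 0 < k -> resB x = k *: x ->
  eigenfunction T (k^-1 - 1)%:C (r x).
Proof.
move=> k0 Bx; have Lr := L2_res x; have Lx := L2val_L2 x.
have kC0 : k%:C != 0 :> R[i] by rewrite realC_neq0// gt_eqF.
apply: T_aeq (Tr x) (L2_cmul _ Lr) _.
have h := clsE Lr; rewrite -/(resB x) Bx in h.
apply: ae_impl (ae_and h (L2ZE k x)) _ => p [e1 e2].
rewrite /cmul /= -e1 e2 rmorphB rmorph1 fmorphV /=; by field.
Qed.

(** The number k corresponds to the point 1 / k - 1 for H, continuously in k > 0, and B x = k x
    makes B x an eigenfunction there; isolation and finite multiplicity carry over. *)
Lemma resB_dichotomy : discrete_spectrum T -> forall k : R, 0 < k ->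
  bounded_below ip (fun x => resB x - k *: x) \/
  (exists2 s : R, 0 < s & forall z : R, z != 0 -> `|z| < s ->
    bounded_below ip (fun x => resB x - (k + z) *: x)) /\
  exists E : seq (L2space R n), (forall e, e \in E -> resB e = k *: e) /\
    forall x, resB x = k *: x -> (forall e, e \in E -> ip e x = 0) -> x = 0.
Proof.
move=> hd k k0; have [res|spec] := pselect (in_resolvent_set T (k^-1 - 1)%:C).
  by left; exact: resB_bounded_below.
right; have [[s s0 hs] _ [N [e [he hspan]]]] := hd _ spec; split.
  (* The first bound gives k + z > k / 2, the second then |1 / (k + z) - 1 / k| = |z| / (k (k + z))
     < s. *)
  exists (Num.min (k / 2) (s * k ^+ 2 / 2)).
    by rewrite lt_min !divr_gt0// mulr_gt0// exprn_gt0.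
  move=> z z0; rewrite lt_min => /andP[zk zs].
  have kz : k / 2 < k + z by move: zk; rewrite ltr_norml; lra.
  have kz0 : 0 < k + z by lra.
  apply: resB_bounded_below => //; apply: contrapT => spec'.
  have E : (k + z)^-1 - 1 - (k^-1 - 1) = - z / (k * (k + z)).
    by field; rewrite !gt_eqF.
  have ne : ((k + z)^-1 - 1)%:C != (k^-1 - 1)%:C :> R[i].
    rewrite -subr_eq0 -rmorphB E realC_neq0// mulf_neq0 ?oppr_eq0//.
    by rewrite invr_neq0// mulf_neq0// gt_eqF.
  have := hs _ spec' ne; rewrite -rmorphB E; apply/negP; rewrite -ltNge.
  rewrite /Normc.normc /= expr0n addr0 sqrtr_sqr normrM normrN normfV.
  rewrite (ger0_norm (x := k * _)); last by rewrite mulr_ge0 ?ltW.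
  rewrite ltr_pdivrMr ?mulr_gt0//; apply: (lt_le_trans zs).
  have := ltW kz; have := mulr_gt0 s0 k0 => sk0 h.
  have := ler_wpM2l (ltW sk0) h; rewrite expr2; lra.
(* Generators over the reals: the e_i together with the i e_i. *)
exists ([seq cls (cmul 1 (e i)) | i <- enum 'I_N] ++ [seq cls (cmul (0 +i* 1) (e i)) | i <- enum 'I_N]).
split.
  move=> y; rewrite mem_cat => /orP[] /mapP[i _ ->]; exact: resB_eigen.
move=> x Bx orth; have [c hc] := hspan _ (resB_eigen_conv k0 Bx).
have Lr := L2_res x; have Lx := L2val_L2 x.
have Le i : L2 (e i) by exact: (T_L2 (he i)).1.
have [LS ES] := ip0_sum c Le Lx.
apply: ip_eq0; apply: (mulfI (lt0r_neq0 k0)); rewrite mulr0 -(ipZl ip_linear) -Bx resBl.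
rewrite (ip0_aeq Lr LS Lx hc) ES big1// => i _.
rewrite -!ip_clsl//; try exact: L2_cmul.
rewrite !orth ?mulr0 ?addr0//; rewrite mem_cat; apply/orP.
  by right; apply/mapP; exists i; rewrite ?mem_enum.
by left; apply/mapP; exists i; rewrite ?mem_enum.
Qed.

End resolvent.

Lemma discrete_no_bounded_forms {R : realType} {n : nat}
    (a : 'rV[R]_n -> 'rV[R]_n) (V : 'rV[R]_n -> R) (K : R) :
  (forall j, measurable_fun setT (fun x => a x ord0 j)) ->
  (forall r : R, exists A : R, forall j (x : 'rV[R]_n), bbox r x -> `|a x ord0 j| <= A) ->
  measurable_fun setT V -> (forall x, 0 <= V x) ->
  (forall r : R, lebesgue_rV.-integrable (bbox r) (EFin \o V)) ->
  discrete_spectrum (magnetic_schrodinger a V) -> 0 <= K ->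
  (forall E : seq (L2space R n), exists v, [/\ test_function v, 0 < ip0 v v,
    hform a V v v <= K * ip0 v v & forall e, e \in E -> ip e (cls v) = 0]) -> False.
Proof.
move=> ma ba mV V0 iV hd K0 hE.
have [r [C [C0 Tr rC]]] := resolvent_exists (minus1_resolvent ma ba mV V0 iV hd).
apply: (@no_bounded_form_subspaces _ _ (@ip R n) ipC ip_linear ip_ge0 ip_eq0 (resB r) C (1 + K)^-1).
- exact: L2space_complete.
- exact: (resB_sym ma ba mV V0 iV Tr).
- exact: (resB_ge0 ma ba mV V0 iV Tr).
- exact: C0.
- exact: (resB_bounded Tr rC).
- by rewrite invr_gt0; lra.
- exact: (resB_dichotomy ma ba mV V0 iV Tr hd).
move=> E; have [v [tv v0 hv orth]] := hE E; exists (cls v).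
  apply/eqP => v00; have := v0; rewrite -ip_cls; try exact: L2_test.
  by rewrite v00 (ip0l ip_linear) ltxx.
by split => //; exact: (resB_test_lower ma ba mV V0 iV Tr).
Qed.

(** * Cubes going to infinity *)

Section combinations.
Local Open Scope complex_scope.
Context {R : realType} {n : nat}.
Variables (a : 'rV[R]_n -> 'rV[R]_n) (V : 'rV[R]_n -> R).
Local Notation mu := (@lebesgue_rV R n).
Hypothesis ma : forall j, measurable_fun setT (fun x : 'rV[R]_n => a x ord0 j).
Hypothesis ba : forall r : R, exists A : R, forall j (x : 'rV[R]_n), bbox r x -> `|a x ord0 j| <= A.
Hypothesis mV : measurable_fun setT V.
Hypothesis V0 : forall x : 'rV[R]_n, 0 <= V x.
Hypothesis iV : forall r : R, mu.-integrable (bbox r) (EFin \o V).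
Local Notation hform := (hform a V).
Variables (t : nat -> R) (phi : nat -> 'rV[R]_n -> R[i]).
Hypothesis tphi : forall k, test_function (phi k).

Definition comb N : 'rV[R]_n -> R[i] := fun x => \sum_(i < N) (t i)%:C * phi i x.

Lemma comb0 : comb 0 = fun=> 0.
Proof. by apply/funext => x; rewrite /comb big_ord0. Qed.

Lemma combS N : comb N.+1 = lincomb (t N) (comb N) (phi N).
Proof. by apply/funext => x; rewrite /comb big_ord_recr. Qed.

Lemma test_comb N : test_function (comb N).
Proof.
by elim: N => [|N IH]; [rewrite comb0; exact: test0|rewrite combS; exact: test_lincomb].
Qed.

Lemma hform_comb v N : test_function v -> hform (comb N) v = \sum_(i < N) t i * hform (phi i) v.
Proof.
move=> tv; elim: N => [|N IH].
  rewrite big_ord0 comb0 (_ : (fun=> 0) = lincomb (-1) v v).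
    by rewrite (hform_lincomb ma ba mV V0 iV)// mulN1r subrr.
  by rewrite -sub_lincomb; apply/funext => x /=; rewrite subrr.
rewrite combS (hform_lincomb ma ba mV V0 iV)//; last exact: test_comb.
by rewrite IH big_ord_recr.
Qed.

Lemma ip0_comb v N : L2 v -> ip0 (comb N) v = \sum_(i < N) t i * ip0 (phi i) v.
Proof.
move=> Lv; elim: N => [|N IH].
  rewrite big_ord0 comb0 (_ : (fun=> 0) = v \- v); first by rewrite ip0B// subrr.
  by apply/funext => x /=; rewrite subrr.
rewrite combS ip0_lincomb//; [|exact: L2_test (test_comb N)|exact: L2_test].
by rewrite IH big_ord_recr.
Qed.

Hypothesis horth : forall i j, i != j -> hform (phi i) (phi j) = 0.
Hypothesis iorth : forall i j, i != j -> ip0 (phi i) (phi j) = 0.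

Lemma hform_comb_diag N : hform (comb N) (comb N) = \sum_(i < N) t i ^+ 2 * hform (phi i) (phi i).
Proof.
rewrite hform_comb; last exact: test_comb.
apply: eq_bigr => i _; rewrite hformC hform_comb// (bigD1 i)//= big1 ?addr0 => [|j ji].
  by rewrite expr2 mulrA.
by rewrite horth// mulr0.
Qed.

Lemma ip0_comb_diag N : ip0 (comb N) (comb N) = \sum_(i < N) t i ^+ 2 * ip0 (phi i) (phi i).
Proof.
rewrite ip0_comb; last exact: L2_test (test_comb N).
apply: eq_bigr => i _; rewrite ip0C ip0_comb; last exact: L2_test.
rewrite (bigD1 i)//= big1 ?addr0 => [|j ji]; first by rewrite expr2 mulrA.
by rewrite iorth// mulr0.
Qed.

End combinations.

Section orthogonal_sequence.
Local Open Scope complex_scope.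
Context {R : realType} {n : nat}.
Variables (a : 'rV[R]_n -> 'rV[R]_n) (V : 'rV[R]_n -> R).
Local Notation mu := (@lebesgue_rV R n).
Hypothesis ma : forall j, measurable_fun setT (fun x : 'rV[R]_n => a x ord0 j).
Hypothesis ba : forall r : R, exists A : R, forall j (x : 'rV[R]_n), bbox r x -> `|a x ord0 j| <= A.
Hypothesis mV : measurable_fun setT V.
Hypothesis V0 : forall x : 'rV[R]_n, 0 <= V x.
Hypothesis iV : forall r : R, mu.-integrable (bbox r) (EFin \o V).
Local Notation hform := (hform a V).

(* N functions and N - 1 linear constraints: some nontrivial combination
   satisfies all of them. *)
Lemma orthogonal_combination (phi : nat -> 'rV[R]_n -> R[i]) (K : R) (E : seq (L2space R n)) :
  (forall k, test_function (phi k)) ->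
  (forall i j, i != j -> hform (phi i) (phi j) = 0) ->
  (forall i j, i != j -> ip0 (phi i) (phi j) = 0) ->
  (forall k, 0 < ip0 (phi k) (phi k)) ->
  (forall k, hform (phi k) (phi k) <= K * ip0 (phi k) (phi k)) ->
  exists v, [/\ test_function v, 0 < ip0 v v,
    hform v v <= K * ip0 v v & forall e, e \in E -> ip e (cls v) = 0].
Proof.
move=> tphi horth iorth pos hK; pose m := size E.
pose A : 'M[R]_(m.+1, m) := \matrix_(i, k) ip0 (phi i) (nth 0 E k).
have /rowV0Pn[s /sub_kermxP sA s0] : kermx A != 0.
  by rewrite -mxrank_eq0 mxrank_ker subn_eq0 -ltnNge ltnS rank_leq_col.
pose t i := s ord0 (inord i : 'I_m.+1).
have tE (i : 'I_m.+1) : t i = s ord0 i by rewrite /t inord_val.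
have tv := test_comb t tphi m.+1.
exists (comb t phi m.+1); split => //.
- rewrite ip0_comb_diag// lt_neqAle; apply/andP; split; last first.
    by apply: sumr_ge0 => i _; rewrite mulr_ge0 ?sqr_ge0// ltW.
  rewrite eq_sym psumr_neq0; last by move=> i _; rewrite mulr_ge0 ?sqr_ge0// ltW.
  have [i si] : exists i, s ord0 i != 0.
    apply: contrapT => h; case/negP: s0; apply/eqP/rowP => i; rewrite mxE.
    by apply: contrapT => /eqP si; apply: h; exists i.
  apply/hasP; exists i; rewrite ?mem_index_enum//=.
  by rewrite mulr_gt0// exprn_even_gt0//= tE.
- rewrite (hform_comb_diag ma ba mV V0 iV)// ip0_comb_diag// mulr_sumr; apply: ler_sum => i _.
  by rewrite mulrCA; apply: ler_wpM2l => //; exact: sqr_ge0.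
move=> e eE; have Lv := L2_test tv.
rewrite ipC ip_clsl// ip0_comb//; last exact: L2val_L2.
have ei : (index e E < m)%N by rewrite index_mem.
have := congr1 (fun B : 'rV[R]_m => B ord0 (Ordinal ei)) sA; rewrite !mxE => h.
rewrite -[RHS]h; apply: eq_bigr => i _; rewrite mxE /= nth_index//.
by rewrite -tE.
Qed.

End orthogonal_sequence.

Section cubes.
Local Open Scope complex_scope.
Context {R : realType} {n : nat}.
Local Notation mu := (@lebesgue_rV R n).

Lemma measurable_cube (c : 'rV[R]_n) (d : R) : measurable (cube c d).
Proof.
rewrite (_ : cube c d = cbox (c - const_mx (d / 2)) d).
  rewrite -[X in measurable X]setCK; apply: measurableC; apply: open_measurable_rV.
  by apply: closed_openC; exact: cbox_closed.
by apply/seteqP; split=> x hx i; have := hx i; rewrite /= ?mxE ler_norml; lra.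
Qed.

Lemma norm_le_coord (x : 'rV[R]_n) (s : R) : 0 <= s -> (forall i, `|x ord0 i| <= s) -> `|x| <= s.
Proof.
move=> s0 h; rewrite [leLHS]/Num.norm /= mx_normrE; apply/bigmax_leP; split => // -[i j] _ /=.
by rewrite (ord1 i).
Qed.

Lemma far_cubes_disjoint (c c' x : 'rV[R]_n) (d : R) : 0 <= d -> `|c| + d < `|c'| ->
  cube c d x -> ~ cube c' d x.
Proof.
move=> d0 far hx hx'; have : `|c' - c| <= d.
  apply: norm_le_coord => // i; rewrite !mxE.
  have := hx i; have := hx' i; rewrite !ler_norml; lra.
by have := ler_normD c (c' - c); rewrite addrC subrK; lra.
Qed.

Lemma far_sequence (B : 'rV[R]_n -> Prop) (d : R) : 0 <= d ->
  (forall r : R, exists c, r < `|c| /\ B c) ->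
  exists c : nat -> 'rV[R]_n, (forall k, B (c k)) /\
    forall i j x, i != j -> cube (c i) d x -> ~ cube (c j) d x.
Proof.
move=> d0 /choice[f hf].
(* Each radius is the norm of the previous centre plus [d]; radii increase, so a new cube misses all
   earlier ones. *)
pose r := fix r k := if k is k'.+1 then `|f (r k')| + d else 0.
have rS k : r k.+1 = `|f (r k)| + d by [].
have rle k : r k <= r k.+1 by rewrite rS; have := (hf (r k)).1; lra.
have rmono k l : (k <= l)%N -> r k <= r l.
  move=> /subnKC <-; elim: (l - k)%N => [|m IH]; first by rewrite addn0.
  by rewrite addnS; exact: le_trans IH (rle _).
have key i j x : (i < j)%N -> cube (f (r i)) d x -> ~ cube (f (r j)) d x.
  move=> ij; apply: far_cubes_disjoint => //; rewrite -rS.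
  by apply: le_lt_trans (rmono _ _ ij) _; exact: (hf _).1.
exists (fun k => f (r k)); split => [k|i j x]; first exact: (hf _).2.
by rewrite neq_ltn => /orP[ij|ji]; [exact: key|move=> h h'; exact: (key _ _ _ ji h' h)].
Qed.

(** Failure for one M gives bad cubes arbitrarily far out, hence infinitely many disjoint ones.
    Their test functions vanish off their cubes together with their magnetic gradients, so they are
    orthogonal both in L^2 and for h. *)
Lemma regular_corollary (a : 'rV[R]_n -> 'rV[R]_n) (V : 'rV[R]_n -> R) (d M : R) :
  (forall j, measurable_fun setT (fun x : 'rV[R]_n => a x ord0 j)) ->
  (forall r : R, exists A : R, forall j (x : 'rV[R]_n), bbox r x -> `|a x ord0 j| <= A) ->
  measurable_fun setT V -> (forall x, 0 <= V x) ->
  (forall r : R, mu.-integrable (bbox r) (EFin \o V)) ->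
  discrete_spectrum (magnetic_schrodinger a V) -> 0 < d ->
  exists r : R, forall c : 'rV[R]_n, r < `|c| ->
    (M%:E <= local_energy a (cube c d) +
      ((d ^+ n)^-1)%:E * \int[mu]_(x in cube c d) (V x)%:E)%E.
Proof.
move=> ma ba mV V0 iV hd d0; apply: contrapT => hno.
have far (r : R) : exists c : 'rV[R]_n, r < `|c| /\ (local_energy a (cube c d) +
    ((d ^+ n)^-1)%:E * \int[mu]_(x in cube c d) (V x)%:E < M%:E)%E.
  apply: contrapT => hr; apply: hno; exists r => c rc; rewrite leNgt; apply/negP => hc.
  by apply: hr; exists c.
have [c [badc disj]] := far_sequence (ltW d0) far.
have [K hK] := @bad_cube_test_function R n d M d0.
have /choice[phi hphi] k := hK a V (c k) ma mV V0 (badc k).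
have tphi k : test_function (phi k) by have [] := hphi k.
have sqE k : (\int[mu]_x (sqmod (phi k x))%:E = (ip0 (phi k) (phi k))%:E)%E.
  by rewrite -sqnormE sqnorm_ip0//; exact: L2_test.
have pos k : 0 < ip0 (phi k) (phi k) by have [_ _ _ + _] := hphi k; rewrite sqE lte_fin.
have zero i j x : i != j -> phi i x = 0 \/ phi j x = 0.
  move=> ij; have [ci|nci] := pselect (cube (c i) d x); [right|left].
    by have [_ + _ _ _] := hphi j; apply; exact: disj ij ci.
  by have [_ + _ _ _] := hphi i; exact.
have zerom i j l x : i != j -> (mpart_re a l (phi i) x = 0 /\ mpart_im a l (phi i) x = 0) \/
    (mpart_re a l (phi j) x = 0 /\ mpart_im a l (phi j) x = 0).
  move=> ij; have [ci|nci] := pselect (cube (c i) d x); [right|left].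
    by have [_ _ + _ _] := hphi j; apply; exact: disj ij ci.
  by have [_ _ + _ _] := hphi i; exact.
have cd0 i j x : i != j -> cdot (phi i x) (phi j x) = 0.
  by move=> /(zero _ _ x)[] ->; rewrite /cdot /= ?mul0r ?mulr0 addr0.
have int0 (f : 'rV[R]_n -> R) : (forall x, f x = 0) -> (\int[mu]_x f x = 0)%R.
  by move=> f0; rewrite /Rintegral integral0_eq// => x _; rewrite f0.
(* The absolute value supplies the nonnegativity required of the bound. *)
apply: (discrete_no_bounded_forms (K := `|K|) ma ba mV V0 iV hd (normr_ge0 K)) => E.
apply: (@orthogonal_combination _ _ a V ma ba mV V0 iV phi `|K| E tphi) => //.
- move=> i j ij; apply: int0 => x; rewrite /form_density cd0// mulr0 addr0.
  by apply: big1 => l _; have [[-> ->]|[-> ->]] := zerom i j l x ij; rewrite ?mul0r ?mulr0 addr0.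
- by move=> i j ij; apply: int0 => x; exact: cd0.
- move=> k; have [_ _ _ _] := hphi k; rewrite sqE -EFinM => hk.
  have [mr mi] := measurable_test (tphi k).
  have su : csmooth_on setT (phi k) by have [] := tphi k.
  have me := measurable_energy openT su ma.
  have E0 : form_density a V (phi k) (phi k) =
      fun x => magnetic_energy_density a (phi k) x + V x * sqmod (phi k x).
    apply/funext => x; rewrite energy_densityE /form_density /cdot /sqmod !expr2.
    by congr (_ + _); apply: eq_bigr => l _; rewrite !expr2.
  rewrite -lee_fin -integral_form_density// E0.
  under eq_integral do rewrite EFinD.
  rewrite ge0_integralD//; last first.
  + apply/measurable_EFinP; apply: measurable_funM => //; exact: measurable_sqmod.
  + by move=> x _; rewrite lee_fin mulr_ge0 ?sqmod_ge0.
  + exact/measurable_EFinP.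
  + by move=> x _; rewrite lee_fin energy_density_ge0.
  apply: (le_trans hk); rewrite lee_fin; apply: ler_wpM2r (ler_norm K); exact: ip0_ge0.
Qed.

End cubes.

(* The operator, the local energy and the integral of V only depend on the
   classes of a and V modulo null sets. *)
Section modification.
Local Open Scope complex_scope.
Context {R : realType} {n : nat}.
Local Notation mu := (@lebesgue_rV R n).
Implicit Types (a : 'rV[R]_n -> 'rV[R]_n) (V : 'rV[R]_n -> R) (u v : 'rV[R]_n -> R[i]).

Lemma measurable_form_density2 a V u v : (forall j, measurable_fun setT (fun x : 'rV[R]_n => a x ord0 j)) ->
  measurable_fun setT V -> test_function u -> test_function v ->
  measurable_fun setT (form_density a V u v).
Proof.
move=> ma mV tu tv; apply: measurable_funD.
  apply: measurable_sum => j; have [m1 m2] := measurable_mpart ma j tu.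
  have [m3 m4] := measurable_mpart ma j tv.
  by apply: measurable_funD; exact: measurable_funM.
by apply: measurable_funM => //; exact: measurable_cdot.
Qed.

Lemma magnetic_formE a V u v : test_function u ->
  magnetic_form a V u v = hform a V u v +i* hform a V (cmul (0 -i* 1) u) v.
Proof.
move=> tu; apply/eqP; rewrite eq_complex Re_magnetic_form eqxx /=; apply/eqP.
rewrite /hform; congr Rintegral; apply/funext => x.
transitivity (complex.Im (\sum_(j < n) magnetic_partial a j u x * conjc (magnetic_partial a j v x))
   + complex.Im ((V x)%:C * u x * conjc (v x))).
  by case: (\sum_(_ < _) _) => p q; case: (_ * _ * _).
rewrite /form_density; congr (_ + _).
  have ImS (I : Type) (s : seq I) (F : I -> R[i]) :
      complex.Im (\sum_(i <- s) F i) = \sum_(i <- s) complex.Im (F i).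
    by elim: s => [|i s IH]; rewrite ?big_nil// !big_cons -IH; case: (F i); case: (\sum_(_ <- _) _).
  rewrite ImS; apply: eq_bigr => j _; have [-> ->] := mpart_cmul a (0 -i* 1) j x tu.
  by rewrite !magnetic_partialE /=; ring.
by rewrite /cdot /cmul; case: (u x) => p q; case: (v x) => p' q' /=; ring.
Qed.

Section equal_ae.
Variables (a a' : 'rV[R]_n -> 'rV[R]_n) (V V' : 'rV[R]_n -> R).
Hypothesis ma : forall j, measurable_fun setT (fun x : 'rV[R]_n => a x ord0 j).
Hypothesis ma' : forall j, measurable_fun setT (fun x : 'rV[R]_n => a' x ord0 j).
Hypothesis mV : measurable_fun setT V.
Hypothesis mV' : measurable_fun setT V'.
Hypothesis aa' : {ae mu, forall x, a x = a' x}.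
Hypothesis VV' : {ae mu, forall x, V x = V' x}.

Lemma hform_ae u v : test_function u -> test_function v -> hform a V u v = hform a' V' u v.
Proof.
move=> tu tv; congr fine; apply: ae_eq_integral => //.
- by apply/measurable_EFinP; exact: measurable_form_density2.
- by apply/measurable_EFinP; exact: measurable_form_density2.
apply: ae_impl (ae_and aa' VV') _ => x [ax Vx] _.
rewrite /form_density Vx; congr (_ + _)%:E; apply: eq_bigr => j _.
by rewrite /mpart_re /mpart_im ax.
Qed.

Lemma magnetic_form_ae u v : test_function u -> test_function v ->
  magnetic_form a V u v = magnetic_form a' V' u v.
Proof.
by move=> tu tv; rewrite !magnetic_formE// !hform_ae//; exact: test_cmul.
Qed.

Lemma form_approximates_ae us u : form_approximates a V us u -> form_approximates a' V' us u.
Proof.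
move=> [tu Lu cu hu]; split => // e e0; have [N hN] := hu e e0; exists N => k l Nk Nl.
by rewrite -magnetic_form_ae; [exact: hN|exact: test_sub|exact: test_sub].
Qed.

Lemma closed_form_ae u v z : closed_form a V u v z -> closed_form a' V' u v z.
Proof.
move=> [us [vs [au av c]]]; exists us, vs; split; try exact: form_approximates_ae.
have [tu _ _ _] := au; have [tv _ _ _] := av.
rewrite (_ : (fun k => _) = (fun k => Normc.normc (magnetic_form a V (us k) (vs k) - z)))//.
by apply/funext => k; rewrite magnetic_form_ae.
Qed.

Lemma local_energy_ae (c : 'rV[R]_n) (d : R) : local_energy a (cube c d) = local_energy a' (cube c d).
Proof.
congr ereal_inf; apply: eq_imagel => u [su _ _]; rewrite /rayleigh_quotient; congr (_ * _)%E.
have oQ : open (cube c d)° by exact: open_interior.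
apply: ae_eq_integral.
- exact: open_measurable_rV.
- by apply/measurable_EFinP; exact: measurable_energy.
- by apply/measurable_EFinP; exact: measurable_energy.
by apply: ae_impl aa' _ => x ax _; rewrite !energy_densityE /mpart_re /mpart_im ax.
Qed.

Lemma integral_cube_ae (c : 'rV[R]_n) (d : R) :
  (\int[mu]_(x in cube c d) (V x)%:E = \int[mu]_(x in cube c d) (V' x)%:E)%E.
Proof.
apply: ae_eq_integral.
- exact: measurable_cube.
- by apply/measurable_EFinP; exact: measurable_funTS.
- by apply/measurable_EFinP; exact: measurable_funTS.
by apply: ae_impl VV' _ => x Vx _; rewrite Vx.
Qed.

End equal_ae.

Lemma magnetic_schrodinger_ae a a' V V' :
  (forall j, measurable_fun setT (fun x : 'rV[R]_n => a x ord0 j)) ->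
  (forall j, measurable_fun setT (fun x : 'rV[R]_n => a' x ord0 j)) ->
  measurable_fun setT V -> measurable_fun setT V' ->
  {ae mu, forall x, a x = a' x} -> {ae mu, forall x, V x = V' x} ->
  magnetic_schrodinger a V = magnetic_schrodinger a' V'.
Proof.
move=> ma ma' mV mV' aa' VV'.
have a'a : {ae mu, forall x, a' x = a x} by apply: ae_impl aa' _ => x.
have V'V : {ae mu, forall x, V' x = V x} by apply: ae_impl VV' _ => x.
apply/funext => u; apply/funext => f; apply/propext; split=> -[[us au] Lf cf]; split => //.
- by exists us; exact: (form_approximates_ae ma ma' mV mV').
- move=> v [vs av]; apply: (closed_form_ae ma ma' mV mV') => //; apply: cf; exists vs.
  exact: (form_approximates_ae ma' ma mV' mV).
- by exists us; exact: (form_approximates_ae ma' ma mV' mV).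
- move=> v [vs av]; apply: (closed_form_ae ma' ma mV' mV) => //; apply: cf; exists vs.
  exact: (form_approximates_ae ma ma' mV mV').
Qed.

(** f is set to 0 wherever one of the essential bounds on the boxes of integer radius k fails; these
    are countably many null sets, and every box lies in one of integer radius. *)
Lemma Linfty_loc_modification (f : 'rV[R]_n -> R) : Linfty_loc f ->
  exists g : 'rV[R]_n -> R, [/\ measurable_fun setT g, {ae mu, forall x, f x = g x} &
    forall r : R, exists A : R, forall x, bbox r x -> `|g x| <= A].
Proof.
move=> [mf bf]; have /choice[A hA] (k : nat) := bf _ (@bbox_compact R n k%:R).
pose G k : set 'rV[R]_n := ~` bbox k%:R `|` [set x | `|f x| <= A k].
have mG k : measurable (G k).
  apply: measurableU; first by apply: measurableC; exact: measurable_bbox.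
  have mn : measurable_fun setT (fun x => `|f x|) by exact: measurableT_comp.
  by have := mn measurableT _ (measurable_itv `]-oo, (A k)]); rewrite setTI set_itvE.
pose S : set 'rV[R]_n := \bigcap_k G k.
have mS : measurable S by apply: bigcapT_measurable => k; exact: mG.
exists (fun x => f x * \1_S x); split.
- by apply: measurable_funM => //; exact: measurable_indic.
- apply: ae_impl (ae_foralln hA) _ => x hx.
  rewrite indicE mem_set ?mulr1// => k _; have [bx|nbx] := pselect (bbox k%:R x); [right|by left].
  exact: hx.
move=> r; pose k := (Num.trunc `|r|).+1; exists `|A k| => x bx.
have rk : r <= k%:R.
  by apply: (le_trans (ler_norm r)); apply: ltW; have /truncn_itv/andP[] := normr_ge0 r.
have [Sx|nSx] := pselect (S x); last by rewrite indicE memNset// mulr0 normr0.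
rewrite indicE mem_set// mulr1; have [//|h] := Sx k I.
  by move/(_ (bboxS rk bx)).
by apply: le_trans h _; exact: ler_norm.
Qed.

End modification.

Theorem corollary1p5 (R : realType) (n : nat) (hn : (2 <= n)%N)
    (a : 'rV[R]_n -> 'rV[R]_n) (V : 'rV[R]_n -> R)
    (ha : forall j : 'I_n, Linfty_loc (fun x => a x ord0 j))
    (hV : L1_loc V)
    (hV0 : {ae lebesgue_rV, forall x, 0 <= V x})
    (hdiscrete : discrete_spectrum (magnetic_schrodinger a V)) :
  forall d : R, 0 < d ->
  forall M : R, exists r : R, forall c : 'rV[R]_n, r < `|c| ->
    (M%:E <= local_energy a (cube c d) +
      ((d ^+ n)^-1)%:E * \int[lebesgue_rV]_(x in cube c d) (V x)%:E)%E.
Proof.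
move=> d d0 M.
(* Representatives of a and V for which local boundedness and nonnegativity hold at every point;
   hypothesis and conclusion depend only on the classes. *)
have /choice[g hg] j := Linfty_loc_modification (ha j).
pose a' x : 'rV[R]_n := \row_j g j x.
pose V' x : R := Num.max 0 (V x).
have ma j : measurable_fun setT (fun x : 'rV[R]_n => a x ord0 j) by have [] := ha j.
have ma' j : measurable_fun setT (fun x : 'rV[R]_n => a' x ord0 j).
  rewrite (_ : (fun x => _) = g j); first by have [] := hg j.
  by apply/funext => x; rewrite mxE.
have [mV iV] := hV.
have mV' : measurable_fun setT V' by apply: measurable_maxr.
have aa' : {ae lebesgue_rV, forall x, a x = a' x}.
  have : \forall x \ae (@lebesgue_rV R n), forall j, a x ord0 j = g j x.
    by apply: filter_forall => j; have [] := hg j.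
  by move=> h; apply: ae_impl h _ => x h; apply/rowP => j; rewrite mxE.
have VV' : {ae lebesgue_rV, forall x, V x = V' x}.
  by apply: ae_impl hV0 _ => x Vx; rewrite /V' max_r.
have ba' (r : R) : exists A : R, forall j (x : 'rV[R]_n), bbox r x -> `|a' x ord0 j| <= A.
  have /choice[A hA] j : exists A : R, forall x, bbox r x -> `|g j x| <= A.
    by have [_ _] := hg j; exact.
  exists (\sum_j `|A j|) => j x bx; rewrite mxE; apply: (le_trans (hA j x bx)).
  by apply: (le_trans (ler_norm _)); rewrite (bigD1 j)//= lerDl sumr_ge0.
have V'0 x : 0 <= V' x by rewrite le_max lexx.
have iV' (r : R) : lebesgue_rV.-integrable (bbox r) (EFin \o V').
  have mb := @measurable_bbox R n r.
  apply: le_integrable (iV _ (@bbox_compact R n r)) => //.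
    by apply/measurable_EFinP; exact: measurable_funTS.
  move=> x _; rewrite lee_fin /= ger0_norm// ge_max normr_ge0; exact: ler_norm.
have hd' : discrete_spectrum (magnetic_schrodinger a' V').
  by rewrite -(magnetic_schrodinger_ae ma ma' mV mV' aa' VV').
have [r hr] := regular_corollary M ma' ba' mV' V'0 iV' hd' d0.
exists r => c rc; rewrite (local_energy_ae ma ma' aa') (integral_cube_ae mV mV' VV').
exact: hr.
Qed.
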